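(* Let $A,B$ be Lie algebroids over $M$, $C\to M$ a vector bundle, and let the $2$-representations $(\partial_B:C\to B,\nabla^{AB},\nabla^{AC},R_{AB})$ of $A$ and $(\partial_A:C\to A,\nabla^{BA},\nabla^{BC},R_{BA})$ of $B$ form a matched pair. Then the split $[2]$-manifold $(A\oplus C^* )[-1]\oplus B^*[-2]$, endowed with (i) the semi-direct Lie $2$-algebroid structure given by the Dorfman $2$-representation $(\partial_B\circ\mathrm{pr}_C:C\oplus A^*\to B,\Delta,\nabla,R)$ of $(A\oplus C^*,\rho_A\circ\mathrm{pr}_A)$ with $$\Delta_{(a,\gamma)}(c,\alpha)=(\nabla_ac,\mathcal L_a\alpha+\langle\nabla^*_\cdot\gamma,c\rangle),\qquad\nabla_{(a,\gamma)}b=\nabla_ab,$$ $$R((a_1,\gamma_1),(a_2,\gamma_2))=\bigl(R_{AB}(a_1,a_2),\ -\langle\gamma_2,R_{AB}(a_1,\cdot)\rangle-\langle\gamma_1,R_{AB}(\cdot,a_2)\rangle\bigr),$$ and (ii) the Poisson bracket of degree $-2$ defined by the self-dual $2$-representation $$\bigl(\partial_A\oplus\partial_A^*:C\oplus A^*\to A\oplus C^*,\ \nabla^{BA}\oplus(\nabla^{BC})^*,\ \nabla^{BC}\oplus(\nabla^{BA})^*,\ R_{BA}\oplus(-R_{BA}^* )\bigr)$$ of $B$, is a split Poisson Lie $2$-algebroid. By symmetry (exchanging the roles of $A$ and $B$), the split $[2]$-manifold $(B\oplus C^* )[-1]\oplus A^*[-2]$ also inherits a split Poisson Lie $2$-algebroid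 structure.
   Context: **$2$-representations.** A $2$-representation of a Lie algebroid $A$ on $\partial:E_0\to E_1$: $A$-connections $\nabla^0,\nabla^1$ on $E_0,E_1$ with $\partial\nabla^0=\nabla^1\partial$, and $R\in\Omega^2(A,\mathrm{Hom}(E_1,E_0))$ with $R_{\nabla^0}=R\partial$, $R_{\nabla^1}=\partial R$, $\mathbf d_{\nabla^{\mathrm{Hom}}}R=0$. All connections are written $\nabla$ when the meaning is clear from the indices ($\nabla^{AB}$ is an $A$-connection on $B$, etc.; $R_{AB}\in\Omega^2(A,\mathrm{Hom}(B,C))$, $R_{BA}\in\Omega^2(B,\mathrm{Hom}(A,C))$). **Matched pair.** For all $a,a_i\in\Gamma(A)$, $b,b_i\in\Gamma(B)$, $c,c_i\in\Gamma(C)$: (1) $\nabla_{\partial_Ac_1}c_2-\nabla_{\partial_Bc_2}c_1=-\nabla_{\partial_Ac_2}c_1+\nabla_{\partial_Bc_1}c_2$; (2) $[a,\partial_Ac]=\partial_A(\nabla_ac)-\nabla_{\partial_Bc}a$; (3) $[b,\partial_Bc]=\partial_B(\nabla_bc)-\nabla_{\partial_Ac}b$; (4) $\nabla_b\nabla_ac-\nabla_a\nabla_bc-\nabla_{\nabla_ba}c+\nabla_{\nabla_ab}c=R_{BA}(b,\partial_Bc)a-R_{AB}(a,\partial_Ac)b$; (5) $\partial_A(R_{AB}(a_1,a_2)b)=-\nabla_b[a_1,a_2]+[\nabla_ba_1,a_2]+[a_1,\nabla_ba_2]+\nabla_{\nabla_{a_2}b}a_1-\nabla_{\nabla_{a_1}b}a_2$;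 (6) $\partial_B(R_{BA}(b_1,b_2)a)=-\nabla_a[b_1,b_2]+[\nabla_ab_1,b_2]+[b_1,\nabla_ab_2]+\nabla_{\nabla_{b_2}a}b_1-\nabla_{\nabla_{b_1}a}b_2$; (7) $\mathbf d_{\nabla^A}R_{BA}=\mathbf d_{\nabla^B}R_{AB}\in\Omega^2(A,\wedge^2B^*\otimes C)=\Omega^2(B,\wedge^2A^*\otimes C)$, with $R_{BA}$ seen in $\Omega^1(A,\wedge^2B^*\otimes C)$, $R_{AB}$ in $\Omega^1(B,\wedge^2A^*\otimes C)$ and the induced connections. **Split Poisson Lie $2$-algebroid.** $Q[-1]\oplus B^*[-2]$ has functions generated over $C^\infty(M)$ by $\Gamma(Q^* )$ (degree $1$) and $\Gamma(B)$ (degree $2$). A split Poisson Lie $2$-algebroid structure on it is a degree $1$ derivation $\mathcal Q$ with $\mathcal Q^2=0$ and a graded Poisson bracket of degree $-2$ ($\{\xi,\eta\}=-(-1)^{|\xi||\eta|}\{\eta,\xi\}$, $\{\xi_1,\xi_2\xi_3\}=\{\xi_1,\xi_2\}\xi_3+(-1)^{|\xi_1||\xi_2|}\xi_2\{\xi_1,\xi_3\}$, $\{\xi_1,\{\xi_2,\xi_3\}\}=\{\{\xi_1,\xi_2\},\xi_3\}+(-1)^{|\xi_1||\xi_2|}\{\xi_2,\{\xi_1,\xi_3\}\}$) with $\mathcal Q\{\xi_1,\xi_2\}=\{\mathcal Q\xi_1,\xi_2\}+(-1)^{|\xi_1|}\{\xi_1,\mathcal Q\xi_2\}$. Here $Q=A\oplus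 C^*$, $Q^*=C\oplus A^*$ with the natural pairing. **Homological vector field of a Dorfman $2$-representation.** For an anchored bundle $(Q,\rho_Q)$ and $(\partial_B:Q^*\to B,\Delta,\nabla,R)$ (with $\Delta:\Gamma(Q)\times\Gamma(Q^* )\to\Gamma(Q^* )$, $\nabla$ a linear $Q$-connection on $B$, $R\in\Omega^2(Q,\mathrm{Hom}(B,Q^* ))$), put $\langle[\![q_1,q_2]\!]_\Delta,\tau\rangle=\rho_Q(q_1)\langle q_2,\tau\rangle-\langle q_2,\Delta_{q_1}\tau\rangle$ and $\omega_R(q_1,q_2,q_3)=R(q_1,q_2)^*q_3\in\Gamma(B^* )$. In coordinates $x_j$ and dual frames $(q_i),(\tau_i)$ of $Q,Q^*$, $(\beta_j),(b_j)$ of $B^*,B$: $$\mathcal Q=\sum\rho_Q(q_i)(x_j)\tau_i\partial_{x_j}-\sum_{i<j,k}\langle[\![q_i,q_j]\!]_\Delta,\tau_k\rangle\tau_i\tau_j\partial_{\tau_k}+\sum\langle\partial_B^*\beta_r,\tau_k\rangle b_r\partial_{\tau_k}-\sum_{i<j<k,l}\omega_R(q_i,q_j,q_k)(b_l)\tau_i\tau_j\tau_k\partial_{b_l}-\sum\langle\nabla^*_{q_i}\beta_j,b_l\rangle\tau_ib_j\partial_{b_l}.$$ It is a Dorfman $2$-representation when $\Delta$ is a Dorfman connection ($\Delta_q(f\tau)=f\Delta_q\tau+\rho_Q(q)(f)\tau$, $\Delta_{fq}\tau=f\Delta_q\tau+\langle q,\tau\rangle\rho_Q^*\mathbf df$,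 $\Delta_q\rho_Q^*\mathbf df=\rho_Q^*\mathbf d(\rho_Q(q)f)$), $[\![\cdot,\cdot]\!]_\Delta$ is skew-symmetric, $\partial_B\Delta_q=\nabla_q\partial_B$, $\nabla^*_{\partial_B^*\xi_1}\xi_2+\nabla^*_{\partial_B^*\xi_2}\xi_1=0$, $\partial_BR=R_\nabla$, $R\partial_B=R_\Delta$, $\omega_R$ is totally skew-symmetric and $\mathbf d_{\nabla^*}\omega_R=0$. **Poisson bracket of a self-dual $2$-representation.** A $2$-representation $(\partial_Q:Q^*\to Q,\nabla^Q,\nabla^{Q^*},R_B)$ of $B$ is self-dual if $\partial_Q^*=\partial_Q$, $\nabla^Q,\nabla^{Q^*}$ are dual, $R_B^*=-R_B$. It defines the Poisson bracket $\{f_1,f_2\}=\{f,\tau\}=0$, $\{\tau_1,\tau_2\}=\langle\tau_2,\partial_Q\tau_1\rangle$, $\{b,f\}=\rho_B(b)f$, $\{b,\tau\}=\nabla^{Q^*}_b\tau$, $\{b_1,b_2\}=[b_1,b_2]-R_B(b_1,b_2)$, where $\tau_1\wedge\tau_2\in\Gamma(\wedge^2Q^* )$ is identified with $q\mapsto\langle\tau_1,q\rangle\tau_2-\langle\tau_2,q\rangle\tau_1$. In the claim $(R_{BA}\oplus(-R_{BA}^* ))(b_1,b_2)(a,\gamma)=(R_{BA}(b_1,b_2)a,-R_{BA}(b_1,b_2)^*\gamma)$, $\langle\nabla^*_\cdot\gamma,c\rangle\in\Gamma(A^* )$ is $a'\mapsto\langle\nabla^*_{a'}\gamma,c\rangle$,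 and $\mathcal L$ is the Lie derivative of the Lie algebroid $A$. *)

(* Defs.v *)
From HB Require Import structures.
From mathcomp Require Import all_boot all_order all_algebra generic_quotient.
From mathcomp Require Import all_classical all_reals all_analysis.
From mathcomp Require Import ring.
Import Order.TTheory GRing.Theory Num.Theory numFieldNormedType.Exports.

Set Implicit Arguments.
Unset Strict Implicit.
Unset Printing Implicit Defensive.

Local Open Scope classical_set_scope.
Local Open Scope ring_scope.

Section EuclideanSmooth.
Variables (R : realType) (n : nat).
Implicit Types (U : set 'rV[R]_n) (f g : 'rV[R]_n -> R).

Definition dir (i : 'I_n) : 'rV[R]_n := delta_mx 0 i.

Fixpoint Ck (k : nat) U f : Prop :=
  (forall x, U x -> {for x, continuous f}) /\
  (if k is k'.+1 then
     forall i, (forall x, U x -> derivable f x (dir i)) /\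
               Ck k' U (fun x => 'D_(dir i) f x)
   else True).

Definition smooth_on U f : Prop := forall k, Ck k U f.

Lemma Ck_ext U : open U -> forall k f g,
  (forall x, U x -> f x = g x) -> Ck k U f -> Ck k U g.
Proof.
move=> oU k f g fg.
have nfg (h1 h2 : 'rV[R]_n -> R) x : (forall y, U y -> h1 y = h2 y) -> U x ->
    {near x, h1 =1 h2}.
  by move=> h12 Ux; near=> y; apply: h12; near: y; exact: open_nbhs_nbhs.
have cfg x (h1 h2 : 'rV[R]_n -> R) : (forall y, U y -> h1 y = h2 y) -> U x ->
    {for x, continuous h1} -> {for x, continuous h2}.
  move=> h12 Ux c1; rewrite /prop_for /continuous_at -(h12 x Ux).
  exact: (cvg_trans (@near_eq_cvg _ _ (nbhs x) _ h1 h2 (nfg h1 h2 x h12 Ux)) c1).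
elim: k f g fg => [|k IH] f g fg [cf df]; split=> //.
- by move=> x Ux; apply: (cfg x f g fg Ux (cf x Ux)).
- by move=> x Ux; apply: (cfg x f g fg Ux (cf x Ux)).
- move=> i; have [dfi Cfi] := df i; split.
    by move=> x Ux; apply: (near_eq_derivable (nfg f g x fg Ux)); exact: dfi.
  by apply: IH Cfi => x Ux; apply: near_eq_derive; exact: (nfg f g).
Unshelve. all: by end_near. Qed.

Lemma CkW k U f : Ck k.+1 U f -> Ck k U f.
Proof.
elim: k f => [|k IH] f [cf df]; split=> // i.
by have [dfi Cfi] := df i; split=> //; apply: IH.
Qed.

Lemma Ck_cst k U (c : R) : open U -> Ck k U (fun=> c).
Proof.
move=> oU; elim: k c => [|k IH] c; split=> //.
- by move=> x _; exact: cst_continuous.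
- by move=> x _; exact: cst_continuous.
- move=> i; split; first by move=> x _; exact: derivable_cst.
  apply: (Ck_ext oU _ (IH 0)) => x _.
  by rewrite (_ : (fun=> c) = cst c) // derive_cst.
Qed.

Lemma CkD k U f g : open U -> Ck k U f -> Ck k U g -> Ck k U (f \+ g).
Proof.
move=> oU; elim: k f g => [|k IH] f g [cf df] [cg dg]; split=> //.
- by move=> x Ux; exact: (@continuousD _ _ _ f g x (cf x Ux) (cg x Ux)).
- by move=> x Ux; exact: (@continuousD _ _ _ f g x (cf x Ux) (cg x Ux)).
- move=> i; have [dfi Cfi] := df i; have [dgi Cgi] := dg i; split.
    by move=> x Ux; apply: derivableD; [exact: (dfi x Ux)|exact: (dgi x Ux)].
  apply: (Ck_ext oU _ (IH _ _ Cfi Cgi)) => x Ux.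
  by rewrite -[f \+ g]/(f + g) deriveD //; [exact: (dfi x Ux)|exact: (dgi x Ux)].
Qed.

Lemma CkM k U f g : open U -> Ck k U f -> Ck k U g -> Ck k U (f \* g).
Proof.
move=> oU; elim: k f g => [|k IH] f g Cf Cg.
  case: Cf Cg => cf df [cg dg]; split=> // x Ux.
  by exact: (@continuousM _ _ f g x (cf x Ux) (cg x Ux)).
have Cf' := CkW Cf; have Cg' := CkW Cg.
case: Cf Cg => cf df [cg dg]; split.
  by move=> x Ux; exact: (@continuousM _ _ f g x (cf x Ux) (cg x Ux)).
move=> i; have [dfi Cfi] := df i; have [dgi Cgi] := dg i; split.
  by move=> x Ux; apply: derivableM; [exact: (dfi x Ux)|exact: (dgi x Ux)].
apply: (Ck_ext oU _ (CkD oU (IH _ _ Cf' Cgi) (IH _ _ Cg' Cfi))) => x Ux.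
by rewrite -[f \* g]/(f * g) deriveM //; [exact: (dfi x Ux)|exact: (dgi x Ux)].
Qed.

Lemma smooth_on_cst U c : open U -> smooth_on U (fun=> c).
Proof. by move=> oU k; exact: Ck_cst. Qed.

Lemma smooth_onD U f g :
  open U -> smooth_on U f -> smooth_on U g -> smooth_on U (f \+ g).
Proof. by move=> oU sf sg k; exact: CkD. Qed.

Lemma smooth_onM U f g :
  open U -> smooth_on U f -> smooth_on U g -> smooth_on U (f \* g).
Proof. by move=> oU sf sg k; exact: CkM. Qed.

Lemma smooth_on_ext U f g : open U ->
  (forall x, U x -> f x = g x) -> smooth_on U f -> smooth_on U g.
Proof. by move=> oU fg sf k; exact: (Ck_ext oU fg). Qed.

End EuclideanSmooth.

Record smoothManifold (R : realType) (n : nat) := SmoothManifold {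
  mpoint :> topologicalType;
  m_hausdorff : hausdorff_space mpoint;
  m_second_countable : @second_countable mpoint;
  m_idx : Type;
  m_dom : m_idx -> set mpoint;
  m_cod : m_idx -> set 'rV[R]_n;
  m_chart : m_idx -> mpoint -> 'rV[R]_n;
  m_param : m_idx -> 'rV[R]_n -> mpoint;
  m_dom_open : forall i, open (m_dom i);
  m_cod_open : forall i, open (m_cod i);
  m_chart_cod : forall i x, m_dom i x -> m_cod i (m_chart i x);
  m_param_dom : forall i y, m_cod i y -> m_dom i (m_param i y);
  m_chartK : forall i x, m_dom i x -> m_param i (m_chart i x) = x;
  m_paramK : forall i y, m_cod i y -> m_chart i (m_param i y) = y;
  m_chart_cont : forall i x, m_dom i x -> {for x, continuous (m_chart i)};
  m_param_cont : forall i y, m_cod i y -> {for y, continuous (m_param i)};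
  m_cover : forall x, exists i, m_dom i x;
  m_transition : forall i j (k : 'I_n),
    smooth_on (m_cod i `&` m_param i @^-1` m_dom j)
              (fun y => m_chart j (m_param i y) 0 k) }.

Section Smooth.
Variables (R : realType) (n : nat) (M : smoothManifold R n).

Definition chart_dom (V : set M) (i : m_idx M) : set 'rV[R]_n :=
  m_cod i `&` @m_param R n M i @^-1` V.

Definition msmooth_on (V : set M) (f : M -> R) : Prop :=
  forall i, smooth_on (chart_dom V i) (f \o @m_param R n M i).

Lemma chart_dom_open (V : set M) i : open V -> open (chart_dom V i).
Proof.
move=> oV; rewrite openE => y [cy Vy].
have nV : nbhs (m_param i y) V by apply: open_nbhs_nbhs.
have := @m_param_cont R n M i y cy V nV.
have : nbhs y (m_cod i) by apply: open_nbhs_nbhs; split=> //; exact: m_cod_open.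
exact: filterI.
Qed.

Lemma msmooth_on_cst V c : open V -> msmooth_on V (fun=> c).
Proof. by move=> oV i; apply: smooth_on_cst; exact: chart_dom_open. Qed.

Lemma msmooth_onD V f g :
  open V -> msmooth_on V f -> msmooth_on V g -> msmooth_on V (f \+ g).
Proof.
by move=> oV sf sg i; apply: smooth_onD; [exact: chart_dom_open|apply: sf|apply: sg].
Qed.

Lemma msmooth_onM V f g :
  open V -> msmooth_on V f -> msmooth_on V g -> msmooth_on V (f \* g).
Proof.
by move=> oV sf sg i; apply: smooth_onM; [exact: chart_dom_open|apply: sf|apply: sg].
Qed.

Lemma msmooth_on_ext V f g : open V ->
  (forall x, V x -> f x = g x) -> msmooth_on V f -> msmooth_on V g.
Proof.
move=> oV fg sf i; apply: (smooth_on_ext _ _ (sf i)); first exact: chart_dom_open.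
by move=> y [_ Vy]; apply: fg.
Qed.

Lemma msmooth_onW V W f : open V -> V `<=` W -> open W ->
  msmooth_on W f -> msmooth_on V f.
Proof.
move=> oV VW oW sf i k; have := sf i k; set h := f \o _; clearbody h; clear sf.
elim: k h => [|k IH] h [ch dh]; split=> //.
- by move=> x [cx Vx]; apply: ch; split=> //; apply: VW.
- by move=> x [cx Vx]; apply: ch; split=> //; apply: VW.
- move=> l; have [dl Cl] := dh l; split; last exact: IH.
  by move=> x [cx Vx]; apply: dl; split=> //; apply: VW.
Qed.

Definition smooth_pred : {pred M -> R} := fun f => `[< msmooth_on setT f >].

Record Cinf := MkCinf { cfun :> M -> R; cfunP : cfun \in smooth_pred }.
HB.instance Definition _ := [isSub for cfun].
HB.instance Definition _ := [Choice of Cinf by <:].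

Lemma smooth_subring : subring_closed smooth_pred.
Proof.
have oT : open (@setT M) by exact: openT.
split.
- by apply/asboolP; exact: msmooth_on_cst.
- move=> f g /asboolP sf /asboolP sg; apply/asboolP.
  apply: (msmooth_on_ext oT (f := f \+ ((fun=> -1) \* g))).
    by move=> x _ /=; rewrite mulN1r.
  by apply: msmooth_onD => //; apply: msmooth_onM => //; exact: msmooth_on_cst.
- by move=> f g /asboolP sf /asboolP sg; apply/asboolP; exact: msmooth_onM.
Qed.
HB.instance Definition _ :=
  GRing.SubChoice_isSubComPzRing.Build (M -> R) smooth_pred Cinf smooth_subring.

Lemma cstf_subproof (r : R) : (fun=> r) \in smooth_pred.
Proof. by apply/asboolP; apply: msmooth_on_cst; exact: openT. Qed.
(* The scalars of R act on C^oo(M)-modules through the constant functions. *)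
Definition cstf (r : R) : Cinf := MkCinf (cstf_subproof r).

Lemma CinfP (f g : Cinf) : (forall x, f x = g x) -> f = g.
Proof. by move=> fg; apply: val_inj; apply: funext. Qed.

(* [vb_finite] says that E is a smooth direct summand of a trivial bundle
   M x R^N: v = sum_i eps_i(v) e_i(x) for all v in E_x, with smooth sections e_i
   and smooth linear forms eps_i.  Every smooth vector bundle (of constant rank,
   over a finite-dimensional second countable Hausdorff manifold) has this
   property, by the Serre-Swan theorem. *)
Record vectorBundle := VectorBundle {
  vb_fib :> M -> lmodType R;
  vb_rank : nat;
  vb_idx : Type;
  vb_dom : vb_idx -> set M;
  vb_triv : forall j x, vb_fib x -> 'rV[R]_vb_rank;
  vb_trivI : forall (j : vb_idx) x, 'rV[R]_vb_rank -> vb_fib x;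
  vb_dom_open : forall j, open (vb_dom j);
  vb_cover : forall x, exists j, vb_dom j x;
  vb_triv_linear : forall j x, vb_dom j x -> linear (@vb_triv j x);
  vb_trivK : forall j x, vb_dom j x -> cancel (@vb_triv j x) (@vb_trivI j x);
  vb_trivIK : forall j x, vb_dom j x -> cancel (@vb_trivI j x) (@vb_triv j x);
  vb_transition : forall j j' (v : 'rV[R]_vb_rank) k,
    msmooth_on (vb_dom j `&` vb_dom j')
      (fun x => @vb_triv j' x (@vb_trivI j x v) 0 k);
  vb_smooth := fun s : (forall x, vb_fib x) =>
    forall j k, msmooth_on (vb_dom j) (fun x => @vb_triv j x (s x) 0 k);
  vb_finite : exists (N : nat) (e : 'I_N -> forall x, vb_fib x)
      (eps : 'I_N -> forall x, vb_fib x -> R),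
    [/\ forall i, vb_smooth (e i),
        forall i x, linear (eps i x : vb_fib x -> R^o),
        forall i s, vb_smooth s -> msmooth_on setT (fun x => eps i x (s x)) &
        forall x (v : vb_fib x), v = \sum_(i < N) eps i x v *: e i x] }.

Record Sec (E : vectorBundle) := MkSec {
  sec_fun :> forall x, E x;
  secP : @vb_smooth E sec_fun }.

End Smooth.

Arguments Cinf {R n} M.
Arguments cstf {R n} M r.
Arguments vectorBundle {R n} M.

Section SectionModule.
Variables (R : realType) (n : nat) (M : smoothManifold R n) (E : vectorBundle M).
Local Notation G := (Sec E).

Lemma sec_ext (s t : G) : (forall x, s x = t x) -> s = t.
Proof.
case: s t => [s ps] [t pt] /= st.
have e : s = t by apply: functional_extensionality_dep.
by rewrite e in ps *; congr MkSec; exact: Prop_irrelevance.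
Qed.

HB.instance Definition _ := gen_eqMixin G.
HB.instance Definition _ := gen_choiceMixin G.

Lemma sec0_subproof : vb_smooth (fun x => 0 : E x).
Proof.
move=> j k; apply: (msmooth_on_ext (f := fun=> 0)); first exact: vb_dom_open.
  move=> x jx; have := vb_triv_linear jx (-1) 0 0.
  by rewrite scaler0 addr0 scaleN1r addNr => ->; rewrite mxE.
by apply: msmooth_on_cst; exact: vb_dom_open.
Qed.
Definition sec0 : G := MkSec sec0_subproof.

Lemma secD_subproof (s t : G) : vb_smooth (fun x => s x + t x).
Proof.
move=> j k; have oj := @vb_dom_open _ _ _ E j.
apply: (msmooth_on_ext oj _ (msmooth_onD oj (@secP _ _ _ _ s j k) (@secP _ _ _ _ t j k))).
move=> x jx /=; have := vb_triv_linear jx 1 (s x) (t x).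
by rewrite !scale1r => ->; rewrite mxE.
Qed.
Definition secD (s t : G) : G := MkSec (secD_subproof s t).

Lemma secZ_subproof (f : Cinf M) (s : G) : vb_smooth (fun x => f x *: s x).
Proof.
move=> j k; have oj := @vb_dom_open _ _ _ E j.
have sf : msmooth_on (vb_dom j) f.
  apply: (msmooth_onW oj (@subsetT _ _) openT); exact/asboolP/cfunP.
apply: (msmooth_on_ext oj _ (msmooth_onM oj sf (@secP _ _ _ _ s j k))) => x jx /=.
have := vb_triv_linear jx (f x) (s x) 0; rewrite addr0 => ->.
have := vb_triv_linear jx (-1) 0 0.
by rewrite scaler0 addr0 scaleN1r addNr => ->; rewrite addr0 mxE.
Qed.
Definition secZ (f : Cinf M) (s : G) : G := MkSec (secZ_subproof f s).
Definition secN (s : G) : G := secZ (-1) s.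

Lemma secDA : associative secD.
Proof. by move=> s t u; apply: sec_ext => x /=; rewrite addrA. Qed.
Lemma secDC : commutative secD.
Proof. by move=> s t; apply: sec_ext => x /=; rewrite addrC. Qed.
Lemma sec0D : left_id sec0 secD.
Proof. by move=> s; apply: sec_ext => x /=; rewrite add0r. Qed.
Lemma secND : left_inverse sec0 secN secD.
Proof. by move=> s; apply: sec_ext => x /=; rewrite scaleN1r addNr. Qed.
HB.instance Definition _ := GRing.isZmodule.Build G secDA secDC sec0D secND.

Lemma secZA (f g : Cinf M) s : secZ f (secZ g s) = secZ (f * g) s.
Proof. by apply: sec_ext => x /=; rewrite scalerA. Qed.
Lemma sec1Z : left_id 1 secZ.
Proof. by move=> s; apply: sec_ext => x /=; rewrite scale1r. Qed.
Lemma secZDr : right_distributive secZ +%R.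
Proof. by move=> f s t; apply: sec_ext => x /=; rewrite scalerDr. Qed.
Lemma secZDl s : {morph secZ^~ s : f g / f + g}.
Proof. by move=> f g; apply: sec_ext => x /=; rewrite scalerDl. Qed.
HB.instance Definition _ :=
  GRing.Zmodule_isLmodule.Build (Cinf M) G secZA sec1Z secZDr secZDl.
End SectionModule.

(* For a vector bundle E with section module V over K = C^oo(M), [dual V] is the
   module of sections of E^*. *)
Section Dual.
Variables (K : comPzRingType) (V : lmodType K).

Record dual := MkDual {
  dual_fun :> V -> K;
  dual_linear : forall (f : K) u v, dual_fun (f *: u + v) = f * dual_fun u + dual_fun v }.

Lemma dual_ext (a b : dual) : (forall v, a v = b v) -> a = b.
Proof.
case: a b => [a pa] [b pb] /= ab; have e : a = b by apply: funext.
by rewrite e in pa *; congr MkDual; exact: Prop_irrelevance.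
Qed.

HB.instance Definition _ := gen_eqMixin dual.
HB.instance Definition _ := gen_choiceMixin dual.

Lemma dual0_subproof (f : K) (u v : V) : 0 = f * 0 + 0 :> K.
Proof. by rewrite mulr0 addr0. Qed.
Definition dual0 := MkDual dual0_subproof.
Lemma dualD_subproof (a b : dual) (f : K) u v :
  a (f *: u + v) + b (f *: u + v) = f * (a u + b u) + (a v + b v).
Proof. by rewrite !dual_linear mulrDr addrACA. Qed.
Definition dualD a b := MkDual (dualD_subproof a b).
Lemma dualZ_subproof (g : K) (a : dual) (f : K) u v :
  g * a (f *: u + v) = f * (g * a u) + g * a v.
Proof. by rewrite dual_linear mulrDr mulrCA. Qed.
Definition dualZ g a := MkDual (dualZ_subproof g a).
Definition dualN := dualZ (-1).

Lemma dualDA : associative dualD.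
Proof. by move=> a b c; apply: dual_ext => v /=; rewrite addrA. Qed.
Lemma dualDC : commutative dualD.
Proof. by move=> a b; apply: dual_ext => v /=; rewrite addrC. Qed.
Lemma dual0D : left_id dual0 dualD.
Proof. by move=> a; apply: dual_ext => v /=; rewrite add0r. Qed.
Lemma dualND : left_inverse dual0 dualN dualD.
Proof. by move=> a; apply: dual_ext => v /=; rewrite mulN1r addNr. Qed.
HB.instance Definition _ := GRing.isZmodule.Build dual dualDA dualDC dual0D dualND.

Lemma dualZA (f g : K) a : dualZ f (dualZ g a) = dualZ (f * g) a.
Proof. by apply: dual_ext => v /=; rewrite mulrA. Qed.
Lemma dual1Z : left_id 1 dualZ.
Proof. by move=> a; apply: dual_ext => v /=; rewrite mul1r. Qed.
Lemma dualZDr : right_distributive dualZ +%R.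
Proof. by move=> f a b; apply: dual_ext => v /=; rewrite mulrDr. Qed.
Lemma dualZDl a : {morph dualZ^~ a : f g / f + g}.
Proof. by move=> f g; apply: dual_ext => v /=; rewrite mulrDl. Qed.
HB.instance Definition _ :=
  GRing.Zmodule_isLmodule.Build K dual dualZA dual1Z dualZDr dualZDl.

Lemma dual_add (a : dual) u v : a (u + v) = a u + a v.
Proof. by have := dual_linear a 1 u v; rewrite scale1r mul1r. Qed.
Lemma dual_zero (a : dual) : a 0 = 0.
Proof. by have := dual_linear a (-1) 0 0; rewrite scaleN1r addNr mulN1r addNr. Qed.
Lemma dual_scale (a : dual) f u : a (f *: u) = f * a u.
Proof. by have := dual_linear a f u 0; rewrite dual_zero !addr0. Qed.
End Dual.

(* The functions on Q[-1] + B'[-2]: the free graded commutative algebra over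
   K = C^oo(M) generated by W = Gamma(Q') in degree 1 and V = Gamma(B) in degree
   2, where ' denotes the dual bundle.  It is isomorphic to
   Gamma(/\Q' (x) S B) and is built as a quotient of formal expressions. *)
Section GradedFunctions.
Local Open Scope quotient_scope.
Variables (K : comPzRingType) (W V : lmodType K).

Inductive gterm :=
  | TScal of K
  | TGen1 of W
  | TGen2 of V
  | TAdd of gterm & gterm
  | TMul of gterm & gterm.

Inductive gequiv : gterm -> gterm -> Prop :=
  | ge_refl x : gequiv x x
  | ge_sym x y : gequiv x y -> gequiv y x
  | ge_trans x y z : gequiv x y -> gequiv y z -> gequiv x z
  | ge_add x x' y y' : gequiv x x' -> gequiv y y' -> gequiv (TAdd x y) (TAdd x' y')
  | ge_mul x x' y y' : gequiv x x' -> gequiv y y' -> gequiv (TMul x y) (TMul x' y')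
  | ge_addA x y z : gequiv (TAdd x (TAdd y z)) (TAdd (TAdd x y) z)
  | ge_addC x y : gequiv (TAdd x y) (TAdd y x)
  | ge_add0 x : gequiv (TAdd (TScal 0) x) x
  | ge_addN x : gequiv (TAdd (TMul (TScal (-1)) x) x) (TScal 0)
  | ge_mulA x y z : gequiv (TMul x (TMul y z)) (TMul (TMul x y) z)
  | ge_mul1 x : gequiv (TMul (TScal 1) x) x
  | ge_mulDl x y z : gequiv (TMul (TAdd x y) z) (TAdd (TMul x z) (TMul y z))
  | ge_mulDr x y z : gequiv (TMul x (TAdd y z)) (TAdd (TMul x y) (TMul x z))
  | ge_scalD f g : gequiv (TScal (f + g)) (TAdd (TScal f) (TScal g))
  | ge_scalM f g : gequiv (TScal (f * g)) (TMul (TScal f) (TScal g))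
  | ge_gen1 (f : K) u v :
      gequiv (TGen1 (f *: u + v)) (TAdd (TMul (TScal f) (TGen1 u)) (TGen1 v))
  | ge_gen2 (f : K) u v :
      gequiv (TGen2 (f *: u + v)) (TAdd (TMul (TScal f) (TGen2 u)) (TGen2 v))
  | ge_comm0 f x : gequiv (TMul (TScal f) x) (TMul x (TScal f))
  | ge_comm1 u v : gequiv (TMul (TGen1 u) (TGen1 v))
                          (TMul (TScal (-1)) (TMul (TGen1 v) (TGen1 u)))
  | ge_comm2 v x : gequiv (TMul (TGen2 v) x) (TMul x (TGen2 v)).

HB.instance Definition _ := gen_eqMixin gterm.
HB.instance Definition _ := gen_choiceMixin gterm.

Definition gequivb (x y : gterm) : bool := `[< gequiv x y >].
Lemma gequivb_refl : reflexive gequivb.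
Proof. by move=> x; apply/asboolP; exact: ge_refl. Qed.
Lemma gequivb_sym : symmetric gequivb.
Proof. by move=> x y; apply/asboolP/asboolP; exact: ge_sym. Qed.
Lemma gequivb_trans : transitive gequivb.
Proof.
by move=> y x z /asboolP xy /asboolP yz; apply/asboolP; exact: ge_trans yz.
Qed.
Canonical gequivb_equiv := EquivRel gequivb gequivb_refl gequivb_sym gequivb_trans.

Definition gfun : Type := {eq_quot gequivb}.
HB.instance Definition _ := Choice.on gfun.

Definition gpi (x : gterm) : gfun := \pi_{eq_quot gequivb} x.

Lemma gpiP x y : gequiv x y -> gpi x = gpi y.
Proof. by move=> xy; apply/eqmodP/asboolP. Qed.
Lemma gpi_inj x y : gpi x = gpi y -> gequiv x y.
Proof. by move=> /eqmodP/asboolP. Qed.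
Lemma gpiK (x : gfun) : gpi (repr x) = x.
Proof. exact: reprK. Qed.
Lemma gfunW (P : gfun -> Prop) : (forall x, P (gpi x)) -> forall x, P x.
Proof. by move=> H x; rewrite -(gpiK x). Qed.
Lemma repr_gpi x : gequiv (repr (gpi x)) x.
Proof. by apply: gpi_inj; exact: gpiK. Qed.

Definition gadd (x y : gfun) : gfun := gpi (TAdd (repr x) (repr y)).
Definition gmul (x y : gfun) : gfun := gpi (TMul (repr x) (repr y)).
Definition gopp (x : gfun) : gfun := gpi (TMul (TScal (-1)) (repr x)).

Lemma gaddE x y : gadd (gpi x) (gpi y) = gpi (TAdd x y).
Proof. by apply: gpiP; apply: ge_add; exact: repr_gpi. Qed.
Lemma gmulE x y : gmul (gpi x) (gpi y) = gpi (TMul x y).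
Proof. by apply: gpiP; apply: ge_mul; exact: repr_gpi. Qed.
Lemma goppE x : gopp (gpi x) = gpi (TMul (TScal (-1)) x).
Proof. by apply: gpiP; apply: ge_mul; [exact: ge_refl|exact: repr_gpi]. Qed.

Lemma gaddA : associative gadd.
Proof.
elim/gfunW=> x; elim/gfunW=> y; elim/gfunW=> z.
by rewrite !gaddE; apply: gpiP; exact: ge_addA.
Qed.
Lemma gaddC : commutative gadd.
Proof.
by elim/gfunW=> x; elim/gfunW=> y; rewrite !gaddE; apply: gpiP; exact: ge_addC.
Qed.
Lemma gadd0 : left_id (gpi (TScal 0)) gadd.
Proof. by elim/gfunW=> x; rewrite gaddE; apply: gpiP; exact: ge_add0. Qed.
Lemma gaddN : left_inverse (gpi (TScal 0)) gopp gadd.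
Proof. by elim/gfunW=> x; rewrite goppE gaddE; apply: gpiP; exact: ge_addN. Qed.
HB.instance Definition _ := GRing.isZmodule.Build gfun gaddA gaddC gadd0 gaddN.

Lemma gmulA : associative gmul.
Proof.
elim/gfunW=> x; elim/gfunW=> y; elim/gfunW=> z.
by rewrite !gmulE; apply: gpiP; exact: ge_mulA.
Qed.
Lemma gmul1l : left_id (gpi (TScal 1)) gmul.
Proof. by elim/gfunW=> x; rewrite gmulE; apply: gpiP; exact: ge_mul1. Qed.
Lemma gmul1r : right_id (gpi (TScal 1)) gmul.
Proof.
elim/gfunW=> x; rewrite gmulE; apply: gpiP.
exact: ge_trans (ge_sym (ge_comm0 _ _)) (ge_mul1 _).
Qed.
Lemma gmulDl : left_distributive gmul +%R.
Proof.
elim/gfunW=> x; elim/gfunW=> y; elim/gfunW=> z.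
by rewrite /+%R /= !(gaddE, gmulE); apply: gpiP; exact: ge_mulDl.
Qed.
Lemma gmulDr : right_distributive gmul +%R.
Proof.
elim/gfunW=> x; elim/gfunW=> y; elim/gfunW=> z.
by rewrite /+%R /= !(gaddE, gmulE); apply: gpiP; exact: ge_mulDr.
Qed.
HB.instance Definition _ :=
  GRing.Zmodule_isPzRing.Build gfun gmulA gmul1l gmul1r gmulDl gmulDr.

Definition gscal (f : K) : gfun := gpi (TScal f).
Definition gen1 (t : W) : gfun := gpi (TGen1 t).
Definition gen2 (b : V) : gfun := gpi (TGen2 b).

Inductive gdeg : nat -> gfun -> Prop :=
  | gdeg_scal f : gdeg 0 (gscal f)
  | gdeg_gen1 t : gdeg 1 (gen1 t)
  | gdeg_gen2 b : gdeg 2 (gen2 b)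
  | gdeg0 k : gdeg k 0
  | gdegD k x y : gdeg k x -> gdeg k y -> gdeg k (x + y)
  | gdegM k l x y : gdeg k x -> gdeg l y -> gdeg (k + l) (x * y).

Lemma gscalD f g : gscal (f + g) = gscal f + gscal g.
Proof. by rewrite [RHS]gaddE; apply: gpiP; exact: ge_scalD. Qed.
Lemma gscal0 : gscal 0 = 0.
Proof. by []. Qed.
Lemma gscalN f : gscal (- f) = - gscal f.
Proof. by apply: (addIr (gscal f)); rewrite -gscalD !addNr. Qed.
Lemma gen2_linear (f : K) u v : gen2 (f *: u + v) = gscal f * gen2 u + gen2 v.
Proof. by rewrite [gscal f * _]gmulE [RHS]gaddE; apply: gpiP; exact: ge_gen2. Qed.
Lemma gen2_0 : gen2 0 = 0.
Proof.
have := gen2_linear (-1) 0 0; rewrite scaler0 addr0 gscalN mulNr.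
by rewrite (_ : gscal 1 = 1) // mul1r addNr.
Qed.
Lemma gen2_sum N (f : 'I_N -> K) (u : 'I_N -> V) :
  gen2 (\sum_(i < N) f i *: u i) = \sum_(i < N) gscal (f i) * gen2 (u i).
Proof.
apply: (big_ind2 (fun v g => gen2 v = g)) => [|x1 x2 y1 y2 <- <-|i _]; first exact: gen2_0.
  by have := gen2_linear 1 x1 y1; rewrite scale1r (_ : gscal 1 = 1) // mul1r.
by have := gen2_linear (f i) (u i) 0; rewrite gen2_0 !addr0.
Qed.
Lemma gscal_comm f x : gscal f * x = x * gscal f.
Proof. by elim/gfunW: x => x; rewrite [LHS]gmulE [RHS]gmulE; apply: gpiP; exact: ge_comm0. Qed.
End GradedFunctions.

Section Algebroids.
Variables (R : realType) (n : nat) (M : smoothManifold R n).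
Local Notation K := (Cinf M).

Record is_vector_field (X : K -> K) : Prop := {
  vf_add : forall f g, X (f + g) = X f + X g;
  vf_scale : forall r f, X (cstf M r * f) = cstf M r * X f;
  vf_leibniz : forall f g, X (f * g) = X f * g + f * X g }.

Lemma vf_nat (X : K -> K) (b : bool) : is_vector_field X -> X b%:R = 0.
Proof.
have dbl (x : K) : x = x + x -> x = 0.
  by move=> e; apply: (addrI x); rewrite -e addr0.
move=> XP; case: b => /=; apply: dbl.
  by have := vf_leibniz XP 1 1; rewrite !mulr1 mul1r.
by have := vf_add XP 0 0; rewrite !addr0.
Qed.

(* The anchor V -> TM is encoded by its action on functions, rho v f = rho(v)(f). *)
Record is_anchor (V : lmodType K) (rho : V -> K -> K) : Prop := {
  anchor_vf : forall v, is_vector_field (rho v);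
  anchor_linear : forall (f : K) u v g, rho (f *: u + v) g = f * rho u g + rho v g }.

Record is_lie_algebroid (V : lmodType K) (rho : V -> K -> K) (br : V -> V -> V) :
    Prop := {
  la_anchor : is_anchor rho;
  la_addr : forall u v w, br u (v + w) = br u v + br u w;
  la_skew : forall u v, br u v = - br v u;
  la_jacobi : forall u v w, br u (br v w) = br (br u v) w + br v (br u w);
  la_leibniz : forall u (f : K) v, br u (f *: v) = f *: br u v + rho u f *: v;
  la_morph : forall u v f, rho (br u v) f = rho u (rho v f) - rho v (rho u f) }.

Record lieAlgebroid := LieAlgebroid {
  la_bundle :> vectorBundle M;
  la_rho : Sec la_bundle -> K -> K;
  la_br : Sec la_bundle -> Sec la_bundle -> Sec la_bundle;
  la_axioms : is_lie_algebroid la_rho la_br }.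

Record is_connection (V E : lmodType K) (rho : V -> K -> K) (nab : V -> E -> E) :
    Prop := {
  conn_add : forall v e e', nab v (e + e') = nab v e + nab v e';
  conn_leibniz : forall v (f : K) e, nab v (f *: e) = f *: nab v e + rho v f *: e;
  conn_linear : forall (f : K) u v e, nab (f *: u + v) e = f *: nab u e + nab v e }.

Definition is_linear (E F : lmodType K) (d : E -> F) : Prop :=
  forall (f : K) u v, d (f *: u + v) = f *: d u + d v.

Record is_hom_2form (V E F : lmodType K) (w : V -> V -> E -> F) : Prop := {
  h2_linear : forall u v, is_linear (w u v);
  h2_form : forall (f : K) u u' v e, w (f *: u + u') v e = f *: w u v e + w u' v e;
  h2_skew : forall u v e, w u v e = - w v u e }.

Definition curvature (V E : lmodType K) (br : V -> V -> V) (nab : V -> E -> E) u v e :=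
  nab u (nab v e) - nab v (nab u e) - nab (br u v) e.

Definition koszul1 (V : lmodType K) (E : zmodType) (br : V -> V -> V)
    (nab : V -> E -> E) (w : V -> E) (u1 u2 : V) : E :=
  nab u1 (w u2) - nab u2 (w u1) - w (br u1 u2).

Definition koszul2 (V : lmodType K) (E : zmodType) (br : V -> V -> V)
    (nab : V -> E -> E) (w : V -> V -> E) (u1 u2 u3 : V) : E :=
  nab u1 (w u2 u3) - nab u2 (w u1 u3) + nab u3 (w u1 u2)
  - w (br u1 u2) u3 + w (br u1 u3) u2 - w (br u2 u3) u1.

Definition koszul3 (V : lmodType K) (E : zmodType) (br : V -> V -> V)
    (nab : V -> E -> E) (w : V -> V -> V -> E) (u1 u2 u3 u4 : V) : E :=
  nab u1 (w u2 u3 u4) - nab u2 (w u1 u3 u4) + nab u3 (w u1 u2 u4)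
  - nab u4 (w u1 u2 u3)
  - w (br u1 u2) u3 u4 + w (br u1 u3) u2 u4 - w (br u1 u4) u2 u3
  - w (br u2 u3) u1 u4 + w (br u2 u4) u1 u3 - w (br u3 u4) u1 u2.

Definition nabla_hom (V E F : lmodType K) (nabE : V -> E -> E) (nabF : V -> F -> F)
    (v : V) (phi : E -> F) : E -> F :=
  fun e => nabF v (phi e) - phi (nabE v e).

Record is_2rep (V E0 E1 : lmodType K) (rho : V -> K -> K) (br : V -> V -> V)
    (d : E0 -> E1) (nab0 : V -> E0 -> E0) (nab1 : V -> E1 -> E1)
    (w : V -> V -> E1 -> E0) : Prop := {
  tr_linear : is_linear d;
  tr_conn0 : is_connection rho nab0;
  tr_conn1 : is_connection rho nab1;
  tr_2form : is_hom_2form w;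
  tr_chain : forall v e, d (nab0 v e) = nab1 v (d e);
  tr_curv0 : forall u v e, curvature br nab0 u v e = w u v (d e);
  tr_curv1 : forall u v e, curvature br nab1 u v e = d (w u v e);
  tr_closed : forall u1 u2 u3 e, koszul2 br (nabla_hom nab1 nab0) w u1 u2 u3 e = 0 }.

Record twoRep (A : lieAlgebroid) (E0 E1 : lmodType K) := TwoRep {
  tr_d : E0 -> E1;
  tr_nab0 : Sec A -> E0 -> E0;
  tr_nab1 : Sec A -> E1 -> E1;
  tr_R : Sec A -> Sec A -> E1 -> E0;
  tr_axioms : is_2rep (@la_rho A) (@la_br A) tr_d tr_nab0 tr_nab1 tr_R }.

Definition nabla_alt2 (V B C : lmodType K) (nabB : V -> B -> B) (nabC : V -> C -> C)
    (v : V) (S : B -> B -> C) : B -> B -> C :=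
  fun b1 b2 => nabC v (S b1 b2) - S (nabB v b1) b2 - S b1 (nabB v b2).

Record matched_pair (A B : lieAlgebroid) (C : vectorBundle M)
    (DA : twoRep A (Sec C) (Sec B)) (DB : twoRep B (Sec C) (Sec A)) : Prop := {
  mp1 : forall c1 c2,
    tr_nab0 DA (tr_d DB c1) c2 - tr_nab0 DB (tr_d DA c2) c1
    = - tr_nab0 DA (tr_d DB c2) c1 + tr_nab0 DB (tr_d DA c1) c2;
  mp2 : forall a c,
    la_br a (tr_d DB c) = tr_d DB (tr_nab0 DA a c) - tr_nab1 DB (tr_d DA c) a;
  mp3 : forall b c,
    la_br b (tr_d DA c) = tr_d DA (tr_nab0 DB b c) - tr_nab1 DA (tr_d DB c) b;
  mp4 : forall a b c,
    tr_nab0 DB b (tr_nab0 DA a c) - tr_nab0 DA a (tr_nab0 DB b c)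
    - tr_nab0 DA (tr_nab1 DB b a) c + tr_nab0 DB (tr_nab1 DA a b) c
    = tr_R DB b (tr_d DA c) a - tr_R DA a (tr_d DB c) b;
  mp5 : forall a1 a2 b,
    tr_d DB (tr_R DA a1 a2 b)
    = - tr_nab1 DB b (la_br a1 a2) + la_br (tr_nab1 DB b a1) a2
      + la_br a1 (tr_nab1 DB b a2)
      + tr_nab1 DB (tr_nab1 DA a2 b) a1 - tr_nab1 DB (tr_nab1 DA a1 b) a2;
  mp6 : forall b1 b2 a,
    tr_d DA (tr_R DB b1 b2 a)
    = - tr_nab1 DA a (la_br b1 b2) + la_br (tr_nab1 DA a b1) b2
      + la_br b1 (tr_nab1 DA a b2)
      + tr_nab1 DA (tr_nab1 DB b2 a) b1 - tr_nab1 DA (tr_nab1 DB b1 a) b2;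
  mp7 : forall a1 a2 b1 b2,
    koszul1 (@la_br A) (nabla_alt2 (tr_nab1 DA) (tr_nab0 DA))
      (fun a b b' => tr_R DB b b' a) a1 a2 b1 b2
    = koszul1 (@la_br B) (nabla_alt2 (tr_nab1 DB) (tr_nab0 DB))
      (fun b a a' => tr_R DA a a' b) b1 b2 a1 a2 }.

(* A bundle Q is given by V = Gamma(Q), W = Gamma(Q'), and the duality pairing
   V x W -> K. *)
Section DualPair.
Variables (V W : lmodType K) (pair : V -> W -> K).

(* Generators q_i of V and t_i of W with q = sum_i <q, t_i> q_i and
   t = sum_i <q_i, t> t_i: dual frames when Q is trivial; for arbitrary Q such
   finite families exist globally, but need not be linearly independent. *)
Definition dual_frames N (q : 'I_N -> V) (t : 'I_N -> W) : Prop :=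
  (forall x, x = \sum_(i < N) pair x (t i) *: q i) /\
  (forall y, y = \sum_(i < N) pair (q i) y *: t i).

Variable U : lmodType K.

(* the elements sum_{i<j} w(q_i, q_j) t_i t_j and
   sum_{i<j<k} w(q_i, q_j, q_k) t_i t_j t_k attached to alternating forms on Q *)
Definition fun_of_2form N (q : 'I_N -> V) (t : 'I_N -> W) (w : V -> V -> K) : gfun W U :=
  \sum_(i < N) \sum_(j < N | (i < j)%N)
    gscal W U (w (q i) (q j)) * gen1 U (t i) * gen1 U (t j).
Definition fun_of_3form N (q : 'I_N -> V) (t : 'I_N -> W) (w : V -> V -> V -> K) :
    gfun W U :=
  \sum_(i < N) \sum_(j < N | (i < j)%N) \sum_(k < N | (j < k)%N)
    gscal W U (w (q i) (q j) (q k)) * gen1 U (t i) * gen1 U (t j) * gen1 U (t k).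

Section Dorfman.
Variables (rho : V -> K -> K) (d : W -> U) (Delta : V -> W -> W)
  (nab : V -> U -> U) (w : V -> V -> U -> W).

(* <[[q1, q2]]_Delta, t> *)
Definition dull_pairing (q1 q2 : V) (t : W) : K :=
  rho q1 (pair q2 t) - pair q2 (Delta q1 t).

(* omega_R(q1, q2, q3)(b) = <q3, R(q1, q2) b> *)
Definition omega (q1 q2 q3 : V) (b : U) : K := pair q3 (w q1 q2 b).

Definition nabla_star (q : V) (beta : U -> K) : U -> K :=
  fun b => rho q (beta b) - beta (nab q b).

(* [rs] stands for rho_Q^* o d_dR, [br] for [[.,.]]_Delta and [ds] for the
   transpose of d; they are determined by the first three clauses, the pairing of a
   bundle with its dual being perfect. *)
Record dorfman_axioms (rs : K -> W) (br : V -> V -> V) (ds : dual U -> V) : Prop := {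
  dr_rs : forall q f, pair q (rs f) = rho q f;
  dr_br : forall q1 q2 t, pair (br q1 q2) t = dull_pairing q1 q2 t;
  dr_ds : forall beta t, pair (ds beta) t = beta (d t);
  dr_anchor : is_anchor rho;
  dr_linear : is_linear d;
  dr_conn : is_connection rho nab;
  dr_2form : is_hom_2form w;
  dr_addr : forall q t t', Delta q (t + t') = Delta q t + Delta q t';
  dr_addl : forall q q' t, Delta (q + q') t = Delta q t + Delta q' t;
  dr_leibniz : forall q (f : K) t, Delta q (f *: t) = f *: Delta q t + rho q f *: t;
  dr_leibnizl : forall (f : K) q t,
    Delta (f *: q) t = f *: Delta q t + pair q t *: rs f;
  dr_exact : forall q f, Delta q (rs f) = rs (rho q f);
  dr_skew : forall q1 q2, br q1 q2 = - br q2 q1;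
  dr_chain : forall q t, d (Delta q t) = nab q (d t);
  dr_sym : forall (xi1 xi2 : dual U) b,
    nabla_star (ds xi1) xi2 b + nabla_star (ds xi2) xi1 b = 0;
  dr_curv1 : forall q1 q2 b, d (w q1 q2 b) = curvature br nab q1 q2 b;
  dr_curv0 : forall q1 q2 t, w q1 q2 (d t) = curvature br Delta q1 q2 t;
  dr_omega12 : forall q1 q2 q3 b, omega q1 q2 q3 b = - omega q2 q1 q3 b;
  dr_omega23 : forall q1 q2 q3 b, omega q1 q2 q3 b = - omega q1 q3 q2 b;
  dr_closed : forall q1 q2 q3 q4 b, koszul3 br nabla_star omega q1 q2 q3 q4 b = 0 }.

Definition is_dorfman_2rep : Prop := exists rs br ds, dorfman_axioms rs br ds.

(* <d_Q t, (q1, q2)> for the differential of the dull algebroid Q *)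
Definition dull_d (t : W) (q1 q2 : V) : K :=
  rho q1 (pair q2 t) - rho q2 (pair q1 t) - dull_pairing q1 q2 t.

Record is_derivation1 (Q : gfun W U -> gfun W U) : Prop := {
  d1_add : forall x y, Q (x + y) = Q x + Q y;
  d1_scale : forall r x, Q (gscal W U (cstf M r) * x) = gscal W U (cstf M r) * Q x;
  d1_deg : forall k x, gdeg k x -> gdeg k.+1 (Q x);
  d1_leibniz : forall k x y, gdeg k x -> Q (x * y) = Q x * y + (-1) ^+ k * (x * Q y) }.

(* The homological vector field of (d, Delta, nabla, R), as the derivation with the
   following values on generators.  On local dual frames, dull_d t_k (q_i, q_j) =
   - <[[q_i, q_j]], t_k> and <nabla^*_{q_i} beta_j, b_l> =
   - <beta_j, nabla_{q_i} b_l>, which gives the usual coordinate formula (see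
   [homological_vf_frame]); the expressions for arbitrary x and b do not depend on
   the frames, and make sense for the global families of [dual_frames]. *)
Record is_homological_vf (Q : gfun W U -> gfun W U) : Prop := {
  hvf_der : is_derivation1 Q;
  hvf_fun : forall N (q : 'I_N -> V) (t : 'I_N -> W), dual_frames q t ->
    forall f, Q (gscal W U f) = \sum_(i < N) gscal W U (rho (q i) f) * gen1 U (t i);
  hvf_gen1 : forall N (q : 'I_N -> V) (t : 'I_N -> W), dual_frames q t ->
    forall x, Q (gen1 U x) = fun_of_2form q t (dull_d x) + gen2 W (d x);
  hvf_gen2 : forall N (q : 'I_N -> V) (t : 'I_N -> W), dual_frames q t ->
    forall b, Q (gen2 W b) =
      - fun_of_3form q t (fun q1 q2 q3 => omega q1 q2 q3 b)
      + \sum_(i < N) gen1 U (t i) * gen2 W (nab (q i) b) }.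

Lemma homological_vf_frame (Q : gfun W U -> gfun W U) N (q : 'I_N -> V)
    (t : 'I_N -> W) m (beta : 'I_m -> dual U) (bb : 'I_m -> U) :
  is_anchor rho -> is_homological_vf Q -> dual_frames q t ->
  (forall i k, pair (q i) (t k) = (i == k)%:R) ->
  (forall b, b = \sum_(r < m) beta r b *: bb r) ->
  (forall r l, beta r (bb l) = (r == l)%:R) ->
  (forall k, Q (gen1 U (t k)) =
    - (\sum_(i < N) \sum_(j < N | (i < j)%N)
        gscal W U (dull_pairing (q i) (q j) (t k)) * gen1 U (t i) * gen1 U (t j))
    + \sum_(r < m) gscal W U (beta r (d (t k))) * gen2 W (bb r)) /\
  (forall l, Q (gen2 W (bb l)) =
    - (\sum_(i < N) \sum_(j < N | (i < j)%N) \sum_(k < N | (j < k)%N)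
        gscal W U (omega (q i) (q j) (q k) (bb l)) *
        gen1 U (t i) * gen1 U (t j) * gen1 U (t k))
    - \sum_(i < N) \sum_(j < m)
        gscal W U (nabla_star (q i) (beta j) (bb l)) * gen1 U (t i) * gen2 W (bb j)).
Proof.
move=> rhoP QP qt pqt bE bbE; split=> [k|l].
  rewrite (hvf_gen1 QP qt) {1}(bE (d (t k))) gen2_sum; congr (_ + _).
  rewrite /fun_of_2form -sumrN; apply: eq_bigr => i _; rewrite -sumrN.
  apply: eq_bigr => j _; rewrite /dull_d !pqt !(vf_nat _ (anchor_vf rhoP _)).
  by rewrite subrr add0r gscalN !mulNr.
rewrite (hvf_gen2 QP qt); congr (_ + _).
rewrite -sumrN; apply: eq_bigr => i _.
rewrite {1}(bE (nab (q i) (bb l))) gen2_sum big_distrr -sumrN /=.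
apply: eq_bigr => j _; rewrite /nabla_star bbE (vf_nat _ (anchor_vf rhoP _)).
by rewrite add0r gscalN !mulNr opprK mulrA -gscal_comm.
Qed.

End Dorfman.

Section SelfDual.
Variables (rhoB : U -> K -> K) (brB : U -> U -> U) (d : W -> V)
  (nabW : U -> W -> W) (nabV : U -> V -> V) (w : U -> U -> V -> W).

Definition is_self_dual_2rep : Prop :=
  is_2rep rhoB brB d nabW nabV w /\
  [/\ forall t1 t2, pair (d t1) t2 = pair (d t2) t1,
      forall b q t, rhoB b (pair q t) = pair (nabV b q) t + pair q (nabW b t) &
      forall b1 b2 q1 q2, pair q1 (w b1 b2 q2) = - pair q2 (w b1 b2 q1)].

Record is_biderivation2 (br : gfun W U -> gfun W U -> gfun W U) : Prop := {
  bd_addl : forall x y z, br (x + y) z = br x z + br y z;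
  bd_addr : forall x y z, br x (y + z) = br x y + br x z;
  bd_scalel : forall r x y,
    br (gscal W U (cstf M r) * x) y = gscal W U (cstf M r) * br x y;
  bd_scaler : forall r x y,
    br x (gscal W U (cstf M r) * y) = gscal W U (cstf M r) * br x y;
  bd_deg : forall k l m x y, (k + l = m + 2)%N -> gdeg k x -> gdeg l y ->
    gdeg m (br x y);
  bd_deg_neg : forall k l x y, (k + l < 2)%N -> gdeg k x -> gdeg l y -> br x y = 0;
  bd_skew : forall k l x y, gdeg k x -> gdeg l y ->
    br x y = - ((-1) ^+ (k * l) * br y x);
  bd_leibniz : forall k l x y z, gdeg k x -> gdeg l y ->
    br x (y * z) = br x y * z + (-1) ^+ (k * l) * (y * br x z) }.

Definition is_graded_poisson (br : gfun W U -> gfun W U -> gfun W U) : Prop :=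
  is_biderivation2 br /\
  forall k l x y z, gdeg k x -> gdeg l y ->
    br x (br y z) = br (br x y) z + (-1) ^+ (k * l) * br y (br x z).

(* The bracket of a self-dual 2-representation, as the biderivation with the
   following values on generators.  Under the identification of t1 /\ t2 with
   q |-> <t1, q> t2 - <t2, q> t1, the skew map R_B(b1, b2) : Q -> Q' is the 2-form
   (q1, q2) |-> <R_B(b1, b2) q1, q2>. *)
Record is_self_dual_bracket (br : gfun W U -> gfun W U -> gfun W U) : Prop := {
  sdb_bider : is_biderivation2 br;
  sdb_00 : forall f g, br (gscal W U f) (gscal W U g) = 0;
  sdb_01 : forall f t, br (gscal W U f) (gen1 U t) = 0;
  sdb_11 : forall t1 t2, br (gen1 U t1) (gen1 U t2) = gscal W U (pair (d t1) t2);
  sdb_20 : forall b f, br (gen2 W b) (gscal W U f) = gscal W U (rhoB b f);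
  sdb_21 : forall b t, br (gen2 W b) (gen1 U t) = gen1 U (nabW b t);
  sdb_22 : forall N (q : 'I_N -> V) (t : 'I_N -> W), dual_frames q t ->
    forall b1 b2, br (gen2 W b1) (gen2 W b2) =
      gen2 W (brB b1 b2) - fun_of_2form q t (fun q1 q2 => pair q2 (w b1 b2 q1)) }.

End SelfDual.

Definition is_split_lie2 (Q : gfun W U -> gfun W U) : Prop :=
  is_derivation1 Q /\ forall x, Q (Q x) = 0.

Definition is_split_poisson_lie2 (Q : gfun W U -> gfun W U)
    (br : gfun W U -> gfun W U -> gfun W U) : Prop :=
  [/\ is_split_lie2 Q, is_graded_poisson br &
      forall k x y, gdeg k x -> Q (br x y) = br (Q x) y + (-1) ^+ k * br x (Q y)].

End DualPair.

Section DualConstructions.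
Variables (A : lieAlgebroid) (E : lmodType K) (nab : Sec A -> E -> E).
Hypothesis nabP : is_connection (@la_rho A) nab.

Lemma lie_der_subproof (a : Sec A) (alpha : dual (Sec A)) (f : K) u v :
  la_rho a (alpha (f *: u + v)) - alpha (la_br a (f *: u + v))
  = f * (la_rho a (alpha u) - alpha (la_br a u))
    + (la_rho a (alpha v) - alpha (la_br a v)).
Proof.
have lA := la_axioms A; have X := anchor_vf (la_anchor lA) a.
rewrite (la_addr lA) (la_leibniz lA) !(dual_add, dual_scale) (vf_add X) (vf_leibniz X).
ring.
Qed.
Definition lie_der (a : Sec A) (alpha : dual (Sec A)) : dual (Sec A) :=
  MkDual (lie_der_subproof a alpha).

Lemma dual_nabla_subproof (a : Sec A) (gamma : dual E) (f : K) u v :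
  la_rho a (gamma (f *: u + v)) - gamma (nab a (f *: u + v))
  = f * (la_rho a (gamma u) - gamma (nab a u))
    + (la_rho a (gamma v) - gamma (nab a v)).
Proof.
have X := anchor_vf (la_anchor (la_axioms A)) a.
rewrite (conn_add nabP) (conn_leibniz nabP) !(dual_add, dual_scale).
by rewrite (vf_add X) (vf_leibniz X); ring.
Qed.
Definition dual_nabla (a : Sec A) (gamma : dual E) : dual E :=
  MkDual (dual_nabla_subproof a gamma).

Lemma nabla_form_subproof (gamma : dual E) (c : E) (f : K) u v :
  dual_nabla (f *: u + v) gamma c = f * dual_nabla u gamma c + dual_nabla v gamma c.
Proof.
have X := anchor_linear (la_anchor (la_axioms A)).
by rewrite /= X (conn_linear nabP) dual_linear; ring.
Qed.
(* <nabla^*_. gamma, c> *)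
Definition nabla_form (gamma : dual E) (c : E) : dual (Sec A) :=
  MkDual (nabla_form_subproof gamma c).
End DualConstructions.

Lemma transpose_subproof (E F : lmodType K) (d : E -> F) (dP : is_linear d)
    (beta : dual F) (f : K) u v :
  beta (d (f *: u + v)) = f * beta (d u) + beta (d v).
Proof. by rewrite dP dual_linear. Qed.
Definition transpose (E F : lmodType K) (d : E -> F) (dP : is_linear d)
  (beta : dual F) : dual E := MkDual (transpose_subproof dP beta).

Section Contraction.
Variables (V E F : lmodType K) (w : V -> V -> E -> F).
Hypothesis wP : is_hom_2form w.
Lemma contract_subproof (gamma : dual F) (v : V) (e : E) (f : K) u u' :
  gamma (w (f *: u + u') v e) = f * gamma (w u v e) + gamma (w u' v e).
Proof. by rewrite (h2_form wP) dual_linear. Qed.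
Definition contractl (gamma : dual F) (v : V) (e : E) : dual V :=
  MkDual (contract_subproof gamma v e).

Lemma contractr_subproof (gamma : dual F) (v : V) (e : E) (f : K) u u' :
  gamma (w v (f *: u + u') e) = f * gamma (w v u e) + gamma (w v u' e).
Proof.
rewrite !(h2_skew wP v) (h2_form wP) -!scaleN1r !(dual_scale, dual_add).
ring.
Qed.
Definition contractr (gamma : dual F) (v : V) (e : E) : dual V :=
  MkDual (contractr_subproof gamma v e).
End Contraction.

(* Below, Q = A + C' and Q' = C + A', where ' denotes the dual bundle. *)
Section SemiDirect.
Variables (A B : lieAlgebroid) (C : vectorBundle M).
Variables (DA : twoRep A (Sec C) (Sec B)) (DB : twoRep B (Sec C) (Sec A)).

Local Notation VQ := (Sec A * dual (Sec C))%type.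
Local Notation WQ := (Sec C * dual (Sec A))%type.

Definition pairQ (q : VQ) (t : WQ) : K := t.2 q.1 + q.2 t.1.

Definition rhoQ (q : VQ) (f : K) : K := la_rho q.1 f.

Definition sd_d (t : WQ) : Sec B := tr_d DA t.1.

Definition sd_Delta (q : VQ) (t : WQ) : WQ :=
  (tr_nab0 DA q.1 t.1,
   lie_der q.1 t.2 + nabla_form (tr_conn0 (tr_axioms DA)) q.2 t.1).

Definition sd_nabla (q : VQ) (b : Sec B) : Sec B := tr_nab1 DA q.1 b.

Definition sd_R (q1 q2 : VQ) (b : Sec B) : WQ :=
  let RP := tr_2form (tr_axioms DA) in
  (tr_R DA q1.1 q2.1 b, - contractr RP q2.2 q1.1 b - contractl RP q1.2 q2.1 b).

Definition po_d (t : WQ) : VQ :=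
  (tr_d DB t.1, transpose (tr_linear (tr_axioms DB)) t.2).

Definition po_nablaQ (b : Sec B) (q : VQ) : VQ :=
  (tr_nab1 DB b q.1, dual_nabla (tr_conn0 (tr_axioms DB)) b q.2).

Definition po_nablaQd (b : Sec B) (t : WQ) : WQ :=
  (tr_nab0 DB b t.1, dual_nabla (tr_conn1 (tr_axioms DB)) b t.2).

Definition po_R (b1 b2 : Sec B) (q : VQ) : WQ :=
  (tr_R DB b1 b2 q.1, - transpose (h2_linear (tr_2form (tr_axioms DB)) b1 b2) q.2).

(* (A + C')[-1] + B'[-2], with (i) the structure of the Dorfman 2-representation
   (sd_d, sd_Delta, sd_nabla, sd_R) and (ii) the bracket of the self-dual
   2-representation (po_d, po_nablaQ, po_nablaQd, po_R), is a split Poisson Lie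
   2-algebroid. *)
Record carries_split_poisson_lie2 : Prop := {
  cs_dorfman : is_dorfman_2rep pairQ rhoQ sd_d sd_Delta sd_nabla sd_R;
  cs_self_dual :
    is_self_dual_2rep pairQ (@la_rho B) (@la_br B) po_d po_nablaQd po_nablaQ po_R;
  cs_vf : exists Q, is_homological_vf pairQ rhoQ sd_d sd_Delta sd_nabla sd_R Q;
  cs_bracket : exists br,
    is_self_dual_bracket pairQ (@la_rho B) (@la_br B) po_d po_nablaQd po_R br;
  cs_main : forall Q br,
    is_homological_vf pairQ rhoQ sd_d sd_Delta sd_nabla sd_R Q ->
    is_self_dual_bracket pairQ (@la_rho B) (@la_br B) po_d po_nablaQd po_R br ->
    is_split_poisson_lie2 Q br }.
End SemiDirect.
End Algebroids.

(* Main.v *)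
Require Import Defs.
From mathcomp Require Import all_boot all_order all_algebra all_reals.
From mathcomp Require Import boolp functions generic_quotient ring.
Import Order.TTheory GRing.Theory Num.Theory.

(* The functions on Q[-1] + B'[-2], with Q = A + C', carry the contractions i_q for q in Q and
   i_xi for xi in B'. By Euler's formula an element of positive degree killed by all of them
   vanishes. Derivations of the algebra of functions are determined by their values on generators,
   so the square of the homological vector field, the Jacobiator of the bracket and the failure
   of the vector field to be a derivation of the bracket need only be computed on generators;
   there one contracts, using the commutators of the contractions with the vector field (Cartan
   calculus) and with the Hamiltonian derivations, until only identities between functions on M
   remain. For Q^2 = 0 these are the axioms of a Dorfman 2-representation, for the Jacobi identity
   those of a self-dual 2-representation, and for the compatibility they are consequences of
   the matched pair axioms; the latter also force rho_A o d_A = rho_B o d_B on C and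
   [rho_A(a), rho_B(b)] = rho_B(nabla_a b) - rho_A(nabla_b a), by replacing a section with
   a multiple of it. *)

Set Implicit Arguments.
Unset Strict Implicit.
Unset Printing Implicit Defensive.

Local Open Scope ring_scope.

(** * Identities in abelian groups *)

(* [zmodule] proves Z-linear identities by counting atoms: [ring] applies neither to the
   noncommutative ring of graded functions nor to modules of sections. *)

(** The algebra of functions is presented by generators and relations, so little is known about its
    elements at the outset: degrees are not known to be unique, and the frames are mere generating
    families, so that coefficients cannot be compared. Signs are therefore carried by the parity
    automorphism [gpar], defined on every element, and equalities are detected by contractions;
    Euler's formula requires division by the degree, which the real constants provide. The
    contractions, the vector field and the bracket all come from one extension principle, [gder],
    whose conditions mention parities but no degrees. The contractions by sections of Q and B' are
    not stable under commutators with Lie derivatives and Hamiltonian derivations: the curvatures R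
    and R_B add contractions [iW] by maps from B to Q', and these corrections are what produces the
    curvature terms of the axioms. *)

Inductive zexp := ZAtom of nat | ZZero | ZAdd of zexp & zexp | ZOpp of zexp.

Section ZmoduleExpressions.
Variable V : zmodType.

Fixpoint zeval (e : seq V) (z : zexp) : V :=
  match z with
  | ZAtom i => nth 0 e i
  | ZZero => 0
  | ZAdd x y => zeval e x + zeval e y
  | ZOpp x => - zeval e x
  end.

(* The numbers of positive (s = true) and negative occurrences of the i-th atom. *)
Fixpoint zcount (s : bool) (z : zexp) (i : nat) : nat :=
  match z with
  | ZAtom j => s && (i == j)
  | ZZero => 0
  | ZAdd x y => zcount s x i + zcount s y i
  | ZOpp x => zcount (~~ s) x i
  end.

Lemma zeval_count e z :
  zeval e z = \sum_(i < size e) (nth 0 e i *+ zcount true z i - nth 0 e i *+ zcount false z i).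
Proof.
elim: z => [j||x IHx y IHy|x IHx] /=.
- under eq_bigr do rewrite mulr0n subr0.
  case: (ltnP j (size e)) => [lt_j|le_j].
    rewrite (bigD1 (Ordinal lt_j)) //= eqxx big1 ?addr0 // => i.
    by rewrite -val_eqE /= => /negPf->.
  rewrite nth_default // big1 // => i _.
  by rewrite (_ : (i == j :> nat) = false) //; apply/negbTE; rewrite neq_ltn (leq_trans _ le_j).
- by rewrite big1 // => i _; rewrite subrr.
- rewrite IHx IHy -big_split; apply: eq_bigr => i _ /=.
  by rewrite !mulrnDr opprD addrACA.
- by rewrite IHx -sumrN; apply: eq_bigr => i _; rewrite opprB.
Qed.

(** Positive occurrences on one side are added to negative ones on the other, so the test uses only
    sums of natural numbers and is decided by computation. *)
Lemma zeval_eq e z z' :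
  all (fun i => zcount true z i + zcount false z' i == zcount true z' i + zcount false z i)%N
    (iota 0 (size e)) -> zeval e z = zeval e z'.
Proof.
move=> /allP eqz; rewrite !zeval_count; apply: eq_bigr => i _.
have := eqz (val i); rewrite mem_iota add0n ltn_ord => /(_ isT) /eqP eqi.
by apply/eqP; rewrite subr_eq addrAC eq_sym subr_eq -!mulrnDr eqi.
Qed.
End ZmoduleExpressions.

(** Products and scalings are compared factor by factor, with holes for the inferred structures, so
    that atoms which differ only in these count as one; the final [exact] in [zmodule] checks this
    by conversion. *)
Ltac zsame a b :=
  match a with
  | b => idtac
  | (?x * ?y)%R => match b with (?x' * ?y')%R => zsame x x'; zsame y y' end
  | (?f *: ?x)%R => match b with (?g *: ?y)%R => zsame f g; zsame x y end
  | ?f ?x => match b with f ?y => zsame x y end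
  end.
Ltac zindex a l :=
  match l with
  | ?b :: _ => let _ := match goal with _ => zsame a b end in constr:(O)
  | _ :: ?l' => let i := zindex a l' in constr:(S i)
  end.
Ltac zatoms V l t :=
  match t with
  | (?x + ?y)%R => let l' := zatoms V l x in zatoms V l' y
  | (- ?x)%R => zatoms V l x
  | 0%R => l
  | _ => match l with
         | _ => let i := zindex t l in l
         | _ => constr:(@cons V t l)
         end
  end.
Ltac zreify l t :=
  match t with
  | (?x + ?y)%R => let a := zreify l x in let b := zreify l y in constr:(ZAdd a b)
  | (- ?x)%R => let a := zreify l x in constr:(ZOpp a)
  | 0%R => constr:(ZZero)
  | _ => let i := zindex t l in constr:(ZAtom i)
  end.
Ltac zmodule :=
  match goal with
  | |- @eq ?V ?s ?t =>
    let l := zatoms V (@nil V) s in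
    let l := zatoms V l t in
    let z := zreify l s in
    let z' := zreify l t in
    let H := fresh in
    pose proof (@zeval_eq _ l z z' isT) as H;
    cbn [zeval nth] in H; exact H
  end.

(** * Derivations of the algebra of graded functions *)

Section GradedAlgebra.
Variables (K : comPzRingType) (W U : lmodType K).
Local Notation G := (gfun W U).
Implicit Types (x y z : G) (p q : bool) (f g : K) (D E : G -> G).

Lemma gscal1 : gscal W U 1 = 1.
Proof. by []. Qed.

Lemma gscalM f g : gscal W U (f * g) = gscal W U f * gscal W U g.
Proof. by rewrite [RHS]gmulE; apply: gpiP; exact: ge_scalM. Qed.

Lemma gen1_linear f (u v : W) : gen1 U (f *: u + v) = gscal W U f * gen1 U u + gen1 U v.
Proof. by rewrite [gscal W U f * _]gmulE [RHS]gaddE; apply: gpiP; exact: ge_gen1. Qed.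

Lemma gen1_0 : gen1 U (0 : W) = 0.
Proof.
have := gen1_linear (-1) 0 0; rewrite scaler0 addr0 gscalN mulNr.
by rewrite gscal1 mul1r addNr.
Qed.

Lemma gen1D (u v : W) : gen1 U (u + v) = gen1 U u + gen1 U v.
Proof. by have := gen1_linear 1 u v; rewrite scale1r gscal1 mul1r. Qed.

Lemma gen1Z f (u : W) : gen1 U (f *: u) = gscal W U f * gen1 U u.
Proof. by have := gen1_linear f u 0; rewrite gen1_0 !addr0. Qed.

Lemma gen1N (u : W) : gen1 U (- u) = - gen1 U u.
Proof. by rewrite -scaleN1r gen1Z gscalN mulN1r. Qed.

Lemma gen2D (u v : U) : gen2 W (u + v) = gen2 W u + gen2 W v.
Proof. by have := gen2_linear W 1 u v; rewrite scale1r gscal1 mul1r. Qed.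

Lemma gen2Z f (u : U) : gen2 W (f *: u) = gscal W U f * gen2 W u.
Proof. by have := gen2_linear W f u 0; rewrite gen2_0 !addr0. Qed.

Lemma gen2N (u : U) : gen2 W (- u) = - gen2 W u.
Proof. by rewrite -scaleN1r gen2Z gscalN mulN1r. Qed.

Lemma gen11C (u v : W) : gen1 U u * gen1 U v = - (gen1 U v * gen1 U u).
Proof.
have -> : - (gen1 U v * gen1 U u) = gscal W U (-1) * (gen1 U v * gen1 U u).
  by rewrite gscalN mulN1r.
by rewrite [LHS]gmulE [gen1 U v * _]gmulE [RHS]gmulE; apply: gpiP; exact: ge_comm1.
Qed.

Lemma gen2C (b : U) x : gen2 W b * x = x * gen2 W b.
Proof.
elim/gfunW: x => x.
by rewrite [LHS]gmulE [RHS]gmulE; apply: gpiP; exact: ge_comm2.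
Qed.

Lemma gfun_ind (P : G -> Prop) :
  (forall f, P (gscal W U f)) -> (forall u, P (gen1 U u)) -> (forall b, P (gen2 W b)) ->
  (forall x y, P x -> P y -> P (x + y)) -> (forall x y, P x -> P y -> P (x * y)) ->
  forall x, P x.
Proof.
move=> P0 P1 P2 PD PM; elim/gfunW; elim=> // x Px y Py.
  by have := PD _ _ Px Py; rewrite [gpi x + _]gaddE.
by have := PM _ _ Px Py; rewrite [gpi x * _]gmulE.
Qed.

(** Stands in for the decomposition into homogeneous components. The predicate is generalised before
    the induction: for a product, the hypothesis on one factor is applied to the elements whose
    product with the other factor satisfies P. *)
Lemma gdeg_span (P : G -> Prop) :
  (forall k x, gdeg k x -> P x) -> (forall x y, P x -> P y -> P (x + y)) ->
  forall x, P x.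
Proof.
move=> hP DP x; move: P hP DP.
apply: (gfun_ind (P := fun x => forall P : G -> Prop, (forall k x, gdeg k x -> P x) ->
  (forall x y, P x -> P y -> P (x + y)) -> P x)) => {x}.
- by move=> f P hP _; apply: hP; exact: gdeg_scal.
- by move=> u P hP _; apply: hP; exact: gdeg_gen1.
- by move=> b P hP _; apply: hP; exact: gdeg_gen2.
- by move=> x y Px Py P hP DP; apply: (DP _ _ (Px _ hP DP) (Py _ hP DP)).
- move=> x y Px Py P hP DP; apply: (Px (fun x => P (x * y))) => [k x1 kx|x1 x2 P1 P2].
    apply: (Py (fun y => P (x1 * y))) => [l y1 ly|y1 y2 P1 P2].
      by apply: hP; exact: gdegM kx ly.
    by rewrite mulrDr; exact: DP.
  by rewrite mulrDl; exact: DP.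
Qed.

(** * The parity automorphism and graded commutativity *)

Fixpoint tparity (x : gterm W U) : G :=
  match x with
  | TScal f => gscal W U f
  | TGen1 u => - gen1 U u
  | TGen2 b => gen2 W b
  | TAdd x y => tparity x + tparity y
  | TMul x y => tparity x * tparity y
  end.

Lemma tparity_equiv (x y : gterm W U) : gequiv x y -> tparity x = tparity y.
Proof.
elim=> {x y} /=.
- by [].
- by move=> x y _ ->.
- by move=> x y z _ -> _ ->.
- by move=> x x' y y' _ -> _ ->.
- by move=> x x' y y' _ -> _ ->.
- by move=> x y z; rewrite addrA.
- by move=> x y; rewrite addrC.
- by move=> x; rewrite gscal0 add0r.
- by move=> x; rewrite gscalN mulN1r addNr.
- by move=> x y z; rewrite mulrA.
- by move=> x; rewrite gscal1 mul1r.
- by move=> x y z; rewrite mulrDl.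
- by move=> x y z; rewrite mulrDr.
- by move=> f g; rewrite gscalD.
- by move=> f g; rewrite gscalM.
- by move=> f u v; rewrite gen1_linear opprD mulrN.
- by move=> f u v; rewrite gen2_linear.
- by move=> f x; rewrite gscal_comm.
- by move=> u v; rewrite !mulrNN gscalN mulN1r gen11C.
- by move=> b x; rewrite gen2C.
Qed.

(** The automorphism acting by (-1)^k in degree k. It gives a meaning to the signed Leibniz rule on
    all elements, homogeneous or not. *)
Definition gpar x : G := tparity (repr x).

Lemma gpar_pi (t : gterm W U) : gpar (gpi t) = tparity t.
Proof. by apply: tparity_equiv; exact: repr_gpi. Qed.
Lemma gpar_scal f : gpar (gscal W U f) = gscal W U f. Proof. exact: gpar_pi. Qed.
Lemma gpar_gen1 u : gpar (gen1 U u) = - gen1 U u. Proof. exact: gpar_pi. Qed.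
Lemma gpar_gen2 b : gpar (gen2 W b) = gen2 W b. Proof. exact: gpar_pi. Qed.
Lemma gparD x y : gpar (x + y) = gpar x + gpar y.
Proof. by elim/gfunW: x => x; elim/gfunW: y => y; rewrite [_ + _]gaddE !gpar_pi. Qed.
Lemma gparM x y : gpar (x * y) = gpar x * gpar y.
Proof. by elim/gfunW: x => x; elim/gfunW: y => y; rewrite [_ * _]gmulE !gpar_pi. Qed.
Lemma gparN x : gpar (- x) = - gpar x.
Proof. by rewrite -mulN1r -gscal1 -gscalN gparM gpar_scal gscalN mulN1r. Qed.
Lemma gpar0 : gpar 0 = 0.
Proof. by rewrite -gscal0 gpar_scal. Qed.
Lemma gparK x : gpar (gpar x) = x.
Proof.
elim/gfun_ind: x => [f|u|b|x y ex ey|x y ex ey].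
- by rewrite !gpar_scal.
- by rewrite gpar_gen1 gparN gpar_gen1 opprK.
- by rewrite !gpar_gen2.
- by rewrite !gparD ex ey.
- by rewrite !gparM ex ey.
Qed.

Definition gsgn p x := if p then - x else x.
Definition gtw p x := if p then gpar x else x.

Lemma gsgnE k x : (-1) ^+ k * x = gsgn (odd k) x.
Proof. by rewrite -signr_odd; case: odd; rewrite ?mulN1r ?mul1r. Qed.

Lemma gdeg_par k x : gdeg k x -> gpar x = gsgn (odd k) x.
Proof.
elim=> {k x} [f|u|b|k|k x y _ ex _ ey|k l x y _ ex _ ey].
- exact: gpar_scal.
- exact: gpar_gen1.
- exact: gpar_gen2.
- by rewrite gpar0; case: odd; rewrite //= oppr0.
- by rewrite gparD ex ey; case: odd; rewrite //= opprD.
- by rewrite gparM ex ey oddD; do 2!case: odd; rewrite /= ?mulrN ?mulNr ?opprK.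
Qed.

(* Elements of parity p; the second condition is graded commutativity with every x. *)
Definition ghom p z := gpar z = gsgn p z /\ forall x, z * x = gtw p x * z.

Lemma ghom_gen1 u : ghom true (gen1 U u).
Proof.
split=> [|x]; first exact: gpar_gen1.
elim/gfun_ind: x => [f|v|b|x y ex ey|x y ex ey] /=.
- by rewrite gpar_scal gscal_comm.
- by rewrite gpar_gen1 gen11C mulNr.
- by rewrite gpar_gen2 gen2C.
- by rewrite gparD mulrDr mulrDl ex ey.
- by rewrite gparM mulrA ex -mulrA ey mulrA.
Qed.

Lemma ghom0 p : ghom p 0.
Proof. by split=> [|x]; rewrite ?gpar0 ?mul0r ?mulr0; case: p; rewrite //= oppr0. Qed.

Lemma ghomD p x y : ghom p x -> ghom p y -> ghom p (x + y).
Proof.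
move=> [px cx] [py cy]; split=> [|z]; last by rewrite mulrDl mulrDr cx cy.
by rewrite gparD px py; case: (p); rewrite //= opprD.
Qed.

Lemma ghomN p x : ghom p x -> ghom p (- x).
Proof.
move=> [px cx]; split=> [|z]; last by rewrite mulNr mulrN cx.
by rewrite gparN px; case: (p).
Qed.

Lemma ghomM p q x y : ghom p x -> ghom q y -> ghom (p (+) q) (x * y).
Proof.
move=> [px cx] [py cy]; split=> [|z].
  by rewrite gparM px py; case: (p); case: (q); rewrite /= ?mulrN ?mulNr ?opprK.
rewrite -mulrA cy mulrA cx -mulrA; congr (_ * _).
by case: (p); case: (q); rewrite /= ?gparK.
Qed.

Lemma gdeg_hom k x : gdeg k x -> ghom (odd k) x.
Proof.
elim=> {k x} [f|u|b|k|k x y _ ex _ ey|k l x y _ ex _ ey].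
- by split=> [|x]; [exact: gpar_scal|exact: gscal_comm].
- exact: ghom_gen1.
- by split=> [|x]; [exact: gpar_gen2|exact: gen2C].
- exact: ghom0.
- exact: ghomD.
- by rewrite oddD; exact: ghomM.
Qed.

Lemma ghom_scal f : ghom false (gscal W U f).
Proof. exact: (gdeg_hom (gdeg_scal _ _ f)). Qed.
Lemma ghom_gen2 b : ghom false (gen2 W b).
Proof. exact: (gdeg_hom (gdeg_gen2 _ b)). Qed.

Lemma gdegN k x : gdeg k x -> gdeg k (- x).
Proof.
move=> dx; rewrite -mulN1r -[- 1]gscalN -[k]add0n.
by apply: gdegM dx; exact: gdeg_scal.
Qed.

Lemma gdeg_sgn k p x : gdeg k x -> gdeg k (gsgn p x).
Proof. by case: p => //; exact: gdegN. Qed.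

Lemma gdeg_tw k p x : gdeg k x -> gdeg k (gtw p x).
Proof. by case: p => //= dx; rewrite (gdeg_par dx); exact: gdeg_sgn. Qed.

Lemma gdeg_sum k (I : Type) (r : seq I) (P : pred I) (F : I -> G) :
  (forall i, P i -> gdeg k (F i)) -> gdeg k (\sum_(i <- r | P i) F i).
Proof. by move=> hF; apply: big_ind => //; [exact: gdeg0|move=> x y; exact: gdegD]. Qed.

(* x has degree k - s; in particular it vanishes when this is negative. *)
Definition gdegB s k x := if (s <= k)%N then gdeg (k - s) x else x = 0.

Lemma gdegB0 s k : gdegB s k 0.
Proof. by rewrite /gdegB; case: ifP => // _; exact: gdeg0. Qed.
Lemma gdegBD s k x y : gdegB s k x -> gdegB s k y -> gdegB s k (x + y).
Proof. by rewrite /gdegB; case: ifP => _; [exact: gdegD|move=> -> ->; rewrite addr0]. Qed.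
Lemma gdegBMr s k l x y : gdegB s k x -> gdeg l y -> gdegB s (k + l) (x * y).
Proof.
rewrite {1}/gdegB; case: ifP => sk; last by move=> -> _; rewrite mul0r; exact: gdegB0.
move=> dx dy; rewrite /gdegB (leq_trans sk (leq_addr _ _)) -addnBAC //.
exact: gdegM.
Qed.
Lemma gdegBMl s k l x y : gdegB s k x -> gdeg l y -> gdegB s (k + l) (y * x).
Proof.
rewrite {1}/gdegB; case: ifP => sk; last by move=> -> _; rewrite mulr0; exact: gdegB0.
move=> dx dy; rewrite /gdegB (leq_trans sk (leq_addr _ _)) -addnBAC // addnC.
exact: gdegM.
Qed.
Lemma gdegBN s k x : gdegB s k x -> gdegB s k (- x).
Proof. by rewrite /gdegB; case: ifP => _; [exact: gdegN|move=> ->; rewrite oppr0]. Qed.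
Lemma gdegB_sgn s k p x : gdegB s k x -> gdegB s k (gsgn p x).
Proof. by case: p => //; exact: gdegBN. Qed.
Lemma gdegB_hom s k x : gdegB s k x -> ghom (odd k (+) odd s) x.
Proof.
by rewrite /gdegB; case: ifP => [sk /gdeg_hom|_ ->]; [rewrite oddB|exact: ghom0].
Qed.

Lemma gsgn0 p : gsgn p 0 = 0 :> G.
Proof. by case: p; rewrite /= ?oppr0. Qed.
Lemma gsgnD p x y : gsgn p (x + y) = gsgn p x + gsgn p y.
Proof. by case: p; rewrite //= opprD. Qed.
Lemma gtwD p x y : gtw p (x + y) = gtw p x + gtw p y.
Proof. by case: p; rewrite //= gparD. Qed.
Lemma gtwM p x y : gtw p (x * y) = gtw p x * gtw p y.
Proof. by case: p; rewrite //= gparM. Qed.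
Lemma gtw_scal p f : gtw p (gscal W U f) = gscal W U f.
Proof. by case: p; rewrite //= gpar_scal. Qed.
Lemma gtw_gen1 p u : gtw p (gen1 U u) = gsgn p (gen1 U u).
Proof. by case: p; rewrite //= gpar_gen1. Qed.
Lemma gtw_gen2 p b : gtw p (gen2 W b) = gen2 W b.
Proof. by case: p; rewrite //= gpar_gen2. Qed.
Lemma gtw_hom p q x : ghom q x -> gtw p x = gsgn (p && q) x.
Proof. by case: p => //= -[]. Qed.
Lemma gtw_deg p k x : gdeg k x -> gtw p x = gsgn (p && odd k) x.
Proof. by move=> /gdeg_hom; exact: gtw_hom. Qed.

(* Derivations of parity p, for p = true those with D(xy) = D(x)y + (-1)^|x| x D(y). *)
Record sder p D : Prop := {
  sderD : forall x y, D (x + y) = D x + D y;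
  sderM : forall x y, D (x * y) = D x * y + gtw p x * D y;
  sder_par : forall x, D (gpar x) = gsgn p (gpar (D x)) }.

Lemma sder0 p D : sder p D -> D 0 = 0.
Proof. by move=> DP; apply: (addIr (D 0)); rewrite -(sderD DP) !add0r. Qed.
Lemma sderN p D x : sder p D -> D (- x) = - D x.
Proof. by move=> DP; apply: (addIr (D x)); rewrite -(sderD DP) !addNr (sder0 DP). Qed.
Lemma sder_sgn p q D x : sder p D -> D (gsgn q x) = gsgn q (D x).
Proof. by move=> DP; case: q => //=; exact: sderN DP. Qed.
Lemma sder_sum p D (I : Type) (r : seq I) (P : pred I) (F : I -> G) : sder p D ->
  D (\sum_(i <- r | P i) F i) = \sum_(i <- r | P i) D (F i).
Proof. by move=> DP; apply: big_morph; [exact: sderD DP|exact: sder0 DP]. Qed.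
Lemma sder_tw p q D x : sder p D -> D (gtw q x) = gsgn (p && q) (gtw q (D x)).
Proof. by move=> DP; case: q; rewrite ?andbF //= (sder_par DP) andbT. Qed.
Lemma sder_scal p D f x : sder p D -> D (gscal W U f) = 0 ->
  D (gscal W U f * x) = gscal W U f * D x.
Proof. by move=> DP Df; rewrite (sderM DP) Df mul0r add0r gtw_scal. Qed.

Lemma sder_ext p D E : sder p D -> sder p E ->
  (forall f, D (gscal W U f) = E (gscal W U f)) ->
  (forall u, D (gen1 U u) = E (gen1 U u)) ->
  (forall b, D (gen2 W b) = E (gen2 W b)) -> forall x, D x = E x.
Proof.
move=> DP EP e0 e1 e2; elim/gfun_ind=> // x y ex ey.
  by rewrite (sderD DP) (sderD EP) ex ey.
by rewrite (sderM DP) (sderM EP) ex ey.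
Qed.

Lemma sder_zero p : sder p (fun=> 0).
Proof.
split=> [x y|x y|x]; rewrite ?addr0 ?mul0r ?mulr0 ?addr0 //.
by rewrite gpar0 gsgn0.
Qed.

Lemma sder_eq0 p D : sder p D -> (forall f, D (gscal W U f) = 0) ->
  (forall u, D (gen1 U u) = 0) -> (forall b, D (gen2 W b) = 0) -> forall x, D x = 0.
Proof. by move=> DP; exact: sder_ext DP (sder_zero p). Qed.

Lemma sder_add p D E : sder p D -> sder p E -> sder p (fun x => D x + E x).
Proof.
move=> DP EP; split=> [x y|x y|x].
- by rewrite (sderD DP) (sderD EP); zmodule.
- by rewrite (sderM DP) (sderM EP) mulrDl mulrDr; zmodule.
- by rewrite (sder_par DP) (sder_par EP) gparD gsgnD.
Qed.

Lemma sder_opp p D : sder p D -> sder p (fun x => - D x).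
Proof.
move=> DP; split=> [x y|x y|x].
- by rewrite (sderD DP); zmodule.
- by rewrite (sderM DP) mulNr mulrN; zmodule.
- by rewrite (sder_par DP) gparN; case: (p).
Qed.

Lemma sder_sumf p N (D : 'I_N -> G -> G) : (forall i, sder p (D i)) ->
  sder p (fun x => \sum_i D i x).
Proof.
move=> DP; elim: N D DP => [|N IH] D DP.
  have := sder_zero p; congr (sder _ _); apply: funext => x; by rewrite big_ord0.
have := sder_add (DP ord0) (IH (fun i => D (lift ord0 i)) (fun i => DP _)).
by congr (sder _ _); apply: funext => x; rewrite big_ord_recl.
Qed.

Lemma sder_sgnf p q D : sder p D -> sder p (fun x => gsgn q (D x)).
Proof. by case: q => //; exact: sder_opp. Qed.

Lemma sder_mull p q z D : ghom q z -> sder p D -> sder (q (+) p) (fun x => z * D x).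
Proof.
move=> [pz cz] DP; split=> [x y|x y|x].
- by rewrite (sderD DP) mulrDr.
- rewrite (sderM DP) mulrDr !mulrA; congr (_ + _); rewrite cz; congr (_ * _ * _).
  by case: (p); case: (q); rewrite /= ?gparK.
- rewrite (sder_par DP) gparM pz.
  by case: (p); case: (q); rewrite /= ?mulrN ?mulNr ?opprK.
Qed.

Definition scomm p q D E x := D (E x) - gsgn (p && q) (E (D x)).

(** The terms in which D and E hit different factors cancel because [sder_par] moves each derivation
    through the twist produced by the other. *)
Lemma sder_comm p q D E : sder p D -> sder q E -> sder (p (+) q) (scomm p q D E).
Proof.
move=> DP EP; rewrite /scomm; split=> [x y|x y|x].
- by rewrite (sderD EP) (sderD DP) (sderD DP) (sderD EP) gsgnD; zmodule.
- rewrite (sderM EP) (sderM DP) (sderD EP) (sderD DP) !(sderM DP, sderM EP).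
  rewrite !(sder_tw _ _ DP) !(sder_tw _ _ EP).
  by case: (p); case: (q); rewrite /= ?gparK ?(mulrDl, mulrDr, mulNr, mulrN); zmodule.
- rewrite (sder_par EP) (sder_par DP) (sder_sgn _ _ DP) (sder_sgn _ _ EP).
  rewrite (sder_par EP) (sder_par DP) gparD.
  by case: (p); case: (q); rewrite /= ?gparN ?gparK; zmodule.
Qed.

(** An odd D anticommutes with [gpar], so the two terms containing both D x and D y cancel. *)
Lemma sder_sq D : sder true D -> sder false (fun x => D (D x)).
Proof.
move=> DP; split=> [x y|x y|x].
- by rewrite !(sderD DP).
- rewrite (sderM DP) (sderD DP) !(sderM DP) (sder_par DP) /= gparK mulNr; zmodule.
- by rewrite (sder_par DP) /= (sderN _ DP) (sder_par DP) /= opprK.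
Qed.

(** Here D has degree a - s. Keeping a and s apart allows negative degrees within the natural
    numbers. *)
Lemma sder_deg p D a s : sder p D ->
  (forall f, gdegB s a (D (gscal W U f))) ->
  (forall u, gdegB s a.+1 (D (gen1 U u))) ->
  (forall b, gdegB s a.+2 (D (gen2 W b))) ->
  forall k x, gdeg k x -> gdegB s (a + k) (D x).
Proof.
move=> DP d0 d1 d2 k x; elim=> {k x} [f|u|b|k|k x y _ ex _ ey|k l x y kx ex ly ey].
- by rewrite addn0.
- by rewrite addn1.
- by rewrite addn2.
- by rewrite (sder0 DP); exact: gdegB0.
- by rewrite (sderD DP); exact: gdegBD.
- rewrite (sderM DP); apply: gdegBD.
    by rewrite addnA; apply: gdegBMr.
  by rewrite addnCA addnC; apply: gdegBMl => //; exact: gdeg_tw.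
Qed.

(** * Extension of derivations from the generators *)

Section ConstructDerivation.
Variables (p : bool) (d0 : K -> G) (d1 : W -> G) (d2 : U -> G).

Fixpoint tder (x : gterm W U) : G :=
  match x with
  | TScal f => d0 f
  | TGen1 u => d1 u
  | TGen2 b => d2 b
  | TAdd x y => tder x + tder y
  | TMul x y => tder x * gpi y + gtw p (gpi x) * tder y
  end.

Definition gder (x : G) : G := tder (repr x).

(** What the defining relations of the algebra demand of the values on generators. The first four
    clauses reflect the relations on scalars and linear combinations; the parity clauses reflect
    [ge_comm0], [ge_comm1] and [ge_comm2], since each value must commute with all elements up to the
    right sign. *)
Record gder_data : Prop := {
  gdd_add : forall f g, d0 (f + g) = d0 f + d0 g;
  gdd_mul : forall f g, d0 (f * g) = d0 f * gscal W U g + gscal W U f * d0 g;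
  gdd_gen1 : forall f u v,
    d1 (f *: u + v) = d0 f * gen1 U u + gscal W U f * d1 u + d1 v;
  gdd_gen2 : forall f u v,
    d2 (f *: u + v) = d0 f * gen2 W u + gscal W U f * d2 u + d2 v;
  gdd_hom0 : forall f, ghom p (d0 f);
  gdd_hom1 : forall u, ghom (~~ p) (d1 u);
  gdd_hom2 : forall b, ghom p (d2 b) }.

Hypothesis H : gder_data.

Let d0_0 : d0 0 = 0.
Proof. by apply: (addIr (d0 0)); rewrite -(gdd_add H) !add0r. Qed.
Let d0_1 : d0 1 = 0.
Proof.
apply: (addIr (d0 1)); rewrite add0r.
by have := gdd_mul H 1 1; rewrite !mulr1 gscal1 mul1r.
Qed.
Let d0_N1 : d0 (-1) = 0.
Proof. by apply: (addIr (d0 1)); rewrite -(gdd_add H) addNr d0_0 d0_1 addr0. Qed.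

Lemma tder_equiv (x y : gterm W U) : gequiv x y -> tder x = tder y.
Proof.
have gpiD (u v : gterm W U) : gpi (TAdd u v) = gpi u + gpi v by rewrite [RHS]gaddE.
have gpiM (u v : gterm W U) : gpi (TMul u v) = gpi u * gpi v by rewrite [RHS]gmulE.
elim=> {x y} /=; rewrite -/(gscal _ _) -/(gen1 _) -/(gen2 _).
- by [].
- by move=> x y _ ->.
- by move=> x y z _ -> _ ->.
- by move=> x x' y y' _ -> _ ->.
- by move=> x x' y y' /gpiP -> -> /gpiP -> ->.
- by move=> x y z; rewrite addrA.
- by move=> x y; rewrite addrC.
- by move=> x; rewrite d0_0 add0r.
- move=> x; rewrite d0_N1 d0_0 mul0r add0r -/(gscal _ _ _) gtw_scal.
  by rewrite gscalN mulN1r addNr.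
- by move=> x y z; rewrite !gpiM gtwM mulrDr mulrDl !mulrA addrA.
- by move=> x; rewrite d0_1 -/(gscal _ _ _) gtw_scal mul0r add0r mul1r.
- by move=> x y z; rewrite !gpiD gtwD !mulrDl; zmodule.
- by move=> x y z; rewrite !gpiD !mulrDr; zmodule.
- by move=> f g; rewrite (gdd_add H).
- by move=> f g; rewrite (gdd_mul H) -!/(gscal _ _ _) gtw_scal.
- by move=> f u v; rewrite (gdd_gen1 H) -!/(gscal _ _ _) gtw_scal.
- by move=> f u v; rewrite (gdd_gen2 H) -!/(gscal _ _ _) gtw_scal.
- move=> f x; rewrite -/(gscal _ _ _) gtw_scal gscal_comm addrC; congr (_ + _).
  by have [_ ->] := gdd_hom0 H f.
- move=> u v; rewrite d0_N1 mul0r add0r -/(gscal _ _ _) gtw_scal gscalN mulN1r.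
  rewrite -/(gen1 _ _) -/(gen1 _ _) !gtw_gen1.
  have [_ ->] := gdd_hom1 H u; have [_ ->] := gdd_hom1 H v.
  by rewrite !gtw_gen1; case: (p) => /=; rewrite ?mulNr; zmodule.
- move=> b x; rewrite -/(gen2 _ _) gtw_gen2 gen2C addrC; congr (_ + _).
  by have [_ ->] := gdd_hom2 H b.
Qed.

Lemma gder_pi t : gder (gpi t) = tder t.
Proof. by apply: tder_equiv; exact: repr_gpi. Qed.
Lemma gder_scal f : gder (gscal W U f) = d0 f. Proof. exact: gder_pi. Qed.
Lemma gder_gen1 u : gder (gen1 U u) = d1 u. Proof. exact: gder_pi. Qed.
Lemma gder_gen2 b : gder (gen2 W b) = d2 b. Proof. exact: gder_pi. Qed.

Lemma sder_gder : sder p gder.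
Proof.
have gD x y : gder (x + y) = gder x + gder y.
  by elim/gfunW: x => x; elim/gfunW: y => y; rewrite [_ + _]gaddE !gder_pi.
have gM x y : gder (x * y) = gder x * y + gtw p x * gder y.
  by elim/gfunW: x => x; elim/gfunW: y => y; rewrite [_ * _]gmulE !gder_pi.
split=> //; elim/gfun_ind=> [f|u|b|x y ex ey|x y ex ey].
- by rewrite gpar_scal gder_scal (gdd_hom0 H f).1; case: (p); rewrite /= ?opprK.
- rewrite gpar_gen1 gder_gen1 (gdd_hom1 H u).1.
  have -> : gder (- gen1 U u) = - gder (gen1 U u).
    have g0 : gder 0 = 0 by rewrite -gscal0 gder_scal.
    by apply: (addIr (gder (gen1 U u))); rewrite -gD !addNr.
  by rewrite gder_gen1; case: (p).
- by rewrite gpar_gen2 gder_gen2 (gdd_hom2 H b).1; case: (p); rewrite /= ?opprK.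
- by rewrite gparD !gD gparD gsgnD ex ey.
- rewrite gparM !gM gparD !gparM ex ey.
  by case: (p); rewrite /= ?gparK ?(mulNr, mulrN) ?opprD.
Qed.
End ConstructDerivation.

Lemma gder_data0 p d1 d2 :
  (forall f u v, d1 (f *: u + v) = gscal W U f * d1 u + d1 v) ->
  (forall f u v, d2 (f *: u + v) = gscal W U f * d2 u + d2 v) ->
  (forall u, ghom (~~ p) (d1 u)) -> (forall b, ghom p (d2 b)) ->
  gder_data p (fun=> 0) d1 d2.
Proof.
move=> l1 l2 h1 h2; split=> //.
- by move=> f g; rewrite addr0.
- by move=> f g; rewrite mul0r mulr0 addr0.
- by move=> f u v; rewrite mul0r add0r.
- by move=> f u v; rewrite mul0r add0r.
- by move=> f; exact: ghom0.
Qed.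

End GradedAlgebra.

Section HomogeneousElements.
Variables (K : comPzRingType) (W U : lmodType K).
Local Notation G := (gfun W U).
Implicit Types (a b c : G) (p q : bool).

Lemma gsgnN p a : gsgn p (- a) = - gsgn p a.
Proof. by case: p. Qed.
Lemma gsgnM p a b : gsgn p (a * b) = gsgn p a * b.
Proof. by case: p; rewrite /= ?mulNr. Qed.
Lemma gsgnMr p a b : gsgn p (a * b) = a * gsgn p b.
Proof. by case: p; rewrite /= ?mulrN. Qed.
Lemma gsgnK p a : gsgn p (gsgn p a) = a.
Proof. by case: p; rewrite /= ?opprK. Qed.

Lemma ghomC p q a b : ghom p a -> ghom q b -> a * b = gsgn (p && q) (b * a).
Proof. by move=> [_ ->] hb; rewrite (gtw_hom _ hb) gsgnM. Qed.

(** Apply D to the commutation rule of a with b: the terms containing D b cancel by the same rule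
    for a and D b, and what is left is the rule for D a. *)
Lemma ghom_sder p q (D : G -> G) a : sder p D -> ghom q a -> ghom (p (+) q) (D a).
Proof.
move=> DP ha; have [pa ca] := ha; split=> [|b].
  have := sder_par DP a; rewrite pa (sder_sgn _ _ DP) => e.
  by rewrite -[gpar _](gsgnK p) -e; case: (p); case: (q); rewrite /= ?opprK.
have := congr1 D (ca b); rewrite !(sderM DP) (sder_tw _ _ DP).
have -> : gtw p a * D b = gsgn (p && q) (gtw q (D b) * a).
  by rewrite (gtw_hom _ ha) -gsgnM ca.
have -> : gtw p (gtw q b) = gtw (p (+) q) b.
  by case: (p); case: (q); rewrite /= ?gparK.
by rewrite -gsgnM addrC => /addrI.
Qed.

Lemma ghom_sgn p q a : ghom p a -> ghom p (gsgn q a).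
Proof. by case: q => //; exact: ghomN. Qed.

(** Even components are doubled and odd ones cancelled; in [ghom_odd] it is the other way round. *)
Lemma ghom_even a : ghom false (a + gpar a).
Proof.
apply: (gdeg_span (P := fun a => ghom false (a + gpar a))) a => [k a da|a b ha hb].
  have := gdeg_hom da; rewrite (gdeg_par da); case: odd => /= ha.
    by rewrite subrr; exact: ghom0.
  exact: ghomD.
by rewrite gparD addrACA; exact: ghomD.
Qed.
Lemma ghom_odd a : ghom true (a - gpar a).
Proof.
apply: (gdeg_span (P := fun a => ghom true (a - gpar a))) a => [k a da|a b ha hb].
  have := gdeg_hom da; rewrite (gdeg_par da); case: odd => /= ha.
    by rewrite opprK; exact: ghomD.
  by rewrite subrr; exact: ghom0.
by rewrite gparD opprD addrACA; exact: ghomD.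
Qed.
End HomogeneousElements.

(** * Contractions and forms *)

Section Contraction.
Variables (R : realType) (n : nat) (M : smoothManifold R n).
Local Notation K := (Cinf M).

Lemma cstf_nat k : cstf M k%:R = k%:R.
Proof.
elim: k => [|k IH]; first exact: CinfP.
by rewrite -natr1 -[RHS]natr1 -IH; apply: CinfP.
Qed.

Lemma cstf_inv k : cstf M k.+1%:R^-1 * k.+1%:R = 1.
Proof.
rewrite -cstf_nat (_ : _ * _ = cstf M (k.+1%:R^-1 * k.+1%:R)); last exact: CinfP.
by rewrite mulVf ?pnatr_eq0 //; exact: CinfP.
Qed.

Lemma natK_eq0 k (f : K) : k.+1%:R * f = 0 -> f = 0.
Proof. by move=> kf; rewrite -[f]mul1r -(cstf_inv k) -mulrA kf mulr0. Qed.

Lemma sqrK_eq0 (f : K) : f * f = 0 -> f = 0.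
Proof.
move=> ff; apply: CinfP => x; apply/eqP; rewrite -[_ == _]orbb -mulf_eq0; apply/eqP.
exact: (congr1 (fun g : K => g x) ff).
Qed.

(* The functions are reduced: apply phi to phi(u) v with v = u. *)
Lemma dual_mulV_eq0 (E : lmodType K) (phi : dual E) :
  (forall u v : E, phi u *: v = 0) -> forall u, phi u = 0.
Proof.
by move=> phi0 u; apply: sqrK_eq0; rewrite -dual_scale phi0 dual_zero.
Qed.

Variables (V W U : lmodType K) (pair : V -> W -> K).
Local Notation G := (gfun W U).
Local Notation gs := (gscal W U).
Local Notation g1 := (gen1 U).
Local Notation g2 := (gen2 W).

Record is_pairing : Prop := {
  pairing_l : forall (f : K) u v w, pair (f *: u + v) w = f * pair u w + pair v w;
  pairing_r : forall (f : K) u v w, pair u (f *: v + w) = f * pair u v + pair u w }.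

Definition is_frame m (beta : 'I_m -> dual U) (bb : 'I_m -> U) : Prop :=
  forall b, b = \sum_(r < m) beta r b *: bb r.

Definition iV (x : V) : G -> G :=
  gder true (fun=> 0) (fun u => gs (pair x u)) (fun=> 0).
Definition iU (beta : dual U) : G -> G :=
  gder false (fun=> 0) (fun=> 0) (fun b => gs (beta b)).
(** A derivation of degree -1 that sees only the generators of degree 2. It measures how far
    commutators of [iV] with Lie derivatives and Hamiltonian derivations are from being contractions
    by sections of Q. *)
Definition iW (phi : U -> W) : G -> G :=
  gder true (fun=> 0) (fun=> 0) (fun b => g1 (phi b)).

Record is_2form (w : V -> V -> K) : Prop := {
  form2_l : forall (f : K) u v x, w (f *: u + v) x = f * w u x + w v x;
  form2_skew : forall u v, w u v = - w v u }.

Record is_3form (w : V -> V -> V -> K) : Prop := {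
  form3_l : forall (f : K) u v x y, w (f *: u + v) x y = f * w u x y + w v x y;
  form3_12 : forall u v x, w u v x = - w v u x;
  form3_23 : forall u v x, w u v x = - w u x v }.

Lemma skew_eq0 (f : K) : f = - f -> f = 0.
Proof. by move=> fN; apply: (@natK_eq0 1); rewrite mulr2n mulrDl mul1r {1}fN addNr. Qed.

Lemma form2_alt w x : is_2form w -> w x x = 0.
Proof. by move=> wP; apply: skew_eq0; rewrite -(form2_skew wP). Qed.

Lemma gscal_sum (I : Type) (r : seq I) (P : pred I) (F : I -> K) :
  gs (\sum_(i <- r | P i) F i) = \sum_(i <- r | P i) gs (F i).
Proof. by apply: (big_morph _ (gscalD W U)). Qed.

Lemma gscalCA (f : K) (x y : G) : x * (gs f * y) = gs f * (x * y).
Proof. by rewrite !mulrA gscal_comm. Qed.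

Lemma gen1_sum N (f : 'I_N -> K) (u : 'I_N -> W) :
  g1 (\sum_i f i *: u i) = \sum_i gs (f i) * g1 (u i).
Proof.
rewrite (big_morph _ (@gen1D _ W U) (gen1_0 _ _)).
by apply: eq_bigr => i _; rewrite gen1Z.
Qed.

Lemma gdeg_2form N (q : 'I_N -> V) (t : 'I_N -> W) w : gdeg 2 (fun_of_2form U q t w).
Proof.
apply: gdeg_sum => i _; apply: gdeg_sum => j _.
by apply: (@gdegM _ _ _ 1 1); [exact: (@gdegM _ _ _ 0 1 _ _ (gdeg_scal _ _ _) (gdeg_gen1 _ _))|exact: gdeg_gen1].
Qed.

Lemma gdeg_3form N (q : 'I_N -> V) (t : 'I_N -> W) w : gdeg 3 (fun_of_3form U q t w).
Proof.
apply: gdeg_sum => i _; apply: gdeg_sum => j _; apply: gdeg_sum => k _.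
apply: (@gdegM _ _ _ 2 1); last exact: gdeg_gen1.
by apply: (@gdegM _ _ _ 1 1); [exact: (@gdegM _ _ _ 0 1 _ _ (gdeg_scal _ _ _) (gdeg_gen1 _ _))|exact: gdeg_gen1].
Qed.

Hypothesis pairP : is_pairing.

Lemma pairDl u v w : pair (u + v) w = pair u w + pair v w.
Proof. by have := pairing_l pairP 1 u v w; rewrite scale1r mul1r. Qed.
Lemma pairDr u v w : pair u (v + w) = pair u v + pair u w.
Proof. by have := pairing_r pairP 1 u v w; rewrite scale1r mul1r. Qed.
Lemma pair0l w : pair 0 w = 0.
Proof. by apply: (addIr (pair 0 w)); rewrite -pairDl !add0r. Qed.
Lemma pair0r v : pair v 0 = 0.
Proof. by apply: (addIr (pair v 0)); rewrite -pairDr !add0r. Qed.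
Lemma pairZl f u w : pair (f *: u) w = f * pair u w.
Proof. by have := pairing_l pairP f u 0 w; rewrite pair0l !addr0. Qed.
Lemma pairZr f u w : pair u (f *: w) = f * pair u w.
Proof. by have := pairing_r pairP f u w 0; rewrite pair0r !addr0. Qed.
Lemma pairNl u w : pair (- u) w = - pair u w.
Proof. by rewrite -scaleN1r pairZl mulN1r. Qed.
Lemma pairNr u w : pair u (- w) = - pair u w.
Proof. by rewrite -scaleN1r pairZr mulN1r. Qed.
Lemma pair_sumr (I : Type) (r : seq I) (P : pred I) (F : I -> W) v :
  pair v (\sum_(i <- r | P i) F i) = \sum_(i <- r | P i) pair v (F i).
Proof. by apply: (big_morph (pair v)); [move=> u w; exact: pairDr|exact: pair0r]. Qed.

Definition pairEr := (pairDr, pairNr, pairZr, pair0r).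

Lemma iV_data x : @gder_data _ W U true (fun=> 0) (fun u => gs (pair x u)) (fun=> 0).
Proof.
apply: gder_data0 => [f u v|f u v|u|b].
- by rewrite (pairing_r pairP) gscalD gscalM.
- by rewrite mulr0 addr0.
- exact: ghom_scal.
- exact: ghom0.
Qed.
Lemma sder_iV x : sder true (iV x). Proof. exact: sder_gder (iV_data x). Qed.
Lemma iV_scal x f : iV x (gs f) = 0. Proof. exact: (gder_scal (iV_data x)). Qed.
Lemma iV_gen1 x u : iV x (g1 u) = gs (pair x u).
Proof. exact: (gder_gen1 (iV_data x)). Qed.
Lemma iV_gen2 x b : iV x (g2 b) = 0. Proof. exact: (gder_gen2 (iV_data x)). Qed.
Lemma iV_deg x k y : gdeg k.+1 y -> gdeg k (iV x y).
Proof.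
move=> dy; suff: gdegB 1 (0 + k.+1) (iV x y) by rewrite /gdegB add0n subn1.
apply: (sder_deg (sder_iV x)) dy => [f|u|b].
- by rewrite iV_scal; exact: gdegB0.
- by rewrite iV_gen1; exact: gdeg_scal.
- by rewrite iV_gen2; exact: gdegB0.
Qed.

Lemma iU_data (beta : dual U) : @gder_data _ W U false (fun=> 0) (fun=> 0) (fun b => gs (beta b)).
Proof.
apply: gder_data0 => [f u v|f u v|u|b].
- by rewrite mulr0 addr0.
- by rewrite dual_linear gscalD gscalM.
- exact: ghom0.
- exact: ghom_scal.
Qed.
Lemma sder_iU (beta : dual U) : sder false (iU beta). Proof. exact: sder_gder (iU_data beta). Qed.
Lemma iU_scal (beta : dual U) f : iU beta (gs f) = 0. Proof. exact: (gder_scal (iU_data beta)). Qed.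
Lemma iU_gen1 (beta : dual U) u : iU beta (g1 u) = 0. Proof. exact: (gder_gen1 (iU_data beta)). Qed.
Lemma iU_gen2 (beta : dual U) b : iU beta (g2 b) = gs (beta b).
Proof. exact: (gder_gen2 (iU_data beta)). Qed.
Lemma iU_degB (beta : dual U) k y : gdeg k y -> gdegB 2 k (iU beta y).
Proof.
move=> dy; rewrite -[k]add0n; apply: (sder_deg (sder_iU beta)) dy => [f|u|b].
- by rewrite iU_scal; exact: gdegB0.
- by rewrite iU_gen1; exact: gdegB0.
- by rewrite iU_gen2; exact: gdeg_scal.
Qed.
Lemma iU_deg (beta : dual U) k y : gdeg k.+2 y -> gdeg k (iU beta y).
Proof. by move=> dy; have := iU_degB beta dy; rewrite /gdegB subn2. Qed.
Lemma iU_deg1 (beta : dual U) y : gdeg 1 y -> iU beta y = 0.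
Proof. by move=> dy; exact: (iU_degB beta dy). Qed.

Lemma iW_data phi : is_linear phi ->
  @gder_data _ W U true (fun=> 0) (fun=> 0) (fun b => g1 (phi b)).
Proof.
move=> phiP; apply: gder_data0 => [f u v|f u v|u|b].
- by rewrite mulr0 addr0.
- by rewrite phiP gen1_linear.
- exact: ghom0.
- exact: ghom_gen1.
Qed.
Lemma sder_iW phi : is_linear phi -> sder true (iW phi).
Proof. by move=> phiP; exact: sder_gder (iW_data phiP). Qed.
Lemma iW_scal phi f : is_linear phi -> iW phi (gs f) = 0.
Proof. by move=> phiP; exact: (gder_scal (iW_data phiP)). Qed.
Lemma iW_gen1 phi u : is_linear phi -> iW phi (g1 u) = 0.
Proof. by move=> phiP; exact: (gder_gen1 (iW_data phiP)). Qed.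
Lemma iW_gen2 phi b : is_linear phi -> iW phi (g2 b) = g1 (phi b).
Proof. by move=> phiP; exact: (gder_gen2 (iW_data phiP)). Qed.

Lemma iU_iV (beta : dual U) x y : iU beta (iV x y) = iV x (iU beta y).
Proof.
apply/eqP; rewrite -subr_eq0; apply/eqP.
apply: (sder_eq0 (sder_comm (sder_iU beta) (sder_iV x))) y => [f|u|b]; rewrite /scomm /=.
- by rewrite iV_scal iU_scal (sder0 (sder_iU _)) (sder0 (sder_iV _)) subr0.
- by rewrite iV_gen1 iU_scal iU_gen1 (sder0 (sder_iV _)) subr0.
- by rewrite iV_gen2 iU_gen2 iV_scal (sder0 (sder_iU _)) subr0.
Qed.

Lemma sder_2form p D N (q : 'I_N -> V) (t : 'I_N -> W) w : sder p D ->
  (forall f, D (gs f) = 0) -> (forall u, D (g1 u) = 0) ->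
  D (fun_of_2form U q t w) = 0.
Proof.
move=> DP D0 D1; rewrite (sder_sum _ _ _ DP) big1 // => i _.
rewrite (sder_sum _ _ _ DP) big1 // => j _.
by rewrite !(sderM DP) D0 !D1 !(mul0r, mulr0, addr0).
Qed.

Lemma sder_3form p D N (q : 'I_N -> V) (t : 'I_N -> W) w : sder p D ->
  (forall f, D (gs f) = 0) -> (forall u, D (g1 u) = 0) ->
  D (fun_of_3form U q t w) = 0.
Proof.
move=> DP D0 D1; rewrite (sder_sum _ _ _ DP) big1 // => i _.
rewrite (sder_sum _ _ _ DP) big1 // => j _; rewrite (sder_sum _ _ _ DP) big1 // => k _.
by rewrite !(sderM DP) D0 !D1 !(mul0r, mulr0, addr0).
Qed.

Section Frames.
Variables (N : nat) (q : 'I_N -> V) (t : 'I_N -> W) (qt : dual_frames pair q t).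

Lemma pair_inj (u v : W) : (forall x, pair x u = pair x v) -> u = v.
Proof.
by move=> uv; rewrite [u]qt.2 [v]qt.2; apply: eq_bigr => i _; rewrite uv.
Qed.

Lemma linear_frame (phi : V -> K) x :
  (forall (f : K) u v, phi (f *: u + v) = f * phi u + phi v) ->
  phi x = \sum_i pair x (t i) * phi (q i).
Proof.
move=> phiP; rewrite {1}[x]qt.1.
have phi0 : phi 0 = 0 by have := phiP (-1) 0 0; rewrite scaler0 addr0 mulN1r addNr.
rewrite (big_morph phi (id1 := 0) (op1 := +%R)) // => [|u v].
  apply: eq_bigr => i _; have := phiP (pair x (t i)) (q i) 0.
  by rewrite phi0 !addr0.
by have := phiP 1 u v; rewrite scale1r mul1r.
Qed.

Lemma form2_frame w x y : is_2form w -> w x y = \sum_i pair x (t i) * w (q i) y.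
Proof. by move=> wP; apply: (linear_frame (phi := w^~ y)) => f u v; exact: form2_l. Qed.

Lemma form3_frame w x y z : is_3form w -> w x y z = \sum_i pair x (t i) * w (q i) y z.
Proof.
by move=> wP; apply: (linear_frame (phi := fun x => w x y z)) => f u v; exact: form3_l.
Qed.

(** The Leibniz rule gives two sums over i < j with opposite signs. Exchanging the indices in one of
    them and using skew-symmetry yields a single sum over all pairs, whose diagonal vanishes;
    expanding x in the frame identifies it with u. *)
Lemma iV_2form w x u : is_2form w -> (forall y, pair y u = w x y) ->
  iV x (fun_of_2form U q t w) = g1 u.
Proof.
move=> wP xu; rewrite [u]qt.2 gen1_sum; under [RHS]eq_bigr do rewrite xu.
have -> : iV x (fun_of_2form U q t w) =
    \sum_(i < N) \sum_(j < N | (i < j)%N) gs (pair x (t i) * w (q i) (q j)) * g1 (t j) -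
    \sum_(i < N) \sum_(j < N | (i < j)%N) gs (pair x (t j) * w (q i) (q j)) * g1 (t i).
  rewrite (sder_sum _ _ _ (sder_iV x)) -sumrB; apply: eq_bigr => i _.
  rewrite (sder_sum _ _ _ (sder_iV x)) -sumrB; apply: eq_bigr => j _.
  rewrite (sderM (sder_iV x)) (sder_scal _ (sder_iV x)) ?iV_scal // !iV_gen1.
  rewrite gtwM gtw_scal gtw_gen1 /= mulrN mulNr -gscalM mulrC.
  by rewrite -mulrA -[g1 _ * gs _]gscal_comm mulrA -gscalM [w _ _ * _]mulrC.
rewrite [X in _ - X](exchange_big_dep predT) //= -sumrB [RHS]big_mkcond.
under [RHS]eq_bigr => j _ do rewrite (form2_frame _ _ wP) gscal_sum mulr_suml.
rewrite [RHS]exchange_big /=; apply: eq_bigr => i _.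
rewrite big_mkcond [X in _ - X]big_mkcond -sumrB; apply: eq_bigr => j _.
case: ltngtP => [_|_|/val_inj ->]; rewrite ?subr0 ?sub0r //.
  by rewrite (form2_skew wP) mulrN gscalN mulNr opprK.
by rewrite (form2_alt _ wP) mulr0 gscal0 mul0r.
Qed.

Lemma form3_alt12 w x y : is_3form w -> w x x y = 0.
Proof. by move=> wP; apply: skew_eq0; rewrite -(form3_12 wP). Qed.
Lemma form3_alt13 w x y : is_3form w -> w x y x = 0.
Proof. by move=> wP; rewrite (form3_23 wP) form3_alt12 // oppr0. Qed.

Lemma form3_2form w x : is_3form w -> is_2form (w x).
Proof.
move=> wP; split=> [f u v y|u v]; last exact: form3_23.
by rewrite !(form3_12 wP x) (form3_l wP); ring.
Qed.

Lemma iV_3form w x : is_3form w ->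
  iV x (fun_of_3form U q t w) = fun_of_2form U q t (w x).
Proof.
move=> wP.
pose X i j k : G := gs (pair x (t i) * w (q i) (q j) (q k)) * g1 (t j) * g1 (t k).
(* The range of summation is a mask on all triples, so that renaming indices just permutes the
   arguments of P and Y. *)
pose S (P : nat -> nat -> nat -> bool) (Y : 'I_N -> 'I_N -> 'I_N -> G) : G :=
  \sum_(i < N) \sum_(j < N) \sum_(k < N) if P i j k then Y i j k else 0.
have S12 P Y : S P Y = S (fun i j k => P j i k) (fun i j k => Y j i k).
  by rewrite /S exchange_big.
have S23 P Y : S P Y = S (fun i j k => P i k j) (fun i j k => Y i k j).
  by rewrite /S; apply: eq_bigr => i _; rewrite exchange_big.
pose lt3 i j k := (i < j)%N && (j < k)%N.
have -> : iV x (fun_of_3form U q t w) =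
    S lt3 X + S lt3 (fun i j k => X j i k) + S lt3 (fun i j k => X k i j).
  rewrite /S -!big_split (sder_sum _ _ _ (sder_iV x)); apply: eq_bigr => i _ /=.
  rewrite -!big_split (sder_sum _ _ _ (sder_iV x)) big_mkcond; apply: eq_bigr => j _ /=.
  rewrite -!big_split /lt3; case: ltnP => _ /=; last by rewrite big1 // => k _; rewrite !addr0.
  rewrite (sder_sum _ _ _ (sder_iV x)) big_mkcond; apply: eq_bigr => k _ /=.
  case: ltnP => _; last by rewrite !addr0.
  rewrite !(sderM (sder_iV x)) iV_scal !iV_gen1 mul0r add0r.
  rewrite !gtwM !gtw_scal !gtw_gen1 /X (form3_12 wP (q j)) (form3_12 wP (q k)).
  rewrite (form3_23 wP (q i) (q k)) /= !mulrDl !(mulrN, mulNr, gscalN, opprK).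
  rewrite -!mulrA -!(gscal_comm _ (g1 _)) !(gscalCA _ (g1 _)) !mulrA -!gscalM.
  by rewrite ![w _ _ _ * _]mulrC.
(* The contracted index is named i in all three sums; their masks become i < j < k, j < i < k and j
   < k < i. *)
rewrite [X in _ + X + _]S12 [X in _ + X]S23 [X in _ + X]S12.
have -> : fun_of_2form U q t (w x) = S (fun i j k => (j < k)%N) X.
  rewrite /S exchange_big; apply: eq_bigr => j _.
  rewrite exchange_big big_mkcond; apply: eq_bigr => k _.
  case: ltnP => _; last by rewrite big1.
  by rewrite (form3_frame _ _ _ wP) gscal_sum !mulr_suml.
rewrite /S -!big_split; apply: eq_bigr => i _; rewrite -!big_split.
apply: eq_bigr => j _; rewrite -!big_split; apply: eq_bigr => k _ /=.
(* For j < k exactly one of the three masks holds, except when i is j or k; there the summand is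
   zero because w is alternating. *)
rewrite /lt3; case: (ltngtP i j) => [ij|ji|/val_inj <-] /=.
- rewrite addr0; case: (ltnP j k) => [jk|_] /=; last by rewrite addr0.
  by rewrite ltnNge ltnW ?addr0 // (ltn_trans ij).
- case: (ltngtP i k) => [ik|ki|/val_inj <-] /=.
  + by rewrite andbF add0r addr0 (ltn_trans ji ik).
  + by rewrite !add0r andbT.
  + by rewrite andbF !add0r ji /X (form3_alt13 _ _ wP) mulr0 gscal0 !mul0r.
- have X0 : X i i k = 0 by rewrite /X (form3_alt12 _ _ wP) mulr0 gscal0 !mul0r.
  by rewrite X0 !if_same !addr0.
Qed.

Variables (m : nat) (beta : 'I_m -> dual U) (bb : 'I_m -> U).
Hypothesis bP : is_frame beta bb.

(* Euler's formula: the sum below is the derivation multiplying elements of degree k by k. *)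
Lemma gdeg_eq0 k (x : G) : gdeg k.+1 x -> (forall v, iV v x = 0) ->
  (forall b : dual U, iU b x = 0) -> x = 0.
Proof.
move=> dx x1 x2.
pose E y : G := \sum_i g1 (t i) * iV (q i) y + \sum_r (g2 (bb r) * iU (beta r) y *+ 2).
have EP : sder false E.
  apply: sder_add; apply: sder_sumf => i.
    exact: (sder_mull (ghom_gen1 _ _) (sder_iV _)).
  have H := sder_mull (ghom_gen2 W (bb i)) (sder_iU (beta i)).
  exact: (sder_add H H).
have Ek l y : gdeg l y -> E y = gs l%:R * y.
  elim=> {l y} [f|u|b|l|l y z _ ey _ ez|l l' y z _ ey _ ez].
  - rewrite mul0r /E !big1 ?addr0 // => i _.
      by rewrite iU_scal mulr0 mul0rn.
    by rewrite iV_scal mulr0.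
  - rewrite gscal1 mul1r /E [X in _ + X]big1 ?addr0 => [|i _].
      rewrite {2}[u]qt.2 gen1_sum; apply: eq_bigr => i _.
      by rewrite iV_gen1 gscal_comm.
    by rewrite iU_gen1 mulr0 mul0rn.
  - rewrite /E [X in X + _]big1 ?add0r => [|i _].
      have -> : gs 2%:R * g2 b = g2 b *+ 2.
        by rewrite [2%:R]mulr2n gscalD gscal1 mulrDl mul1r -mulr2n.
      rewrite sumrMnl {2}(bP b) gen2_sum.
      by congr (_ *+ 2); apply: eq_bigr => i _; rewrite iU_gen2 gscal_comm.
    by rewrite iV_gen2 mulr0.
  - by rewrite (sder0 EP) mulr0.
  - by rewrite (sderD EP) ey ez mulrDr.
  - rewrite (sderM EP) ey ez natrD gscalD mulrDl; congr (_ + _); first by rewrite mulrA.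
    by rewrite /= gscalCA.
have := Ek _ _ dx; rewrite /E !big1 => [|i _|i _]; last 2 first.
- by rewrite x2 mulr0 mul0rn.
- by rewrite x1 mulr0.
rewrite addr0 => /(congr1 (fun y => gs (cstf M k.+1%:R^-1) * y)).
by rewrite mulr0 mulrA -gscalM cstf_inv gscal1 mul1r.
Qed.

Lemma gdeg1_eq0 (x : G) : gdeg 1 x -> (forall v, iV v x = 0) -> x = 0.
Proof. by move=> dx x1; apply: (gdeg_eq0 dx x1) => b; exact: iU_deg1. Qed.

(** Contracting with a section of B' leaves degree 1, where sections of Q detect everything, and the
    two kinds of contraction commute. In degree 2 this fails: [iV] kills the generators [gen2]. *)
Lemma gdeg3_eq0 (x : G) : gdeg 3 x -> (forall v, iV v x = 0) -> x = 0.
Proof.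
move=> dx x1; apply: (gdeg_eq0 dx x1) => b; apply: (gdeg1_eq0 (iU_deg b dx)) => v.
by rewrite -iU_iV x1 (sder0 (sder_iU b)).
Qed.

Lemma gdeg_eq k (x y : G) : gdeg k.+1 x -> gdeg k.+1 y -> (forall v, iV v x = iV v y) ->
  (forall b : dual U, iU b x = iU b y) -> x = y.
Proof.
move=> dx dy xy1 xy2; apply/eqP; rewrite -subr_eq0; apply/eqP.
apply: gdeg_eq0 (gdegD dx (gdegN dy)) _ _ => [v|b].
  by rewrite (sderD (sder_iV v)) (sderN _ (sder_iV v)) xy1 subrr.
by rewrite (sderD (sder_iU b)) (sderN _ (sder_iU b)) xy2 subrr.
Qed.

Lemma iU_2form (b : dual U) w : iU b (fun_of_2form U q t w) = 0.
Proof. by apply: (sder_2form _ _ _ (sder_iU b)) => u; [exact: iU_scal|exact: iU_gen1]. Qed.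

Lemma iU_3form (b : dual U) w : iU b (fun_of_3form U q t w) = 0.
Proof. by apply: (sder_3form _ _ _ (sder_iU b)) => u; [exact: iU_scal|exact: iU_gen1]. Qed.

Lemma iW_2form phi w : is_linear phi -> iW phi (fun_of_2form U q t w) = 0.
Proof.
move=> phiP; apply: (sder_2form _ _ _ (sder_iW phiP)) => u.
  exact: iW_scal.
exact: iW_gen1.
Qed.

Lemma linear_rep (phi : V -> K) x :
  (forall (f : K) u v, phi (f *: u + v) = f * phi u + phi v) ->
  pair x (\sum_i phi (q i) *: t i) = phi x.
Proof.
move=> phiP; rewrite pair_sumr (linear_frame _ phiP); apply: eq_bigr => i _.
by rewrite pairZr mulrC.
Qed.

Lemma eq_2form (w w' : V -> V -> K) : (forall x y, w x y = w' x y) ->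
  fun_of_2form U q t w = fun_of_2form U q t w'.
Proof. by move=> ww; apply: eq_bigr => i _; apply: eq_bigr => j _; rewrite ww. Qed.

Lemma scale_2form (f : K) (w w' : V -> V -> K) :
  fun_of_2form U q t (fun x y => f * w x y + w' x y) =
  gs f * fun_of_2form U q t w + fun_of_2form U q t w'.
Proof.
rewrite mulr_sumr -big_split; apply: eq_bigr => i _ /=.
rewrite mulr_sumr -big_split; apply: eq_bigr => j _ /=.
by rewrite gscalD gscalM !mulrDl !mulrA.
Qed.

Lemma scale_3form (f : K) (w w' : V -> V -> V -> K) :
  fun_of_3form U q t (fun x y z => f * w x y z + w' x y z) =
  gs f * fun_of_3form U q t w + fun_of_3form U q t w'.
Proof.
rewrite mulr_sumr -big_split; apply: eq_bigr => i _ /=.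
rewrite mulr_sumr -big_split; apply: eq_bigr => j _ /=.
rewrite mulr_sumr -big_split; apply: eq_bigr => k _ /=.
by rewrite gscalD gscalM !mulrDl !mulrA.
Qed.

Lemma eq_3form (w w' : V -> V -> V -> K) : (forall x y z, w x y z = w' x y z) ->
  fun_of_3form U q t w = fun_of_3form U q t w'.
Proof.
move=> ww; apply: eq_bigr => i _; apply: eq_bigr => j _; apply: eq_bigr => k _.
by rewrite ww.
Qed.

Lemma form2_rep w x y : is_2form w -> pair y (\sum_i w x (q i) *: t i) = w x y.
Proof.
move=> wP; apply: (linear_rep (phi := w x)) => f u v.
by rewrite !(form2_skew wP x) (form2_l wP); ring.
Qed.

(** Turns the derivative of a coefficient, which appears as a product with [rs f], into a 2-form
    that can be added to the dull differential. *)
Lemma gen1_wedge u v : g1 u * g1 v =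
  fun_of_2form U q t (fun x y => pair x u * pair y v - pair y u * pair x v).
Proof.
set w := (X in fun_of_2form _ _ _ X).
have wP : is_2form w.
  split=> [f x x' y|x y]; rewrite /w ?(pairing_l pairP); ring.
apply: (gdeg_eq (k := 1)) (gdegM (gdeg_gen1 _ _) (gdeg_gen1 _ _)) (gdeg_2form _ _ _) _ _.
  move=> x; rewrite (iV_2form (u := pair x u *: v - pair x v *: u) wP) => [|y].
    rewrite (sderM (sder_iV x)) !iV_gen1 gtw_gen1 gen1D gen1N !gen1Z /= mulNr.
    by rewrite -gscal_comm.
  by rewrite !pairEr /w; ring.
by move=> b; rewrite iU_2form (sderM (sder_iU b)) !iU_gen1 mul0r mulr0 addr0.
Qed.

End Frames.

(** Both elements have the same contractions. The vector field and the bracket are constructed with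
    one frame but specified for all frames, hence the need for this independence. *)
Lemma form2_indep N (q : 'I_N -> V) (t : 'I_N -> W) N' (q' : 'I_N' -> V) (t' : 'I_N' -> W)
    m (beta : 'I_m -> dual U) (bb : 'I_m -> U) w :
  dual_frames pair q t -> dual_frames pair q' t' -> is_frame beta bb -> is_2form w ->
  fun_of_2form U q t w = fun_of_2form U q' t' w.
Proof.
move=> qt qt' bP wP.
apply: (gdeg_eq qt bP (k := 1)) (gdeg_2form _ _ _) (gdeg_2form _ _ _) _ _ => [x|b].
  rewrite (iV_2form qt wP (x := x) (u := \sum_i w x (q i) *: t i)) => [|y].
    by rewrite (iV_2form qt' wP (x := x) (u := \sum_i w x (q i) *: t i)) // => y; exact: form2_rep.
  exact: form2_rep.
by rewrite !iU_2form.
Qed.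

Lemma form3_indep N (q : 'I_N -> V) (t : 'I_N -> W) N' (q' : 'I_N' -> V) (t' : 'I_N' -> W)
    m (beta : 'I_m -> dual U) (bb : 'I_m -> U) w :
  dual_frames pair q t -> dual_frames pair q' t' -> is_frame beta bb -> is_3form w ->
  fun_of_3form U q t w = fun_of_3form U q' t' w.
Proof.
move=> qt qt' bP wP.
apply: (gdeg_eq qt bP (k := 2)) (gdeg_3form _ _ _) (gdeg_3form _ _ _) _ _ => [x|b].
  rewrite !iV_3form //; apply: form2_indep qt qt' bP _; exact: form3_2form.
by rewrite !iU_3form.
Qed.
End Contraction.

(** * The homological vector field *)

Section Anchors.
Variables (R : realType) (n : nat) (M : smoothManifold R n).
Local Notation K := (Cinf M).
Variables (V : lmodType K) (rho : V -> K -> K) (rhoP : is_anchor rho).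
Implicit Types (v : V) (f g : K).

Lemma anchorD v f g : rho v (f + g) = rho v f + rho v g.
Proof. exact: vf_add (anchor_vf rhoP v) _ _. Qed.
Lemma anchorM v f g : rho v (f * g) = rho v f * g + f * rho v g.
Proof. exact: vf_leibniz (anchor_vf rhoP v) _ _. Qed.
Lemma anchor0 v : rho v 0 = 0. Proof. exact: (vf_nat false (anchor_vf rhoP v)). Qed.
Lemma anchorN v f : rho v (- f) = - rho v f.
Proof. by apply: (addIr (rho v f)); rewrite -anchorD !addNr anchor0. Qed.
Lemma anchor_cst v r : rho v (cstf M r) = 0.
Proof.
have vP := anchor_vf rhoP v.
by rewrite -[cstf M r]mulr1 (vf_scale vP) (vf_nat true vP) mulr0.
Qed.
Lemma anchor1 v : rho v 1 = 0. Proof. exact: (vf_nat true (anchor_vf rhoP v)). Qed.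
Definition anchorE := (anchorM, anchorD, anchorN, anchor0, anchor1).
End Anchors.

Section LinearMaps.
Variables (R : realType) (n : nat) (M : smoothManifold R n).
Variables (E F : lmodType (Cinf M)) (d : E -> F) (dP : is_linear d).
Lemma is_linearD u v : d (u + v) = d u + d v.
Proof. by have := dP 1 u v; rewrite !scale1r. Qed.
Lemma is_linear0 : d 0 = 0.
Proof. by apply: (addIr (d 0)); rewrite -is_linearD !add0r. Qed.
Lemma is_linearZ f u : d (f *: u) = f *: d u.
Proof. by have := dP f u 0; rewrite is_linear0 !addr0. Qed.
Lemma is_linearN u : d (- u) = - d u.
Proof. by rewrite -scaleN1r is_linearZ scaleN1r. Qed.
Lemma is_linear_sum (I : Type) (r : seq I) (P : pred I) (f : I -> E) :
  d (\sum_(i <- r | P i) f i) = \sum_(i <- r | P i) d (f i).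
Proof. by apply: (big_morph d); [exact: is_linearD|exact: is_linear0]. Qed.
End LinearMaps.

Section Derivations.
Variables (R : realType) (n : nat) (M : smoothManifold R n).
Local Notation K := (Cinf M).
Variables (W U : lmodType K).
Local Notation G := (gfun W U).

(** The rules for homogeneous arguments extend to all by [gdeg_span], both sides being additive once
    the sign is written with [gtw]. *)
Lemma is_derivation1_sder (Q : G -> G) : is_derivation1 Q -> sder true Q.
Proof.
move=> QP; have Q0 : Q 0 = 0.
  by apply: (addIr (Q 0)); rewrite -(d1_add QP) !add0r.
have QN x : Q (- x) = - Q x.
  by apply: (addIr (Q x)); rewrite -(d1_add QP) !addNr.
split=> [|x y|x]; first exact: d1_add.
  apply: (gdeg_span (P := fun x => Q (x * y) = Q x * y + gtw true x * Q y)) x => [k x dx|x x' e e'].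
    by rewrite (d1_leibniz QP _ dx) gsgnE (gtw_deg _ dx) /=; case: odd; rewrite ?mulNr.
  by rewrite mulrDl !(d1_add QP) e e' gtwD !mulrDl; zmodule.
apply: (gdeg_span (P := fun x => Q (gpar x) = gsgn true (gpar (Q x)))) x => [k x dx|x x' e e'].
  rewrite (gdeg_par dx) (gdeg_par (d1_deg QP dx)) /=.
  by case: odd; rewrite /= ?opprK ?QN.
by rewrite gparD !(d1_add QP) gparD gsgnD e e'.
Qed.

Lemma sder_is_derivation1 (Q : G -> G) : sder true Q ->
  (forall r, Q (gscal W U (cstf M r)) = 0) ->
  (forall f, gdeg 1 (Q (gscal W U f))) -> (forall u, gdeg 2 (Q (gen1 U u))) ->
  (forall b, gdeg 3 (Q (gen2 W b))) -> is_derivation1 Q.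
Proof.
move=> QP Qc Q0 Q1 Q2; split=> [|r x|k x dx|k x y dx]; first exact: sderD QP.
- exact: (sder_scal _ QP (Qc r)).
- have := sder_deg (a := 1) (s := 0) QP _ _ _ dx.
  by rewrite /gdegB subn0 add1n; apply.
- by rewrite (sderM QP) gsgnE (gtw_deg _ dx) /=; case: odd; rewrite ?mulNr.
Qed.
End Derivations.

Section Dorfman.
Variables (R : realType) (n : nat) (M : smoothManifold R n).
Local Notation K := (Cinf M).
Variables (V W U : lmodType K) (pair : V -> W -> K) (pairP : is_pairing pair).
Local Notation G := (gfun W U).
Local Notation gs := (gscal W U).
Local Notation g1 := (gen1 U).
Local Notation g2 := (gen2 W).
Local Notation iV := (@iV R n M V W U pair).
Variables (N : nat) (q : 'I_N -> V) (t : 'I_N -> W) (qt : dual_frames pair q t).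
Variables (m : nat) (beta : 'I_m -> dual U) (bb : 'I_m -> U) (bP : is_frame beta bb).
Variables (rho : V -> K -> K) (d : W -> U) (Delta : V -> W -> W)
  (nab : V -> U -> U) (w : V -> V -> U -> W)
  (rs : K -> W) (br : V -> V -> V) (ds : dual U -> V).
Hypothesis DP : dorfman_axioms pair rho d Delta nab w rs br ds.
(** The part of Q(Q f) lying in B. For the semi-direct structure it holds because [rs f] lies in A',
    on which d vanishes. *)
Hypothesis drs : forall f, d (rs f) = 0.
Implicit Types (x y z v : V) (u : W) (b : U) (f : K) (xi : dual U) (a : G).

Let rhoP := dr_anchor DP.

(** Cartan's formula for the dull algebroid: the contraction of d_Q u with x is the Lie derivative
    Delta_x u minus the differential of the pairing of x with u. *)
Lemma dull_dE u x y : dull_d pair rho Delta u x y = pair y (Delta x u - rs (pair x u)).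
Proof. by rewrite /dull_d /dull_pairing !(pairEr pairP) (dr_rs DP); ring. Qed.

Lemma dull_d_2form u : is_2form (dull_d pair rho Delta u).
Proof.
split=> [f x x' y|x y].
  rewrite !dull_dE (dr_addl DP) (dr_leibnizl DP) (pairing_l pairP).
  rewrite !(pairEr pairP) !(dr_rs DP) !(anchorE rhoP).
  by ring.
have := congr1 (pair^~ u) (dr_skew DP x y).
rewrite (pairNl pairP) !(dr_br DP) /dull_d => ->; ring.
Qed.

Lemma omega_3form b : is_3form (fun x y z => omega pair w x y z b).
Proof.
split=> [f x x' y z|x y z|x y z].
- by rewrite /omega (h2_form (dr_2form DP)) (pairing_r pairP).
- exact: dr_omega12 DP _ _ _ _.
- exact: dr_omega23 DP _ _ _ _.
Qed.

Lemma rs_add f g : rs (f + g) = rs f + rs g.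
Proof.
by apply: (pair_inj qt) => x; rewrite (pairDr pairP) !(dr_rs DP) (anchorD rhoP).
Qed.
Lemma rs_mul f g : rs (f * g) = f *: rs g + g *: rs f.
Proof.
apply: (pair_inj qt) => x; rewrite (pairDr pairP) !(pairZr pairP) !(dr_rs DP).
by rewrite (anchorM rhoP); ring.
Qed.

Definition connection_term N (q : 'I_N -> V) (t : 'I_N -> W) b : G :=
  \sum_i g1 (t i) * g2 (nab (q i) b).

Lemma gdeg_connection_term N' (q' : 'I_N' -> V) (t' : 'I_N' -> W) b :
  gdeg 3 (connection_term q' t' b).
Proof.
by apply: gdeg_sum => i _; apply: (@gdegM _ _ _ 1 2); [exact: gdeg_gen1|exact: gdeg_gen2].
Qed.

Lemma nab_frame N' (q' : 'I_N' -> V) (t' : 'I_N' -> W) x b : dual_frames pair q' t' ->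
  nab x b = \sum_i pair x (t' i) *: nab (q' i) b.
Proof.
move=> qt'; have lin : forall f y z, nab (f *: y + z) b = f *: nab y b + nab z b.
  by move=> f y z; exact: conn_linear (dr_conn DP) _ _ _ _.
by rewrite {1}[x](qt'.1) (is_linear_sum lin); apply: eq_bigr => i _; rewrite (is_linearZ lin).
Qed.

Lemma iV_connection_term N' (q' : 'I_N' -> V) (t' : 'I_N' -> W) x b :
  dual_frames pair q' t' -> iV x (connection_term q' t' b) = g2 (nab x b).
Proof.
move=> qt'; rewrite (nab_frame x b qt') gen2_sum (sder_sum _ _ _ (sder_iV U pairP x)).
apply: eq_bigr => i _; rewrite (sderM (sder_iV U pairP x)) (iV_gen1 U pairP) (iV_gen2 pairP).
by rewrite mulr0 addr0.
Qed.

Definition nab_rep xi b : W := \sum_i xi (nab (q i) b) *: t i.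

Lemma pair_nab_rep x xi b : pair x (nab_rep xi b) = xi (nab x b).
Proof.
apply: (linear_rep pairP qt (phi := fun x => xi (nab x b))) => f y z.
by rewrite (conn_linear (dr_conn DP)) dual_linear.
Qed.

Lemma iU_connection_term xi N' (q' : 'I_N' -> V) (t' : 'I_N' -> W) b :
  dual_frames pair q' t' -> iU xi (connection_term q' t' b) = g1 (nab_rep xi b).
Proof.
move=> qt'; have -> : nab_rep xi b = \sum_i xi (nab (q' i) b) *: t' i.
  apply: (pair_inj qt) => x; rewrite pair_nab_rep.
  rewrite (linear_rep pairP qt' (phi := fun x => xi (nab x b))) // => f y z.
  by rewrite (conn_linear (dr_conn DP)) dual_linear.
rewrite gen1_sum (sder_sum _ _ _ (sder_iU W xi)); apply: eq_bigr => i _.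
rewrite (sderM (sder_iU W xi)) iU_gen1 iU_gen2 mul0r add0r /=.
by rewrite gscal_comm.
Qed.

Lemma connection_term_indep N' (q' : 'I_N' -> V) (t' : 'I_N' -> W) b :
  dual_frames pair q' t' -> connection_term q t b = connection_term q' t' b.
Proof.
move=> qt'; apply: (gdeg_eq pairP qt bP (k := 2)); try exact: gdeg_connection_term.
  by move=> x; rewrite !iV_connection_term.
by move=> xi; rewrite !iU_connection_term.
Qed.

Definition homological_vf : G -> G :=
  gder true (fun f => g1 (rs f)) (fun u => fun_of_2form U q t (dull_d pair rho Delta u) + g2 (d u))
    (fun b => - fun_of_3form U q t (fun x y z => omega pair w x y z b) + connection_term q t b).

Lemma homological_vf_data : @gder_data _ W U true (fun f => g1 (rs f))
  (fun u => fun_of_2form U q t (dull_d pair rho Delta u) + g2 (d u))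
  (fun b => - fun_of_3form U q t (fun x y z => omega pair w x y z b) + connection_term q t b).
Proof.
split=> [f g|f g|f u u'|f b b'|f|u|b].
- by rewrite rs_add gen1D.
- by rewrite rs_mul gen1D !gen1Z addrC [gs g * _]gscal_comm.
- rewrite (gen1_wedge pairP qt bP) (dr_linear DP f) gen2_linear.
  rewrite mulrDr.
  (* The middle summand is the 2-form of the product of [rs f] and u; the factor 1 gives it the
     shape f w + w' expected by [scale_2form]. *)
  rewrite (eq_2form U q t (w' := fun x y => f * dull_d pair rho Delta u x y +
     (1 * (pair x (rs f) * pair y u - pair y (rs f) * pair x u) + dull_d pair rho Delta u' x y))).
    by rewrite !scale_2form gscal1 mul1r; zmodule.
  move=> x y; rewrite !dull_dE (pairing_r pairP) (dr_addr DP) (dr_leibniz DP).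
  rewrite !(pairEr pairP) !(dr_rs DP) !(anchorE rhoP).
  by ring.
- have -> : connection_term q t (f *: b + b') =
      g1 (rs f) * g2 b + gs f * connection_term q t b + connection_term q t b'.
    rewrite {1}[rs f]qt.2 gen1_sum mulr_suml mulr_sumr -!big_split; apply: eq_bigr => i _ /=.
    rewrite (conn_add (dr_conn DP)) (conn_leibniz (dr_conn DP)) !gen2D !gen2Z !mulrDr (dr_rs DP).
    by rewrite -!mulrA !gscalCA; zmodule.
  rewrite (eq_3form U q t (w' := fun x y z => f * omega pair w x y z b + omega pair w x y z b')).
    by rewrite scale_3form mulrDr mulrN; zmodule.
  by move=> x y z; rewrite /omega (h2_linear (dr_2form DP)) (pairing_r pairP).
- exact: ghom_gen1.
- by apply: ghomD; [exact: (gdeg_hom (gdeg_2form _ _ _ _))|exact: ghom_gen2].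
- apply: ghomD; first exact: (ghomN (gdeg_hom (gdeg_3form _ _ _ _))).
  exact: (gdeg_hom (gdeg_connection_term _ _ _)).
Qed.

Lemma homological_vf_exists : exists Q, is_homological_vf pair rho d Delta nab w Q.
Proof.
have HP := homological_vf_data.
exists homological_vf; have sQ : sder true homological_vf := sder_gder HP.
have Q0 f : homological_vf (gs f) = _ := gder_scal HP f.
have Q1 u : homological_vf (g1 u) = _ := gder_gen1 HP u.
have Q2 b : homological_vf (g2 b) = _ := gder_gen2 HP b.
split=> [|N' q' t' qt' f|N' q' t' qt' u|N' q' t' qt' b].
- apply: (sder_is_derivation1 sQ) => [r|f|u|b].
  + rewrite Q0 (_ : rs _ = 0) ?gen1_0 //; apply: (pair_inj qt) => x.
    by rewrite (dr_rs DP) (anchor_cst rhoP) (pair0r pairP).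
  + by rewrite Q0; exact: gdeg_gen1.
  + by rewrite Q1; apply: gdegD; [exact: gdeg_2form|exact: gdeg_gen2].
  + rewrite Q2; apply: gdegD; first exact: gdegN (gdeg_3form _ _ _ _).
    exact: gdeg_connection_term.
- rewrite Q0 [rs f](qt'.2) gen1_sum.
  by apply: eq_bigr => i _; rewrite (dr_rs DP).
- rewrite Q1 (form2_indep pairP qt qt' bP) //; exact: dull_d_2form.
- rewrite Q2 (form3_indep pairP qt qt' bP); last exact: omega_3form.
  by rewrite (connection_term_indep b qt').
Qed.

Lemma nabla_star_subproof x xi f b b' :
  nabla_star rho nab x xi (f *: b + b') =
  f * nabla_star rho nab x xi b + nabla_star rho nab x xi b'.
Proof.
rewrite /nabla_star (conn_add (dr_conn DP)) (conn_leibniz (dr_conn DP)).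
by rewrite !dual_add !dual_scale !(anchorE rhoP); ring.
Qed.
Definition nabla_dual x xi : dual U := MkDual (nabla_star_subproof x xi).

Lemma pair_dual_subproof z (phi : U -> W) (phiP : is_linear phi) f b b' :
  pair z (phi (f *: b + b')) = f * pair z (phi b) + pair z (phi b').
Proof. by rewrite phiP (pairing_r pairP). Qed.
Definition pair_dual z (phi : U -> W) (phiP : is_linear phi) : dual U :=
  MkDual (pair_dual_subproof z phiP).

Section HomologicalVectorField.
Variables (Q : G -> G) (QP : is_homological_vf pair rho d Delta nab w Q).

Let sQ : sder true Q := is_derivation1_sder (hvf_der QP).
Let sV x : sder true (iV x) := sder_iV U pairP x.
Let sU xi : sder false (iU xi) := sder_iU W xi.

Lemma hvf_scal f : Q (gs f) = g1 (rs f).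
Proof.
rewrite (hvf_fun QP qt) [rs f](qt.2) gen1_sum.
by apply: eq_bigr => i _; rewrite (dr_rs DP).
Qed.

Lemma iV_hvf1 x u : iV x (Q (g1 u)) = g1 (Delta x u - rs (pair x u)).
Proof.
rewrite (hvf_gen1 QP qt) (sderD (sV x)) (iV_gen2 pairP) addr0.
apply: (iV_2form _ pairP qt (dull_d_2form u)) => y; by rewrite dull_dE.
Qed.

Lemma iU_hvf1 xi u : iU xi (Q (g1 u)) = gs (xi (d u)).
Proof. by rewrite (hvf_gen1 QP qt) (sderD (sU xi)) iU_2form add0r iU_gen2. Qed.

Lemma iV_hvf2 x b : iV x (Q (g2 b)) =
  g2 (nab x b) - fun_of_2form U q t (fun y z => omega pair w x y z b).
Proof.
rewrite (hvf_gen2 QP qt) (sderD (sV x)) (sderN _ (sV x)) addrC.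
rewrite (iV_connection_term _ _ qt) (iV_3form U pairP qt) //; exact: omega_3form.
Qed.

Lemma iU_hvf2 xi b : iU xi (Q (g2 b)) = g1 (nab_rep xi b).
Proof.
rewrite (hvf_gen2 QP qt) (sderD (sU xi)) (sderN _ (sU xi)) iU_3form oppr0 add0r.
exact: iU_connection_term.
Qed.

Lemma iVV_hvf2 x y b : iV y (iV x (Q (g2 b))) = - g1 (w x y b).
Proof.
rewrite iV_hvf2 (sderD (sV y)) (sderN _ (sV y)) (iV_gen2 pairP) add0r; congr (- _).
by apply: (iV_2form _ pairP qt (form3_2form x (omega_3form b))).
Qed.

Lemma iUV_hvf2 xi x b : iU xi (iV x (Q (g2 b))) = gs (xi (nab x b)).
Proof.
by rewrite iV_hvf2 (sderD (sU xi)) (sderN _ (sU xi)) iU_2form iU_gen2 subr0.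
Qed.

Lemma iWV_hvf2 phi x b : is_linear phi -> iW phi (iV x (Q (g2 b))) = g1 (phi (nab x b)).
Proof.
move=> phiP; have sW := sder_iW phiP.
by rewrite iV_hvf2 (sderD sW) (sderN _ sW) iW_2form // iW_gen2 // subr0.
Qed.

(* Cartan calculus: the graded commutators of contractions with the homological vector field. *)
Definition lieV x a := scomm true true (iV x) Q a.
Definition lieU xi a := scomm false true (iU xi) Q a.

Lemma sder_lieV x : sder false (lieV x). Proof. exact: sder_comm (sV x) sQ. Qed.
Lemma sder_lieU xi : sder true (lieU xi). Proof. exact: sder_comm (sU xi) sQ. Qed.

Lemma lieVE x a : iV x (Q a) = lieV x a - Q (iV x a).
Proof. by rewrite /lieV /scomm /=; zmodule. Qed.
Lemma lieUE xi a : iU xi (Q a) = lieU xi a + Q (iU xi a).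
Proof. by rewrite /lieU /scomm /=; zmodule. Qed.

Lemma lieV_scal x f : lieV x (gs f) = gs (rho x f).
Proof.
rewrite /lieV /scomm /= (iV_scal U pairP) (sder0 sQ) hvf_scal (iV_gen1 U pairP) (dr_rs DP).
by zmodule.
Qed.
Lemma lieV_gen1 x u : lieV x (g1 u) = g1 (Delta x u).
Proof.
by rewrite /lieV /scomm /= (iV_gen1 U pairP) hvf_scal iV_hvf1 opprK -gen1D subrK.
Qed.
Lemma lieV_gen2 x b : lieV x (g2 b) = iV x (Q (g2 b)).
Proof. by rewrite /lieV /scomm /= (iV_gen2 pairP) (sder0 sQ); zmodule. Qed.
Lemma lieU_gen1 xi u : lieU xi (g1 u) = gs (xi (d u)).
Proof. by rewrite /lieU /scomm /= iU_hvf1 iU_gen1 (sder0 sQ) subr0. Qed.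

Lemma lieU_scal xi f : lieU xi (gs f) = 0.
Proof. by rewrite /lieU /scomm /= hvf_scal iU_gen1 iU_scal (sder0 sQ) subrr. Qed.
Lemma lieU_gen2 xi b : lieU xi (g2 b) = g1 (nab_rep xi b - rs (xi b)).
Proof. by rewrite /lieU /scomm /= iU_hvf2 iU_gen2 hvf_scal gen1D gen1N. Qed.

(** The Cartan relation between L_x and i_y, with the correction [iW (w x y)]: on generators of
    degree 2, L_x adds to the connection a form built from the curvature. *)
Lemma iV_lieV x y a : iV y (lieV x a) =
  lieV x (iV y a) - iV (br x y) a - iW (w x y) a.
Proof.
have wP : is_linear (w x y) := h2_linear (dr_2form DP) x y.
have sW := sder_iW wP.
pose D a := scomm true false (iV y) (lieV x) a + (iV (br x y) a + iW (w x y) a).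
suff : D a = 0 by rewrite /D /scomm /= => /eqP; rewrite addr_eq0 subr_eq => /eqP->; zmodule.
have DD : sder true D.
  exact: (sder_add (sder_comm (sV y) (sder_lieV x)) (sder_add (sV _) sW)).
apply: (sder_eq0 DD) => [f|u|b]; rewrite /D /scomm /=.
- by rewrite lieV_scal !(iV_scal U pairP) iW_scal // (sder0 (sder_lieV x)); zmodule.
- rewrite lieV_gen1 !(iV_gen1 U pairP) iW_gen1 // lieV_scal (dr_br DP) /dull_pairing.
  by rewrite gscalD gscalN; zmodule.
- rewrite lieV_gen2 iVV_hvf2 !(iV_gen2 pairP) (sder0 (sder_lieV x)) iW_gen2 //.
  by zmodule.
Qed.

Lemma iU_lieV xi x a : iU xi (lieV x a) = lieV x (iU xi a) - iU (nabla_dual x xi) a.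
Proof.
pose D a := scomm false false (iU xi) (lieV x) a + iU (nabla_dual x xi) a.
suff : D a = 0 by rewrite /D /scomm /= => /eqP; rewrite addr_eq0 subr_eq => /eqP->; zmodule.
have DD : sder false D by exact: (sder_add (sder_comm (sU xi) (sder_lieV x)) (sU _)).
apply: (sder_eq0 DD) => [f|u|b]; rewrite /D /scomm /=.
- by rewrite lieV_scal !iU_scal (sder0 (sder_lieV x)); zmodule.
- by rewrite lieV_gen1 !iU_gen1 (sder0 (sder_lieV x)); zmodule.
- rewrite lieV_gen2 iUV_hvf2 !iU_gen2 lieV_scal /= /nabla_star gscalD gscalN.
  by zmodule.
Qed.

Lemma iU_lieU xi xi' a : iU xi' (lieU xi a) = lieU xi (iU xi' a).
Proof.
apply/eqP; rewrite -subr_eq0; apply/eqP.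
have DD := sder_comm (sU xi') (sder_lieU xi).
apply: (sder_eq0 DD) a => [f|u|b]; rewrite /scomm /=.
- by rewrite lieU_scal !iU_scal !(sder0 (sU _), sder0 (sder_lieU xi)) subrr.
- by rewrite lieU_gen1 iU_scal iU_gen1 (sder0 (sder_lieU xi)) subrr.
- by rewrite lieU_gen2 iU_gen1 iU_gen2 lieU_scal subrr.
Qed.

Lemma iV_iW phi (phiP : is_linear phi) x a :
  iV x (iW phi a) = iU (pair_dual x phiP) a - iW phi (iV x a).
Proof.
have sW := sder_iW phiP.
pose D a := scomm true true (iV x) (iW phi) a - iU (pair_dual x phiP) a.
suff : D a = 0 by rewrite /D /scomm /= => /eqP; rewrite subr_eq0 subr_eq => /eqP->; zmodule.
have DD : sder false D := sder_add (sder_comm (sV x) sW) (sder_opp (sU _)).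
apply: (sder_eq0 DD) => [f|u|b]; rewrite /D /scomm /=.
- by rewrite iW_scal // (iV_scal U pairP) iU_scal !(sder0 (sV _), sder0 sW); zmodule.
- by rewrite iW_gen1 // (iV_gen1 U pairP) iW_scal // iU_gen1 !(sder0 (sV _)); zmodule.
- rewrite iW_gen2 // (iV_gen1 U pairP) (iV_gen2 pairP) iU_gen2 /= (sder0 sW); zmodule.
Qed.

Lemma iU_iW phi (phiP : is_linear phi) xi a :
  iU xi (iW phi a) = iW phi (iU xi a).
Proof.
have sW := sder_iW phiP.
apply/eqP; rewrite -subr_eq0; apply/eqP.
apply: (sder_eq0 (sder_comm (sU xi) sW)) a => [f|u|b]; rewrite /scomm /=.
- by rewrite iW_scal // iU_scal !(sder0 (sU _), sder0 sW) subr0.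
- by rewrite iW_gen1 // iU_gen1 !(sder0 (sU _), sder0 sW) subr0.
- by rewrite iW_gen2 // iU_gen1 iU_gen2 iW_scal // subr0.
Qed.

(** A degree 2 element: its contractions with Q vanish by [dr_exact], those with B' by [drs]. *)
Lemma hvf_sq_scal f : Q (Q (gs f)) = 0.
Proof.
have d2 : gdeg 2 (Q (Q (gs f))).
  exact: (d1_deg (hvf_der QP) (d1_deg (hvf_der QP) (gdeg_scal _ _ f))).
apply: (gdeg_eq0 pairP qt bP d2) => [x|xi]; rewrite hvf_scal.
  by rewrite iV_hvf1 (dr_rs DP) (dr_exact DP) subrr gen1_0.
by rewrite iU_hvf1 drs dual_zero.
Qed.

Lemma hvf_sq_gen1 u : Q (Q (g1 u)) = 0.
Proof.
have dQ k a : gdeg k a -> gdeg k.+1 (Q a) := d1_deg (hvf_der QP) (x := a).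
have d3 := dQ _ _ (dQ _ _ (gdeg_gen1 _ u)).
apply: (gdeg3_eq0 pairP qt bP d3) => x.
(* The exact part of i_x Q u is Q of a function, so the preceding lemma removes it after another
   application of Q. *)
have E : iV x (Q (Q (g1 u))) = lieV x (Q (g1 u)) - Q (g1 (Delta x u)).
  rewrite lieVE iV_hvf1 gen1D gen1N (sderD sQ) (sderN _ sQ) -hvf_scal hvf_sq_scal.
  by zmodule.
apply: (gdeg_eq0 pairP qt bP (iV_deg pairP x d3)) => [y|xi]; rewrite E.
  rewrite (sderD (sV y)) (sderN _ (sV y)) iV_lieV !iV_hvf1 lieV_gen1.
  have wP : is_linear (w x y) := h2_linear (dr_2form DP) x y.
  (* The correction term of [iV_lieV] supplies R composed with d, which balances the curvature of
     Delta. *)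
  have -> : iW (w x y) (Q (g1 u)) = g1 (w x y (d u)).
    rewrite (hvf_gen1 QP qt) (sderD (sder_iW wP)) iW_2form // iW_gen2 //.
    by zmodule.
  rewrite -!(gen1D, gen1N) -[RHS](gen1_0 W U); congr (g1 _).
  apply: (pair_inj qt) => z.
  have Delta0 : Delta x (- rs (pair y u)) = - rs (rho x (pair y u)).
    have := dr_addr DP x (- rs (pair y u)) (rs (pair y u)).
    rewrite addNr (dr_exact DP) => e; apply/eqP; rewrite -addr_eq0 -e; apply/eqP.
    have := dr_addr DP x 0 0; rewrite addr0 => e0.
    by apply: (addrI (Delta x 0)); rewrite -e0 addr0.
  rewrite (dr_addr DP) Delta0 (dr_curv0 DP) /curvature !(pairEr pairP) !(dr_rs DP).
  rewrite (dr_br DP) /dull_pairing !(anchorE rhoP); ring.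
rewrite (sderD (sU xi)) (sderN _ (sU xi)) iU_lieV !iU_hvf1 lieV_scal /= /nabla_star.
by rewrite (dr_chain DP) gscalD gscalN; zmodule.
Qed.

(** The transpose of [drs]; it strips [dr_sym] of its derivative terms. *)
Lemma rho_ds xi f : rho (ds xi) f = 0.
Proof. by rewrite -(dr_rs DP) (dr_ds DP) drs dual_zero. Qed.

Lemma pair_Delta x y u : pair y (Delta x u) = rho x (pair y u) - pair (br x y) u.
Proof. by rewrite (dr_br DP) /dull_pairing; ring. Qed.

Lemma iVV_hvf_sq x y b : iV y (iV x (Q (Q (g2 b)))) =
  lieV x (iV y (Q (g2 b))) - iV (br x y) (Q (g2 b)) - iW (w x y) (Q (g2 b)) -
  lieV y (iV x (Q (g2 b))) - Q (g1 (w x y b)).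
Proof.
rewrite (lieVE x) (sderD (sV y)) (sderN _ (sV y)) iV_lieV (lieVE y (iV x _)).
rewrite iVV_hvf2 (sderN _ sQ).
by zmodule.
Qed.

(** In degree 4 it is enough to contract with three sections of Q, then with two of Q and one of B',
    then with two of B'; the remaining mixed case follows from the commutation of [iU] with [iV]. *)
Lemma hvf_sq_gen2 b : Q (Q (g2 b)) = 0.
Proof.
have dQ k a : gdeg k a -> gdeg k.+1 (Q a) := d1_deg (hvf_der QP) (x := a).
have d4 := dQ _ _ (dQ _ _ (gdeg_gen2 _ b)).
have iVQ x : iV x (Q (Q (g2 b))) = 0.
  apply: (gdeg3_eq0 pairP qt bP (iV_deg pairP x d4)) => y.
  have wP : is_linear (w x y) := h2_linear (dr_2form DP) x y.
  apply: (gdeg_eq0 pairP qt bP (iV_deg pairP y (iV_deg pairP x d4))) => [z|xi];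
    rewrite iVV_hvf_sq.
    (* Three sections of Q: tested against a fourth, the identity is the closedness of omega. *)
    rewrite 4!(sderD (sV z)) 4!(sderN _ (sV z)) !iV_lieV !(iV_iW wP) !iVV_hvf2 iU_hvf2.
    rewrite !iWV_hvf2 //; try exact: (h2_linear (dr_2form DP)).
    rewrite !(sderN _ (sder_lieV _)) !lieV_gen1 iV_hvf1.
    rewrite -!(gen1D, gen1N) -[RHS](gen1_0 W U); congr (g1 _).
    apply: (pair_inj qt) => v.
    have funD (phi psi : U -> K) : (phi + psi) b = phi b + psi b by [].
    have funN (phi : U -> K) : (- phi) b = - phi b by [].
    have := dr_closed DP x y z v b; rewrite /koszul3 /nabla_star /omega !(funD, funN).
    rewrite !(pairEr pairP) pair_nab_rep /= !pair_Delta (dr_rs DP).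
    have s12 q1 q2 q3 b' : pair q3 (w q1 q2 b') = - pair q3 (w q2 q1 b').
      exact: dr_omega12 DP q1 q2 q3 b'.
    have s31 q1 q2 q3 b' : pair q3 (w q1 q2 b') = pair q2 (w q3 q1 b').
      have := dr_omega23 DP q1 q2 q3 b'; rewrite /omega => ->.
      by rewrite s12 opprK.
    (* Total skew-symmetry brings the omega terms containing a bracket to one order of arguments, so
       that [ring] can match them. *)
    rewrite (s31 y z (br x v)) (s31 x z (br y v)) (s31 x y (br z v)).
    rewrite (s12 y (br x z)) (s12 x (br y z)).
    by move=> e; rewrite -[RHS]oppr0 -e; ring.
  (* Two sections of Q and one of B': the curvature of nabla is d composed with R. *)
  rewrite 4!(sderD (sU xi)) 4!(sderN _ (sU xi)) !iU_lieV !iUV_hvf2 !(iU_iW wP) iU_hvf1.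
  rewrite iU_hvf2 iW_gen1 // !lieV_scal /= /nabla_star (dr_curv1 DP) /curvature.
  rewrite !(dual_add, dual_zero) -!scaleN1r !dual_scale !(gscalD, gscalN, mulN1r).
  zmodule.
apply: (gdeg_eq0 pairP qt bP d4) => // xi.
apply: (gdeg_eq0 pairP qt bP (iU_deg xi d4)) => [x|xi'].
  by rewrite -(iU_iV pairP) iVQ (sder0 (sU xi)).
(* Two sections of B': the symmetry condition [dr_sym]. *)
rewrite lieUE (sderD (sU xi')) iU_lieU !iU_hvf2 lieU_gen1 iU_hvf1 -gscalD.
rewrite -!(dr_ds DP) !pair_nab_rep -[RHS](gscal0 W U); congr (gs _).
by have := dr_sym DP xi xi' b; rewrite /nabla_star !rho_ds => e; rewrite -[RHS]oppr0 -e; ring.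
Qed.

Lemma hvf_split_lie2 : is_split_lie2 Q.
Proof.
split; first exact: hvf_der QP.
exact: sder_eq0 (sder_sq sQ) hvf_sq_scal hvf_sq_gen1 hvf_sq_gen2.
Qed.

End HomologicalVectorField.

End Dorfman.

(** * The Poisson bracket of degree -2 *)

Section SelfDual.
Variables (R : realType) (n : nat) (M : smoothManifold R n).
Local Notation K := (Cinf M).
Variables (V W U : lmodType K) (pair : V -> W -> K) (pairP : is_pairing pair).
Local Notation G := (gfun W U).
Local Notation gs := (gscal W U).
Local Notation g1 := (gen1 U).
Local Notation g2 := (gen2 W).
Local Notation iV := (@iV R n M V W U pair).
Variables (N : nat) (q : 'I_N -> V) (t : 'I_N -> W) (qt : dual_frames pair q t).
Variables (m : nat) (beta : 'I_m -> dual U) (bb : 'I_m -> U) (bP : is_frame beta bb).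
Variables (rhoB : U -> K -> K) (brB : U -> U -> U) (dB : W -> V)
  (nabW : U -> W -> W) (nabV : U -> V -> V) (wB : U -> U -> V -> W).
Hypothesis LB : is_lie_algebroid rhoB brB.
Hypothesis SP : is_self_dual_2rep pair rhoB brB dB nabW nabV wB.
Implicit Types (x y z v : V) (u : W) (b c : U) (f : K) (xi : dual U) (a : G).

Let rhoBP : is_anchor rhoB := la_anchor LB.
Let dBP : is_linear dB := tr_linear SP.1.
Let nWP : is_connection rhoB nabW := tr_conn0 SP.1.
Let wBP : is_hom_2form wB := tr_2form SP.1.
Let dB_sym u u' : pair (dB u) u' = pair (dB u') u.
Proof. by have [_ []] := SP. Qed.
Let nab_dual b x u : rhoB b (pair x u) = pair (nabV b x) u + pair x (nabW b u).
Proof. by have [_ []] := SP. Qed.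
Let wB_skew b c x y : pair x (wB b c y) = - pair y (wB b c x).
Proof. by have [_ []] := SP. Qed.

Definition curv_form b c x y : K := pair y (wB b c x).

Lemma curv_2form b c : is_2form (curv_form b c).
Proof.
split=> [f x y z|x y]; last exact: wB_skew.
by rewrite /curv_form (h2_linear wBP) (pairing_r pairP).
Qed.

Lemma curv_form_linear b f c c' x y :
  curv_form b (f *: c + c') x y = f * curv_form b c x y + curv_form b c' x y.
Proof.
rewrite /curv_form !(h2_skew wBP b) (h2_form wBP) !(pairEr pairP); ring.
Qed.
Lemma curv_form_skew b c x y : curv_form b c x y = - curv_form c b x y.
Proof. by rewrite /curv_form (h2_skew wBP) (pairNr pairP). Qed.

Lemma brB_linear b f c c' : brB b (f *: c + c') = f *: brB b c + rhoB b f *: c + brB b c'.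
Proof. by rewrite (la_addr LB) (la_leibniz LB). Qed.
Lemma brB_linearl f b b' c : brB (f *: b + b') c = f *: brB b c - rhoB c f *: b + brB b' c.
Proof.
by rewrite (la_skew LB) brB_linear (la_skew LB c b) (la_skew LB c b') scalerN; zmodule.
Qed.

Definition curv b c : G := fun_of_2form U q t (curv_form b c).

Lemma curv_linear b f c c' : curv b (f *: c + c') = gs f * curv b c + curv b c'.
Proof.
rewrite /curv -scale_2form; apply: eq_2form => x y; exact: curv_form_linear.
Qed.
Lemma curv_skew b c : curv b c = - curv c b.
Proof.
rewrite /curv /fun_of_2form -sumrN; apply: eq_bigr => i _; rewrite -sumrN.
by apply: eq_bigr => j _; rewrite curv_form_skew gscalN !mulNr.
Qed.

(** * Hamiltonian derivations and the construction of the bracket *)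

Definition ham0 f : G -> G := gder false (fun=> 0) (fun=> 0) (fun b => - gs (rhoB b f)).
Definition ham1 u : G -> G :=
  gder true (fun=> 0) (fun u' => gs (pair (dB u) u')) (fun b => - g1 (nabW b u)).
Definition ham2 b : G -> G :=
  gder false (fun f => gs (rhoB b f)) (fun u => g1 (nabW b u))
    (fun c => g2 (brB b c) - curv b c).

Lemma ham0_data f : @gder_data _ W U false (fun=> 0) (fun=> 0) (fun b => - gs (rhoB b f)).
Proof.
apply: gder_data0 => [g u v|g b c|u|b].
- by rewrite mulr0 addr0.
- by rewrite (anchor_linear rhoBP) gscalD gscalM mulrN; zmodule.
- exact: ghom0.
- exact: (ghomN (ghom_scal _ _ _)).
Qed.
Lemma ham1_data u : @gder_data _ W U true (fun=> 0)
  (fun u' => gs (pair (dB u) u')) (fun b => - g1 (nabW b u)).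
Proof.
apply: gder_data0 => [g u' v|g b c|u'|b].
- by rewrite (pairing_r pairP) gscalD gscalM.
- by rewrite (conn_linear nWP) gen1_linear mulrN; zmodule.
- exact: ghom_scal.
- exact: (ghomN (ghom_gen1 _ _)).
Qed.
Lemma ham2_data b : @gder_data _ W U false (fun f => gs (rhoB b f)) (fun u => g1 (nabW b u))
    (fun c => g2 (brB b c) - curv b c).
Proof.
split=> [f g|f g|f u v|f c c'|f|u|c].
- by rewrite (anchorD rhoBP) gscalD.
- by rewrite (anchorM rhoBP) gscalD !gscalM.
- by rewrite (conn_add nWP) (conn_leibniz nWP) !gen1D !gen1Z; zmodule.
- by rewrite brB_linear curv_linear !gen2D !gen2Z mulrDr mulrN; zmodule.
- exact: ghom_scal.
- exact: ghom_gen1.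
- by apply: ghomD; [exact: ghom_gen2|exact: (ghomN (gdeg_hom (gdeg_2form _ _ _ _)))].
Qed.

Lemma sder_ham0 f : sder false (ham0 f). Proof. exact: sder_gder (ham0_data f). Qed.
Lemma sder_ham1 u : sder true (ham1 u). Proof. exact: sder_gder (ham1_data u). Qed.
Lemma sder_ham2 b : sder false (ham2 b). Proof. exact: sder_gder (ham2_data b). Qed.
Lemma ham00 f g : ham0 f (gs g) = 0. Proof. exact: gder_scal (ham0_data f) g. Qed.
Lemma ham01 f u : ham0 f (g1 u) = 0. Proof. exact: gder_gen1 (ham0_data f) u. Qed.
Lemma ham02 f b : ham0 f (g2 b) = - gs (rhoB b f). Proof. exact: gder_gen2 (ham0_data f) b. Qed.
Lemma ham10 u g : ham1 u (gs g) = 0. Proof. exact: gder_scal (ham1_data u) g. Qed.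
Lemma ham11 u u' : ham1 u (g1 u') = gs (pair (dB u) u').
Proof. exact: gder_gen1 (ham1_data u) u'. Qed.
Lemma ham12 u b : ham1 u (g2 b) = - g1 (nabW b u). Proof. exact: gder_gen2 (ham1_data u) b. Qed.
Lemma ham20 b g : ham2 b (gs g) = gs (rhoB b g). Proof. exact: gder_scal (ham2_data b) g. Qed.
Lemma ham21 b u : ham2 b (g1 u) = g1 (nabW b u). Proof. exact: gder_gen1 (ham2_data b) u. Qed.
Lemma ham22 b c : ham2 b (g2 c) = g2 (brB b c) - curv b c.
Proof. exact: gder_gen2 (ham2_data b) c. Qed.
Let hamE := (ham00, ham01, ham02, ham10, ham11, ham12, ham20, ham21, ham22).

Lemma ham0D f g a : ham0 (f + g) a = ham0 f a + ham0 g a.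
Proof.
apply: (sder_ext (sder_ham0 _) (sder_add (sder_ham0 f) (sder_ham0 g))) a => [h|u|b];
  rewrite !hamE; try zmodule.
by rewrite (anchorD rhoBP) gscalD; zmodule.
Qed.

Lemma ham0M f g a : ham0 (f * g) a = gs g * ham0 f a + gs f * ham0 g a.
Proof.
have H := sder_add (sder_mull (ghom_scal _ _ g) (sder_ham0 f))
                   (sder_mull (ghom_scal _ _ f) (sder_ham0 g)).
apply: (sder_ext (sder_ham0 _) H) a => [h|u|b]; rewrite !hamE ?mulr0; try zmodule.
rewrite (anchorM rhoBP) gscalD !gscalM !mulrN [gs (rhoB b f) * _]gscal_comm.
by zmodule.
Qed.

(** The Leibniz rule in the first argument, {f u, .} = u {f, .} + f {u, .}. With its analogues for
    products of functions and for generators of degree 2, it makes [ham_of] respect the relations of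
    the algebra. *)
Lemma ham1_linear f u u' a :
  ham1 (f *: u + u') a = g1 u * ham0 f a + gs f * ham1 u a + ham1 u' a.
Proof.
have H := sder_add (sder_add (sder_mull (ghom_gen1 _ u) (sder_ham0 f))
  (sder_mull (ghom_scal _ _ f) (sder_ham1 u))) (sder_ham1 u').
apply: (sder_ext (sder_ham1 _) H) a => [h|v|b]; rewrite !hamE ?mulr0; try zmodule.
  by rewrite dBP (pairing_l pairP) gscalD gscalM; zmodule.
rewrite (conn_add nWP) (conn_leibniz nWP) !gen1D !gen1Z !mulrN -gscal_comm.
by zmodule.
Qed.

Lemma ham2_linear f b c a :
  ham2 (f *: b + c) a = g2 b * ham0 f a + gs f * ham2 b a + ham2 c a.
Proof.
have H := sder_add (sder_add (sder_mull (ghom_gen2 _ b) (sder_ham0 f))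
  (sder_mull (ghom_scal _ _ f) (sder_ham2 b))) (sder_ham2 c).
apply: (sder_ext (sder_ham2 _) H) a => [h|v|b']; rewrite !hamE ?mulr0 ?add0r.
- by rewrite (anchor_linear rhoBP) gscalD gscalM.
- by rewrite (conn_linear nWP) gen1_linear.
- rewrite brB_linearl curv_skew curv_linear (curv_skew b') (curv_skew b').
  rewrite !gen2D gen2N !gen2Z [g2 b * _]gen2C mulrDr mulNr mulrN.
  by zmodule.
Qed.

Section Ham.
Variables (p : bool) (a : G) (ha : ghom p a).

(* For a of parity p this is {a, .}: skew-symmetry gives its values on generators from the
   Hamiltonian derivations {f, .}, {u, .} and {b, .}. *)
Definition ham_of : G -> G := gder p (fun f => - ham0 f a) (fun u => - gsgn p (ham1 u a))
  (fun b => - ham2 b a).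

Lemma ham_of_data : @gder_data _ W U p (fun f => - ham0 f a) (fun u => - gsgn p (ham1 u a))
  (fun b => - ham2 b a).
Proof.
split=> [f g|f g|f u v|f b c|f|u|b].
- by rewrite ham0D; zmodule.
- by rewrite ham0M !mulNr mulrN -gscal_comm; zmodule.
- rewrite ham1_linear !gsgnD mulrN mulNr -gsgnMr.
  rewrite (ghomC (ghom_sder (sder_ham0 f) ha) (ghom_gen1 _ u)) andbT addFb.
  by zmodule.
- rewrite ham2_linear mulrN mulNr gen2C; zmodule.
- exact: (ghomN (ghom_sder (sder_ham0 f) ha)).
- exact: (ghomN (ghom_sgn _ (ghom_sder (sder_ham1 u) ha))).
- exact: (ghomN (ghom_sder (sder_ham2 b) ha)).
Qed.
Lemma sder_ham_of : sder p ham_of. Proof. exact: sder_gder ham_of_data. Qed.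
Lemma ham_of0 f : ham_of (gs f) = - ham0 f a. Proof. exact: gder_scal ham_of_data f. Qed.
Lemma ham_of1 u : ham_of (g1 u) = - gsgn p (ham1 u a).
Proof. exact: gder_gen1 ham_of_data u. Qed.
Lemma ham_of2 b : ham_of (g2 b) = - ham2 b a. Proof. exact: gder_gen2 ham_of_data b. Qed.
End Ham.
Let ham_ofE := (ham_of0, ham_of1, ham_of2).

Lemma ham_ofD p a a' (b : G) : ghom p a -> ghom p a' ->
  ham_of p (a + a') b = ham_of p a b + ham_of p a' b.
Proof.
move=> ha ha'.
apply: (sder_ext (sder_ham_of (ghomD ha ha')) (sder_add (sder_ham_of ha) (sder_ham_of ha'))) b
  => [f|u|b]; rewrite !ham_ofE //; try exact: ghomD.
- by rewrite (sderD (sder_ham0 f)); zmodule.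
- by rewrite (sderD (sder_ham1 u)) gsgnD; zmodule.
- by rewrite (sderD (sder_ham2 b)); zmodule.
Qed.

Lemma ham_of_0 p (b : G) : ham_of p 0 b = 0.
Proof.
apply: (sder_eq0 (sder_ham_of (ghom0 _ _ p))) b => [f|u|b]; rewrite ham_ofE; try exact: ghom0.
- by rewrite (sder0 (sder_ham0 f)) oppr0.
- by rewrite (sder0 (sder_ham1 u)) gsgn0 oppr0.
- by rewrite (sder0 (sder_ham2 b)) oppr0.
Qed.

Lemma ham_ofM p p' a a' (b : G) : ghom p a -> ghom p' a' ->
  ham_of (p (+) p') (a * a') b = a * ham_of p' a' b + gsgn (p && p') (a' * ham_of p a b).
Proof.
move=> ha ha'.
have H : sder (p (+) p') (fun b : G => a * ham_of p' a' b + gsgn (p && p') (a' * ham_of p a b)).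
  apply: sder_add; first exact: (sder_mull ha (sder_ham_of ha')).
  by apply: sder_sgnf; rewrite addbC; exact: (sder_mull ha' (sder_ham_of ha)).
apply: (sder_ext (sder_ham_of (ghomM ha ha')) H) b => [f|u|b];
  rewrite !ham_ofE //; try exact: ghomM.
- rewrite (sderM (sder_ham0 f)) (ghomC (ghom_sder (sder_ham0 f) ha) ha') /=.
  by rewrite !mulrN gsgnN; zmodule.
- rewrite (sderM (sder_ham1 u)) (ghomC (ghom_sder (sder_ham1 u) ha) ha') (gtw_hom _ ha) /=.
  by case: (p); case: (p'); rewrite /= ?mulrN ?mulNr; zmodule.
- rewrite (sderM (sder_ham2 b)) (ghomC (ghom_sder (sder_ham2 b) ha) ha') /=.
  by rewrite !mulrN gsgnN; zmodule.
Qed.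

(** This lemma and the next two amount to skew-symmetry on pairs of generators: it rests on the
    symmetry of [dB] in degree 1, and on that of the bracket of B and of its curvature form in
    degree 2. *)
Lemma ham_of_scal f a : ham_of false (gs f) a = ham0 f a.
Proof.
apply: (sder_ext (sder_ham_of (ghom_scal _ _ f)) (sder_ham0 f)) a => [g|u|b];
  rewrite ?ham_ofE ?hamE //=; try exact: ghom_scal; zmodule.
Qed.
Lemma ham_of_gen1 u a : ham_of true (g1 u) a = ham1 u a.
Proof.
apply: (sder_ext (sder_ham_of (ghom_gen1 _ u)) (sder_ham1 u)) a => [g|u'|b];
  rewrite ?ham_ofE ?hamE //=; try exact: ghom_gen1.
  zmodule.
by rewrite opprK dB_sym.
Qed.
Lemma ham_of_gen2 b a : ham_of false (g2 b) a = ham2 b a.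
Proof.
apply: (sder_ext (sder_ham_of (ghom_gen2 _ b)) (sder_ham2 b)) a => [g|u'|c];
  rewrite ?ham_ofE ?hamE //=; try exact: ghom_gen2; try by rewrite opprK.
by rewrite (la_skew LB) gen2N (curv_skew c); zmodule.
Qed.

(** Built into [ham_of] when a is a generator; it passes to products because both sides obey the
    Leibniz rule in a. *)
Lemma ham_of_skew k l a a' : gdeg k a -> gdeg l a' ->
  ham_of (odd k) a a' = - gsgn (odd k && odd l) (ham_of (odd l) a' a).
Proof.
move=> da da'; have ha' := gdeg_hom da'.
elim: da => {k a} [f|u|b|k|k x y dx ex dy ey|k k' x y dx ex dy ey].
- by rewrite ham_of_scal ham_of0 //= opprK.
- by rewrite ham_of_gen1 ham_of1 //= gsgnN gsgnK opprK.
- by rewrite ham_of_gen2 ham_of2 //= opprK.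
- by rewrite ham_of_0 (sder0 (sder_ham_of ha')) gsgn0 oppr0.
- have [hx hy] := (gdeg_hom dx, gdeg_hom dy).
  by rewrite ham_ofD // (sderD (sder_ham_of ha')) gsgnD ex ey; zmodule.
- have [hx hy] := (gdeg_hom dx, gdeg_hom dy).
  rewrite oddD ham_ofM // (sderM (sder_ham_of ha')) ex ey.
  rewrite (ghomC (ghom_sder (sder_ham_of ha') hx) hy) (gtw_hom _ hx).
  by case: (odd k); case: (odd l); case: (odd k') => /=; rewrite ?mulrN ?mulNr; zmodule.
Qed.

(** The bracket must be defined on all pairs, whereas [ham_of] requires a first argument of definite
    parity: one half splits any element into an even and an odd part. *)
Definition half : K := cstf M 2%:R^-1.
Lemma halfD a : gs half * a + gs half * a = a.
Proof.
by rewrite -mulrDl -gscalD -mulr2n -mulr_natr (cstf_inv M 1) gscal1 mul1r.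
Qed.
Definition even_part a : G := gs half * (a + gpar a).
Definition odd_part a : G := gs half * (a - gpar a).

Lemma ghom_even_part a : ghom false (even_part a).
Proof. exact: (ghomM (ghom_scal _ _ _) (ghom_even a)). Qed.
Lemma ghom_odd_part a : ghom true (odd_part a).
Proof. exact: (ghomM (ghom_scal _ _ _) (ghom_odd a)). Qed.
Lemma even_part_deg k a : gdeg k a -> even_part a = if odd k then 0 else a.
Proof.
move=> da; rewrite /even_part (gdeg_par da); case: odd => /=; first by rewrite subrr mulr0.
by rewrite mulrDr halfD.
Qed.
Lemma odd_part_deg k a : gdeg k a -> odd_part a = if odd k then a else 0.
Proof.
move=> da; rewrite /odd_part (gdeg_par da); case: odd => /=; last by rewrite subrr mulr0.
by rewrite opprK mulrDr halfD.
Qed.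

Definition self_dual_bracket a a' : G :=
  ham_of false (even_part a) a' + ham_of true (odd_part a) a'.

Lemma self_dual_bracketE k a a' : gdeg k a -> self_dual_bracket a a' = ham_of (odd k) a a'.
Proof.
move=> da; rewrite /self_dual_bracket (even_part_deg da) (odd_part_deg da).
by case: odd; rewrite ham_of_0; zmodule.
Qed.

Lemma ham_of_cst p r a a' : ghom p a ->
  ham_of p (gs (cstf M r) * a) a' = gs (cstf M r) * ham_of p a a'.
Proof.
move=> ha; rewrite -[p]addFb ham_ofM //; last exact: ghom_scal.
rewrite addFb ham_of_scal /= (sder_eq0 (sder_ham0 _)) ?mulr0 ?addr0 // => [f|u|b].
- exact: ham00.
- exact: ham01.
- by rewrite ham02 (anchor_cst rhoBP) gscal0 oppr0.
Qed.

Lemma ham2_degB b k a : gdeg k a -> gdegB 2 (2 + k) (ham2 b a).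
Proof.
move=> da; apply: (sder_deg (sder_ham2 b)) da => [g|u'|c]; rewrite hamE.
- exact: gdeg_scal.
- exact: gdeg_gen1.
- exact: (gdegD (gdeg_gen2 _ _) (gdegN (gdeg_2form _ _ _ _))).
Qed.
Lemma ham2_deg b k a : gdeg k a -> gdeg k (ham2 b a).
Proof. by move=> da; have := ham2_degB b da; rewrite /gdegB leq_addr addKn. Qed.

Lemma ham_of_deg k l a a' : gdeg k a -> gdeg l a' -> gdegB 2 (k + l) (ham_of (odd k) a a').
Proof.
move=> da da'; have ha := gdeg_hom da.
apply: (sder_deg (sder_ham_of ha)) da' => [f|u|b]; rewrite ham_ofE //; apply: gdegBN.
- rewrite -[k]add0n; apply: (sder_deg (sder_ham0 f)) da => [g|u|b]; rewrite hamE.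
  + exact: gdegB0.
  + exact: gdegB0.
  + by apply: gdegBN; exact: gdeg_scal.
- apply: gdegB_sgn; rewrite -[k.+1]add1n.
  apply: (sder_deg (sder_ham1 u)) da => [g|u'|b]; rewrite hamE.
  + exact: gdegB0.
  + exact: gdeg_scal.
  + by apply: gdegBN; exact: gdeg_gen1.
- by rewrite -[k.+2]add2n; exact: ham2_degB.
Qed.

Lemma self_dual_bracket_exists : exists br,
  is_self_dual_bracket pair rhoB brB dB nabW wB br.
Proof.
exists self_dual_bracket; split=> [|f g|f u|u u'|b f|b u|N' q' t' qt' b c].
- split=> [a a' c|a a' c|r a c|r a c|k l l' a a' e da da'|k l a a' e da da'|k l a a' da da'|k l a a' c da da'].
  + have [ee eo] : even_part (a + a') = even_part a + even_part a' /\
                   odd_part (a + a') = odd_part a + odd_part a'.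
      by rewrite /even_part /odd_part !gparD -!mulrDr; split; congr (_ * _); zmodule.
    rewrite /self_dual_bracket ee eo !ham_ofD; try exact: ghom_even_part; try exact: ghom_odd_part.
    by zmodule.
  + rewrite /self_dual_bracket (sderD (sder_ham_of (ghom_even_part _))).
    by rewrite (sderD (sder_ham_of (ghom_odd_part _))); zmodule.
  + have [ee eo] : even_part (gs (cstf M r) * a) = gs (cstf M r) * even_part a /\
                   odd_part (gs (cstf M r) * a) = gs (cstf M r) * odd_part a.
      rewrite /even_part /odd_part !gparM gpar_scal -mulrDr -mulrBr.
      by split; rewrite !mulrA -!gscalM mulrC.
    rewrite /self_dual_bracket ee eo (ham_of_cst _ _ (ghom_even_part a)).
    by rewrite (ham_of_cst _ _ (ghom_odd_part a)) mulrDr.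
  + rewrite /self_dual_bracket mulrDr.
    have c0 p (z : G) : ghom p z -> ham_of p z (gs (cstf M r)) = 0.
      move=> hx; rewrite ham_of0 // (sder_eq0 (sder_ham0 _)) ?oppr0 // => [f|u|b].
      * exact: ham00.
      * exact: ham01.
      * by rewrite ham02 (anchor_cst rhoBP) gscal0 oppr0.
    rewrite (sder_scal _ (sder_ham_of (ghom_even_part _))) ?c0 //; try exact: ghom_even_part.
    by rewrite (sder_scal _ (sder_ham_of (ghom_odd_part _))) ?c0 //; exact: ghom_odd_part.
  + rewrite (self_dual_bracketE _ da).
    by have := ham_of_deg da da'; rewrite /gdegB e leq_addl addnK.
  + rewrite (self_dual_bracketE _ da).
    by have := ham_of_deg da da'; rewrite /gdegB leqNgt e.
  + by rewrite (self_dual_bracketE _ da) (self_dual_bracketE _ da') gsgnE oddM (ham_of_skew da da').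
  + rewrite !(self_dual_bracketE _ da) gsgnE oddM (sderM (sder_ham_of (gdeg_hom da))).
    by rewrite (gtw_deg _ da') gsgnM.
- by rewrite (self_dual_bracketE _ (gdeg_scal _ _ _)) ham_of_scal hamE.
- by rewrite (self_dual_bracketE _ (gdeg_scal _ _ _)) ham_of_scal hamE.
- by rewrite (self_dual_bracketE _ (gdeg_gen1 _ _)) ham_of_gen1 hamE.
- by rewrite (self_dual_bracketE _ (gdeg_gen2 _ _)) ham_of_gen2 hamE.
- by rewrite (self_dual_bracketE _ (gdeg_gen2 _ _)) ham_of_gen2 hamE.
- rewrite (self_dual_bracketE _ (gdeg_gen2 _ _)) ham_of_gen2 hamE /curv.
  by rewrite (form2_indep pairP qt qt' bP) //; exact: curv_2form.
Qed.

Lemma ham0_2form f (w : V -> V -> K) : ham0 f (fun_of_2form U q t w) = 0.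
Proof. exact: (sder_2form _ _ _ (sder_ham0 f) (ham00 f) (ham01 f)). Qed.

(** On functions and generators of degree 1, {u, .} and the contraction by [dB u] agree; a 2-form
    involves no other generators. *)
Lemma ham1_2form u (w : V -> V -> K) :
  ham1 u (fun_of_2form U q t w) = iV (dB u) (fun_of_2form U q t w).
Proof.
apply/eqP; rewrite -subr_eq0; apply/eqP.
apply: (sder_2form _ _ _ (sder_add (sder_ham1 u) (sder_opp (sder_iV U pairP (dB u))))) => [f|u'].
  by rewrite ham10 (iV_scal U pairP) subr0.
by rewrite ham11 (iV_gen1 U pairP) subrr.
Qed.

Lemma iV_curv x b c : iV x (curv b c) = g1 (wB b c x).
Proof. exact: (iV_2form _ pairP qt (curv_2form b c)). Qed.

Lemma lieB_subproof b xi f c c' :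
  rhoB b (xi (f *: c + c')) - xi (brB b (f *: c + c')) =
  f * (rhoB b (xi c) - xi (brB b c)) + (rhoB b (xi c') - xi (brB b c')).
Proof.
by rewrite brB_linear !(dual_add, dual_scale) !(anchorE rhoBP); ring.
Qed.
Definition lieB b xi : dual U := MkDual (lieB_subproof b xi).

Lemma wB_linear b x : is_linear (fun c => wB b c x).
Proof.
move=> f c c'; rewrite !(h2_skew wBP b) (h2_form wBP) scalerN.
by zmodule.
Qed.

(** The counterpart of [iV_lieV]: the [iW] term records the curvature form contained in {b, c}. *)
Lemma iV_ham2 x b a : iV x (ham2 b a) =
  ham2 b (iV x a) - iV (nabV b x) a - iW (fun c => wB b c x) a.
Proof.
have sV z := sder_iV U pairP z; have sW := sder_iW (wB_linear b x).
pose D a := scomm true false (iV x) (ham2 b) a + (iV (nabV b x) a + iW (fun c => wB b c x) a).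
suff : D a = 0 by rewrite /D /scomm /= => /eqP; rewrite addr_eq0 subr_eq => /eqP->; zmodule.
have DD : sder true D := sder_add (sder_comm (sV x) (sder_ham2 b)) (sder_add (sV _) sW).
apply: (sder_eq0 DD) => [f|u|c]; rewrite /D /scomm /=.
- by rewrite ham20 !(iV_scal U pairP) (iW_scal _ (wB_linear b x)) (sder0 (sder_ham2 b)); zmodule.
- rewrite ham21 !(iV_gen1 U pairP) (iW_gen1 _ (wB_linear b x)) ham20 nab_dual gscalD.
  by zmodule.
- rewrite ham22 (sderD (sV x)) (sderN _ (sV x)) iV_curv !(iV_gen2 pairP).
  by rewrite (iW_gen2 _ (wB_linear b x)) (sder0 (sder_ham2 b)); zmodule.
Qed.

Lemma iU_ham2 xi b a : iU xi (ham2 b a) = ham2 b (iU xi a) - iU (lieB b xi) a.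
Proof.
have sU xi' := sder_iU W xi'.
pose D a := scomm false false (iU xi) (ham2 b) a + iU (lieB b xi) a.
suff : D a = 0 by rewrite /D /scomm /= => /eqP; rewrite addr_eq0 subr_eq => /eqP->; zmodule.
have DD : sder false D := sder_add (sder_comm (sU xi) (sder_ham2 b)) (sU _).
apply: (sder_eq0 DD) => [f|u|c]; rewrite /D /scomm /=.
- by rewrite ham20 !iU_scal (sder0 (sder_ham2 b)); zmodule.
- by rewrite ham21 !iU_gen1 (sder0 (sder_ham2 b)); zmodule.
- rewrite ham22 (sderD (sU xi)) (sderN _ (sU xi)) iU_2form !iU_gen2 ham20 /=.
  by rewrite gscalD gscalN; zmodule.
Qed.

Lemma gdeg_curv b c : gdeg 2 (curv b c). Proof. exact: gdeg_2form. Qed.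

Section Bracket.
Variables (br : G -> G -> G) (brP : is_self_dual_bracket pair rhoB brB dB nabW wB br).

Let bd := sdb_bider brP.

Lemma br_degB k l a a' : gdeg k a -> gdeg l a' -> gdegB 2 (k + l) (br a a').
Proof.
move=> da da'; rewrite /gdegB; case: ifP => kl.
  by apply: (bd_deg bd _ da da'); rewrite subnK.
by apply: (bd_deg_neg bd _ da da'); rewrite ltnNge kl.
Qed.

Lemma br0l a : br 0 a = 0.
Proof. by apply: (addIr (br 0 a)); rewrite -(bd_addl bd) !add0r. Qed.
Lemma brNl a a' : br (- a) a' = - br a a'.
Proof. by apply: (addIr (br a a')); rewrite -(bd_addl bd) !addNr br0l. Qed.
Lemma br_sgn p a a' : br (gsgn p a) a' = gsgn p (br a a').
Proof. by case: p => //=; exact: brNl. Qed.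

Lemma sder_br k a : gdeg k a -> sder (odd k) (br a).
Proof.
move=> da; have br0r : br a 0 = 0.
  by apply: (addIr (br a 0)); rewrite -(bd_addr bd) !add0r.
split=> [|x y|x]; first exact: bd_addr.
  apply: (gdeg_span (P := fun x : G => br a (x * y) = br a x * y + gtw (odd k) x * br a y)) x
    => [l x dx|x x' e e'].
    by rewrite (bd_leibniz bd _ da dx) gsgnE oddM (gtw_deg _ dx) gsgnM.
  by rewrite mulrDl !(bd_addr bd) e e' gtwD !mulrDl; zmodule.
apply: (gdeg_span (P := fun x : G => br a (gpar x) = gsgn (odd k) (gpar (br a x)))) x
  => [l x dx|x x' e e'].
  have [par_br _] := gdegB_hom (br_degB da dx).
  rewrite par_br (gdeg_par dx) addbF oddD.
  have brN (x' : G) : br a (- x') = - br a x'.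
    by apply: (addIr (br a x')); rewrite -(bd_addr bd) !addNr br0r.
  by case: (odd k); case: (odd l); rewrite /= ?opprK ?brN.
by rewrite gparD !(bd_addr bd) gparD gsgnD e e'.
Qed.

Lemma sder_brB k a : gdegB 2 k a -> sder (odd k) (br a).
Proof.
rewrite /gdegB; case: ifP => k2 da.
  by have := sder_br da; rewrite oddB // addbF.
have := sder_zero W U (odd k); congr sder; apply: funext => a'.
by rewrite da br0l.
Qed.

Lemma br_skewB k l a a' : gdegB 2 k a -> gdeg l a' ->
  br a a' = - gsgn (odd k && odd l) (br a' a).
Proof.
rewrite /gdegB; case: ifP => k2 da da'.
  by rewrite (bd_skew bd da da') gsgnE oddM oddB // addbF.
by rewrite da br0l (sder0 (sder_br da')) gsgn0 oppr0.
Qed.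

Lemma br_skew k l a a' : gdeg k a -> gdeg l a' ->
  br a a' = - gsgn (odd k && odd l) (br a' a).
Proof. by move=> da da'; rewrite (bd_skew bd da da') gsgnE oddM. Qed.

Lemma br_scal f a : br (gs f) a = ham0 f a.
Proof.
apply: (sder_ext (sder_br (gdeg_scal _ _ f)) (sder_ham0 f)) a => [g|u|b]; rewrite hamE.
- exact: sdb_00 brP _ _.
- exact: sdb_01 brP _ _.
- by rewrite (br_skew (gdeg_scal _ _ f) (gdeg_gen2 _ b)) /= (sdb_20 brP).
Qed.

Lemma br_gen1 u a : br (g1 u) a = ham1 u a.
Proof.
apply: (sder_ext (sder_br (gdeg_gen1 _ u)) (sder_ham1 u)) a => [g|u'|b]; rewrite hamE.
- by rewrite (br_skew (gdeg_gen1 _ u) (gdeg_scal _ _ g)) /= (sdb_01 brP) oppr0.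
- exact: sdb_11 brP _ _.
- by rewrite (br_skew (gdeg_gen1 _ u) (gdeg_gen2 _ b)) /= (sdb_21 brP).
Qed.

Lemma br_gen2 b a : br (g2 b) a = ham2 b a.
Proof.
apply: (sder_ext (sder_br (gdeg_gen2 _ b)) (sder_ham2 b)) a => [g|u|c]; rewrite hamE.
- exact: sdb_20 brP _ _.
- exact: sdb_21 brP _ _.
- by rewrite (sdb_22 brP qt).
Qed.
Let brE := (br_scal, br_gen1, br_gen2).

Definition jacobiator p p' a a' (z : G) : G :=
  br a (br a' z) - gsgn (p && p') (br a' (br a z)) - br (br a a') z.

Lemma sder_jacobiator k l a a' : gdeg k a -> gdeg l a' ->
  sder (odd k (+) odd l) (jacobiator (odd k) (odd l) a a').
Proof.
move=> da da'; rewrite /jacobiator.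
apply: (sder_add (sder_comm (sder_br da) (sder_br da'))); apply: sder_opp.
by rewrite -oddD; exact: (sder_brB (br_degB da da')).
Qed.

(** Skew-symmetry makes the Jacobiator cyclically invariant up to sign. Any argument can thus be
    moved to the last place, where the Jacobiator is a derivation. *)
Lemma jacobiator_cyc k l m' a a' a'' : gdeg k a -> gdeg l a' -> gdeg m' a'' ->
  jacobiator (odd k) (odd l) a a' a'' = 0 -> jacobiator (odd m') (odd k) a'' a a' = 0.
Proof.
move=> da da' da''; rewrite /jacobiator.
rewrite (br_skewB (br_degB da da') da'') (br_skewB (br_degB da'' da) da').
rewrite (br_skew da'' da) (br_skew da'' da').
have bN (x y : G) k' : gdeg k' x -> br x (- y) = - br x y by move=> /sder_br/sderN.
rewrite !oddD; move=> e.
(* The sign is that of moving a'' past a and a'; the zero under it is then replaced by the given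
   Jacobiator. *)
have -> : 0 = gsgn (odd m' && (odd k (+) odd l)) (0 : G) by rewrite gsgn0.
rewrite -e; move: e => _.
have s (x y : G) k' p : gdeg k' x -> br x (gsgn p y) = gsgn p (br x y).
  by move=> /sder_br/sder_sgn.
rewrite !(bN _ _ _ da) !(bN _ _ _ da') !(s _ _ _ _ da) !(s _ _ _ _ da').
by case: (odd k); case: (odd l); case: (odd m') => /=; zmodule.
Qed.

Lemma jacobiator_swap k l a a' (z : G) : gdeg k a -> gdeg l a' ->
  jacobiator (odd k) (odd l) a a' z = 0 -> jacobiator (odd l) (odd k) a' a z = 0.
Proof.
move=> da da' e.
have -> : 0 = - gsgn (odd k && odd l) (0 : G) by rewrite gsgn0 oppr0.
rewrite -e /jacobiator (br_skew da' da) brNl br_sgn.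
by case: (odd k); case: (odd l) => /=; zmodule.
Qed.

Inductive is_generator : nat -> G -> Prop :=
  | is_generator0 f : is_generator 0 (gs f)
  | is_generator1 u : is_generator 1 (g1 u)
  | is_generator2 b : is_generator 2 (g2 b).

Lemma is_generator_deg k a : is_generator k a -> gdeg k a.
Proof.
by case=> [f|u|b]; [exact: gdeg_scal|exact: gdeg_gen1|exact: gdeg_gen2].
Qed.

Lemma sder_generator p (D : G -> G) : sder p D ->
  (forall k a, is_generator k a -> D a = 0) -> forall a, D a = 0.
Proof.
move=> DP D0; apply: (sder_eq0 DP) => [f|u|b]; apply: D0.
- exact: is_generator0.
- exact: is_generator1.
- exact: is_generator2.
Qed.

Lemma jacobiator00 f g a : jacobiator false false (gs f) (gs g) a = 0.
Proof.
apply: (sder_eq0 (sder_jacobiator (gdeg_scal _ _ f) (gdeg_scal _ _ g))) a => [h|u|b];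
  by rewrite /jacobiator /= !brE !hamE ?(sderN _ (sder_ham0 _)) ?hamE br0l; zmodule.
Qed.

Lemma jacobiator10 u f a : jacobiator true false (g1 u) (gs f) a = 0.
Proof.
apply: (sder_eq0 (sder_jacobiator (gdeg_gen1 _ u) (gdeg_scal _ _ f))) a => [h|u'|b];
  rewrite /jacobiator /= !brE !hamE ?(sderN _ (sder_ham0 _)) ?(sderN _ (sder_ham1 _)) ?hamE br0l;
  rewrite ?(sder0 (sder_ham1 _)); zmodule.
Qed.

Lemma jacobiator11 u u' a : jacobiator true true (g1 u) (g1 u') a = 0.
Proof.
apply: (sder_eq0 (sder_jacobiator (gdeg_gen1 _ u) (gdeg_gen1 _ u'))) a => [h|v|b];
  rewrite /jacobiator /= !brE !hamE ?(sderN _ (sder_ham1 _)) ?hamE ?brE ?hamE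
    ?(sder0 (sder_ham1 _)); try zmodule.
rewrite nab_dual -(tr_chain SP.1) [pair (dB (nabW b u)) u']dB_sym gscalD; zmodule.
Qed.

Lemma jacobiator20 b f a : jacobiator false false (g2 b) (gs f) a = 0.
Proof.
apply: (sder_eq0 (sder_jacobiator (gdeg_gen2 _ b) (gdeg_scal _ _ f))) a => [h|v|c];
  rewrite /jacobiator /= !brE !hamE ?(sderN _ (sder_ham2 _)) ?hamE ?brE ?hamE
    ?(sder0 (sder_ham2 _)) ?(anchor0 rhoBP) ?gscal0; try zmodule.
rewrite (sderD (sder_ham0 f)) (sderN _ (sder_ham0 f)) ham0_2form hamE.
by rewrite (la_morph LB) gscalD gscalN; zmodule.
Qed.

Lemma jacobiator21 b u a : jacobiator false true (g2 b) (g1 u) a = 0.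
Proof.
apply: (sder_eq0 (sder_jacobiator (gdeg_gen2 _ b) (gdeg_gen1 _ u))) a => [h|v|c];
  rewrite /jacobiator /= !brE !hamE ?(sderN _ (sder_ham2 _)) ?hamE ?brE ?hamE
    ?(sder0 (sder_ham2 _)) ?(anchor0 rhoBP) ?gscal0; try zmodule.
  rewrite nab_dual (tr_chain SP.1) gscalD; zmodule.
rewrite (sderD (sder_ham1 u)) (sderN _ (sder_ham1 u)) ham1_2form iV_curv hamE.
rewrite -(tr_curv0 SP.1) /curvature !gen1D !gen1N; zmodule.
Qed.

(** On functions the anchor is a morphism; on degree 1 the curvature is R_B composed with [dB]; on
    degree 2 one has the Jacobi identity of B and the closedness of R_B. *)
Lemma jacobiator22 b c a : jacobiator false false (g2 b) (g2 c) a = 0.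
Proof.
(* Only brackets with a generator in first place are known explicitly, so a curvature form is moved
   to the second place; its even degree leaves just a minus sign. *)
have brF e e' k a' : gdeg k a' -> br (curv e e') a' = - br a' (curv e e').
  by move=> da'; rewrite (br_skew (gdeg_curv e e') da').
apply: (sder_eq0 (sder_jacobiator (gdeg_gen2 _ b) (gdeg_gen2 _ c))) a => [h|u|e];
  rewrite /jacobiator /= !brE !hamE (bd_addl bd) brNl !brE.
- rewrite (brF _ _ _ _ (gdeg_scal _ _ h)) br_scal ham0_2form !hamE.
  by rewrite (la_morph LB) gscalD gscalN; zmodule.
- rewrite (brF _ _ _ _ (gdeg_gen1 _ u)) br_gen1 ham1_2form iV_curv !hamE.
  rewrite -(tr_curv0 SP.1) /curvature !gen1D !gen1N; zmodule.
rewrite (brF _ _ _ _ (gdeg_gen2 _ e)) br_gen2 !(sderD (sder_ham2 _)) !(sderN _ (sder_ham2 _)) !hamE.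
have -> : g2 (brB b (brB c e)) = g2 (brB (brB b c) e) + g2 (brB c (brB b e)).
  by rewrite (la_jacobi LB) gen2D.
(* The generators of degree 2 have cancelled; what remains is the covariant differential of R_B, as
   a 2-form on Q. *)
suff : curv b (brB c e) + ham2 b (curv c e) - curv c (brB b e) - ham2 c (curv b e)
   - curv (brB b c) e + ham2 e (curv b c) = 0.
  move=> e0; rewrite -[RHS]oppr0 -e0; zmodule.
have dc := gdeg_curv; have dh := fun b' => @ham2_deg b' 2.
apply: (gdeg_eq0 pairP qt bP (k := 1)) => [|x|xi].
- by do !apply: gdegD => //; try apply: gdegN => //; apply: dh.
- have sV := sder_iV U pairP x.
  rewrite 5!(sderD sV) 3!(sderN _ sV) !iV_ham2 !iV_curv !ham21.
  rewrite !(iW_2form q t _ (wB_linear _ _)) !subr0.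
  rewrite -!(gen1D, gen1N) -[RHS](gen1_0 W U); congr (g1 _).
  have := tr_closed SP.1 b c e x; rewrite /koszul2 /nabla_hom.
  have funD (phi psi : V -> W) : (phi + psi) x = phi x + psi x by [].
  have funN (phi : V -> W) : (- phi) x = - phi x by [].
  rewrite !(funD, funN) (h2_skew wBP b (brB c e)) (h2_skew wBP c (brB b e)).
  by move=> e0; rewrite -[RHS]e0; zmodule.
- have sU := sder_iU W xi.
  rewrite 5!(sderD sU) 3!(sderN _ sU) !iU_ham2 !iU_2form !(sder0 (sder_ham2 _)).
  zmodule.
Qed.

Lemma jacobiator_generators k l a a' (z : G) : is_generator k a -> is_generator l a' ->
  jacobiator (odd k) (odd l) a a' z = 0.
Proof.
case=> [f|u|b] [g|v|c].
- exact: jacobiator00.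
- exact: (jacobiator_swap (gdeg_gen1 _ v) (gdeg_scal _ _ f) (jacobiator10 v f z)).
- exact: (jacobiator_swap (gdeg_gen2 _ c) (gdeg_scal _ _ f) (jacobiator20 c f z)).
- exact: jacobiator10.
- exact: jacobiator11.
- exact: (jacobiator_swap (gdeg_gen2 _ c) (gdeg_gen1 _ u) (jacobiator21 c u z)).
- exact: jacobiator20.
- exact: jacobiator21.
- exact: jacobiator22.
Qed.

(** Arguments are reduced to generators one at a time, each being rotated to the last place: two
    generators and any third, then one generator and any two, then any three. *)
Lemma jacobiator_eq0 k l a a' (z : G) : gdeg k a -> gdeg l a' ->
  jacobiator (odd k) (odd l) a a' z = 0.
Proof.
have J1 k' l' g a2 (z' : G) : is_generator k' g -> gdeg l' a2 ->
    jacobiator (odd k') (odd l') g a2 z' = 0.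
  move=> gg da2; have dg := is_generator_deg gg.
  apply: (sder_generator (sder_jacobiator dg da2)) z' => m' g' gg'.
  have dg' := is_generator_deg gg'.
  apply: (jacobiator_cyc da2 dg' dg); apply: (jacobiator_cyc dg' dg da2).
  exact: jacobiator_generators.
move=> da da'; apply: (sder_generator (sder_jacobiator da da')) z => m' g gg.
have dg := is_generator_deg gg.
apply: (jacobiator_cyc da' dg da); apply: (jacobiator_cyc dg da da'); exact: J1.
Qed.

Lemma self_dual_bracket_poisson : is_graded_poisson br.
Proof.
split=> // k l x y z dx dy.
have := jacobiator_eq0 z dx dy; rewrite /jacobiator gsgnE oddM => e.
by apply/eqP; rewrite -subr_eq0 -e; apply/eqP; zmodule.
Qed.

End Bracket.
End SelfDual.

(** * Compatibility of the vector field with the bracket *)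

Section Compatibility.
Variables (R : realType) (n : nat) (M : smoothManifold R n).
Local Notation K := (Cinf M).
Variables (V W U : lmodType K) (pair : V -> W -> K) (pairP : is_pairing pair).
Local Notation G := (gfun W U).
Local Notation gs := (gscal W U).
Local Notation g1 := (gen1 U).
Local Notation g2 := (gen2 W).
Local Notation iV := (@iV R n M V W U pair).
Variables (rho : V -> K -> K) (d : W -> U) (Delta : V -> W -> W)
  (nab : V -> U -> U) (w : V -> V -> U -> W)
  (rs : K -> W) (brV : V -> V -> V) (ds : dual U -> V).
Variables (rhoB : U -> K -> K) (brB : U -> U -> U) (dB : W -> V)
  (nabW : U -> W -> W) (nabV : U -> V -> V) (wB : U -> U -> V -> W).

(* The compatibility of the homological vector field with the bracket, evaluated on the
   pairs of generators (f, u), (b, f), (u, u'), (b, u), (b, u), (b, c), (b, c) and contracted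
   with sections of Q and B' until only functions are left. *)
Record poisson_compatible : Prop := {
  pc_01 : forall f u, pair (dB (rs f)) u = rhoB (d u) f;
  pc_20 : forall x b f, rho x (rhoB b f) - rhoB b (rho x f) =
    rhoB (nab x b) f - rho (nabV b x) f;
  pc_11 : forall u u', Delta (dB u') u + Delta (dB u) u' =
    rs (pair (dB u) u') + nabW (d u) u' + nabW (d u') u;
  pc_21U : forall b u, d (nabW b u) - nab (dB u) b = brB b (d u);
  pc_21V : forall x y b u,
    pair x (Delta y (nabW b u)) - rho x (pair y (nabW b u))
    + pair y (nabW (nab x b) u) - pair x (nabW (nab y b) u)
    - pair x (w y (dB u) b) - pair x (nabW b (Delta y u))
    + (rhoB b (rho x (pair y u)) - rho (nabV b x) (pair y u))
    + pair x (Delta (nabV b y) u) - rho x (pair (nabV b y) u) + pair x (wB b (d u) y) = 0;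
  pc_22U : forall x b c, d (wB b c x) = - nab x (brB b c) + nab (nabV c x) b
    - brB c (nab x b) - nab (nabV b x) c + brB b (nab x c);
  pc_22V : forall x y z b c,
    let S b c := - rhoB c (pair z (w x y b)) + pair (nabV c z) (w x y b)
      + pair z (w x (nabV c y) b) + pair z (w (nabV c x) y b) - pair z (wB c (nab x b) y)
      + pair z (wB c (nab y b) x) - pair y (wB c (nab z b) x) in
    - pair z (w x y (brB b c)) - rho x (pair z (wB b c y)) + pair (brV x z) (wB b c y)
    + pair z (wB b c (brV x y)) + rho y (pair z (wB b c x)) - pair (brV y z) (wB b c x)
    - rho z (pair y (wB b c x)) + S b c - S c b = 0 }.

Variables (N : nat) (q : 'I_N -> V) (t : 'I_N -> W) (qt : dual_frames pair q t).
Variables (m : nat) (beta : 'I_m -> dual U) (bb : 'I_m -> U) (bP : is_frame beta bb).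
Hypothesis DP : dorfman_axioms pair rho d Delta nab w rs brV ds.
Hypothesis drs : forall f, d (rs f) = 0.
Hypothesis LB : is_lie_algebroid rhoB brB.
Hypothesis SP : is_self_dual_2rep pair rhoB brB dB nabW nabV wB.
Hypothesis CP : poisson_compatible.
Variables (Q : G -> G) (QP : is_homological_vf pair rho d Delta nab w Q).
Variables (br : G -> G -> G) (brP : is_self_dual_bracket pair rhoB brB dB nabW wB br).
Implicit Types (x y z v : V) (u : W) (b c : U) (f : K) (xi : dual U) (a : G).

Let sQ : sder true Q := is_derivation1_sder (hvf_der QP).
Let sV x : sder true (iV x) := sder_iV U pairP x.
Let sU xi : sder false (iU xi) := sder_iU W xi.
Let Qdeg k a : gdeg k a -> gdeg k.+1 (Q a) := d1_deg (hvf_der QP) (x := a).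
Let nab_dual b x u : rhoB b (pair x u) = pair (nabV b x) u + pair x (nabW b u).
Proof. by have [_ []] := SP. Qed.
Let nWP : is_connection rhoB nabW := tr_conn0 SP.1.

Local Notation ham0 := (@ham0 R n M W U rhoB).
Local Notation ham1 := (@ham1 R n M V W U pair dB nabW).
Local Notation ham2 := (@ham2 R n M V W U pair N q t rhoB brB nabW wB).
Local Notation curv := (@curv R n M V W U pair N q t wB).
Let s0 f : sder false (ham0 f) := sder_ham0 W LB f.
Let s1 u : sder true (ham1 u) := sder_ham1 pairP SP u.
Let s2 b : sder false (ham2 b) := sder_ham2 pairP q t LB SP b.
Let hamE := (ham00 W LB, ham01 (W := W) LB, ham02 W LB, ham10 pairP SP, ham11 pairP SP, ham12 pairP SP,
  ham20 pairP q t LB SP, ham21 pairP q t LB SP, ham22 pairP q t LB SP).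
Let brE := (br_scal LB brP, br_gen1 pairP SP brP, br_gen2 pairP qt LB SP brP).

(* The failure of Q to be a derivation of the bracket. It is a derivation in each argument and
   graded skew-symmetric, hence vanishes once it does on generators. *)
Definition defect p a a' : G := Q (br a a') - gsgn p (br a (Q a')) - br (Q a) a'.

Lemma sder_defect k a : gdeg k a -> sder (~~ odd k) (defect (odd k) a).
Proof.
move=> da; apply: (sder_add (sder_comm sQ (sder_br brP da))); apply: sder_opp.
exact: (sder_br brP (Qdeg da)).
Qed.

Lemma defect_swap k l a a' : gdeg k a -> gdeg l a' ->
  defect (odd k) a a' = 0 -> defect (odd l) a' a = 0.
Proof.
move=> da da' e; have -> : 0 = - gsgn (odd k && odd l) (0 : G) by rewrite gsgn0 oppr0.
rewrite -e /defect (br_skew brP da' da) (br_skew brP (Qdeg da') da).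
rewrite (br_skew brP da' (Qdeg da)) /= (sderN _ sQ) (sder_sgn _ _ sQ).
by case: (odd k); case: (odd l) => /=; zmodule.
Qed.

(** The vector field has degree 1 and the bracket degree -2. When k + l = 1 the bracket of a and a'
    vanishes, so the truncated degree of that term does no harm. *)
Lemma defect_deg k l a a' : gdeg k a -> gdeg l a' -> (1 <= k + l)%N ->
  gdeg (k + l).-1 (defect (odd k) a a').
Proof.
move=> da da' kl; rewrite /defect; apply: gdegD; first apply: gdegD.
- have := br_degB brP da da'; rewrite /gdegB; case: ifP => [kl2|_ ->]; last first.
    by rewrite (sder0 sQ); exact: gdeg0.
  by move=> /Qdeg; rewrite -subSn // subSS subn1.
- apply: gdegN; apply: gdeg_sgn; have := br_degB brP da (Qdeg da').
  by rewrite /gdegB addnS ltnS kl subSS subn1.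
- apply: gdegN; have := br_degB brP (Qdeg da) da'.
  by rewrite /gdegB addSn ltnS kl subSS subn1.
Qed.

Lemma ham0_hvf1 f u : ham0 f (Q (g1 u)) = - gs (rhoB (d u) f).
Proof. by rewrite (hvf_gen1 QP qt) (sderD (s0 f)) (ham0_2form q t LB) hamE add0r. Qed.

Lemma iV_ham0 x f a : iV x (ham0 f a) = ham0 f (iV x a).
Proof.
apply/eqP; rewrite -subr_eq0; apply/eqP.
apply: (sder_eq0 (sder_comm (sV x) (s0 f))) a => [g|u|b]; rewrite /scomm /= !hamE.
- by rewrite (iV_scal U pairP) (sder0 (s0 f)) (sder0 (sV x)) subr0.
- by rewrite (iV_gen1 U pairP) hamE (sder0 (sV x)) subr0.
- by rewrite (sderN _ (sV x)) (iV_scal U pairP) (iV_gen2 pairP) (sder0 (s0 f)); zmodule.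
Qed.

Lemma nabW_linear y u : is_linear (nabW^~ u).
Proof. by move=> f b c; rewrite (conn_linear nWP). Qed.

Lemma iV_ham1 x u a : iV x (ham1 u a) =
  - iU (pair_dual pairP x (nabW_linear x u)) a - ham1 u (iV x a).
Proof.
pose D a := scomm true true (iV x) (ham1 u) a + iU (pair_dual pairP x (nabW_linear x u)) a.
suff : D a = 0 by rewrite /D /scomm /= => /eqP; rewrite addr_eq0 subr_eq => /eqP->; zmodule.
have DD : sder false D := sder_add (sder_comm (sV x) (s1 u)) (sU _).
apply: (sder_eq0 DD) => [f|u'|b]; rewrite /D /scomm /= !hamE.
- by rewrite (iV_scal U pairP) iU_scal (sder0 (sV x)) (sder0 (s1 u)); zmodule.
- by rewrite (iV_gen1 U pairP) hamE (iV_scal U pairP) iU_gen1; zmodule.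
- rewrite (sderN _ (sV x)) (iV_gen1 U pairP) (iV_gen2 pairP) iU_gen2 (sder0 (s1 u)) /=.
  by zmodule.
Qed.

Lemma iU_ham1 xi u a : iU xi (ham1 u a) = ham1 u (iU xi a).
Proof.
apply/eqP; rewrite -subr_eq0; apply/eqP.
apply: (sder_eq0 (sder_comm (sU xi) (s1 u))) a => [g|u'|b]; rewrite /scomm /= !hamE.
- by rewrite iU_scal (sder0 (s1 u)) (sder0 (sU xi)) subr0.
- by rewrite iU_scal iU_gen1 (sder0 (s1 u)) subr0.
- by rewrite (sderN _ (sU xi)) iU_gen1 iU_gen2 hamE; zmodule.
Qed.

Lemma ham1_hvf1 u u' : ham1 u' (Q (g1 u)) =
  g1 (Delta (dB u') u - rs (pair (dB u') u)) - g1 (nabW (d u) u').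
Proof.
have := iV_hvf1 pairP qt DP QP (dB u') u.
rewrite (hvf_gen1 QP qt) (sderD (sV _)) (sderD (s1 _)) (iV_gen2 pairP) addr0 => <-.
by rewrite (ham1_2form pairP q t SP) hamE.
Qed.

Lemma ham1_iV_hvf2 u x b : ham1 u (iV x (Q (g2 b))) =
  - g1 (nabW (nab x b) u) - g1 (w x (dB u) b).
Proof.
rewrite (iV_hvf2 pairP qt DP QP) (sderD (s1 _)) (sderN _ (s1 _)) hamE; congr (_ + _).
rewrite (ham1_2form pairP q t SP).
by rewrite (iV_2form U pairP qt (form3_2form x (omega_3form pairP DP b)) (u := w x (dB u) b)).
Qed.

Lemma ham0_iV_hvf2 f x b : ham0 f (iV x (Q (g2 b))) = - gs (rhoB (nab x b) f).
Proof.
rewrite (iV_hvf2 pairP qt DP QP) (sderD (s0 _)) (sderN _ (s0 _)) hamE.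
by rewrite (ham0_2form q t LB) oppr0 addr0.
Qed.

(** On functions and generators of degree 1, [lieU xi] is the contraction by [ds xi], hence also on
    2-forms. *)
Lemma lieU_curv xi b c : lieU Q xi (curv b c) = g1 (wB b c (ds xi)).
Proof.
rewrite -(iV_curv pairP qt SP (ds xi)); apply/eqP; rewrite -subr_eq0; apply/eqP.
apply: (sder_2form _ _ _ (sder_add (sder_lieU QP xi) (sder_opp (sV (ds xi))))) => [f|u].
  by rewrite (lieU_scal qt DP QP) (iV_scal U pairP) subr0.
by rewrite (lieU_gen1 qt QP) (iV_gen1 U pairP) (dr_ds DP) subrr.
Qed.

Lemma defect00 f g : defect false (gs f) (gs g) = 0.
Proof.
rewrite /defect /= !(hvf_scal qt DP QP) !brE !hamE (sder0 sQ); zmodule.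
Qed.

Lemma defect01 f u : defect false (gs f) (g1 u) = 0.
Proof.
rewrite /defect /= (hvf_scal qt DP QP) !brE !hamE (sder0 sQ) ham0_hvf1 (pc_01 CP).
zmodule.
Qed.

Lemma defect20 b f : defect false (g2 b) (gs f) = 0.
Proof.
have dd := defect_deg (gdeg_gen2 _ b) (gdeg_scal _ _ f) isT.
apply: (gdeg1_eq0 pairP qt bP dd) => x.
rewrite /defect (br_skew brP (Qdeg (gdeg_gen2 _ b)) (gdeg_scal _ _ f)) /= !brE !hamE.
rewrite !(hvf_scal qt DP QP) hamE opprK (sderD (sV x)) (sderD (sV x)) (sderN _ (sV x)).
rewrite iV_ham0 ham0_iV_hvf2 !(iV_gen1 U pairP) (dr_rs DP) -!(gscalN, gscalD).
rewrite -[RHS](gscal0 W U); congr (gs _).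
have := nab_dual b x (rs f); rewrite !(dr_rs DP) => e.
have := pc_20 CP x b f; rewrite e => e'.
by rewrite -[RHS](subrr (rhoB (nab x b) f - rho (nabV b x) f)) -{1}e'; ring.
Qed.

Lemma defect11 u u' : defect true (g1 u) (g1 u') = 0.
Proof.
rewrite /defect (br_skew brP (Qdeg (gdeg_gen1 _ u)) (gdeg_gen1 _ u')) /= !brE !hamE.
rewrite (hvf_scal qt DP QP) !ham1_hvf1 -!(gen1N, gen1D) -[RHS](gen1_0 W U).
congr (g1 _); have e := pc_11 CP u u'; rewrite -[RHS](subrr (Delta (dB u') u + Delta (dB u) u')).
have sym : pair (dB u') u = pair (dB u) u' by have [_ []] := SP.
by rewrite {2}e sym; zmodule.
Qed.

Lemma defect21 b u : defect false (g2 b) (g1 u) = 0.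
Proof.
have dd := defect_deg (gdeg_gen2 _ b) (gdeg_gen1 _ u) isT.
move: dd; rewrite /defect (br_skew brP (Qdeg (gdeg_gen2 _ b)) (gdeg_gen1 _ u)) /= !brE !hamE opprK.
move=> dd; apply: (gdeg_eq0 pairP qt bP dd) => [x|xi].
  rewrite 2!(sderD (sV x)) 2!(sderN _ (sV x)) (iV_hvf1 pairP qt DP QP) iV_ham1.
  rewrite (iU_hvf2 pairP qt DP QP) ham1_iV_hvf2 (iV_ham2 pairP qt LB SP).
  rewrite !(iV_hvf1 pairP qt DP QP) hamE.
  have -> : iW (fun c => wB b c x) (Q (g1 u)) = g1 (wB b (d u) x).
    have sW := sder_iW (wB_linear SP b x).
    rewrite (hvf_gen1 QP qt) (sderD sW) (iW_2form _ _ _ (wB_linear SP b x)).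
    by rewrite (iW_gen2 _ (wB_linear SP b x)) add0r.
  rewrite -!(gen1N, gen1D) -[RHS](gen1_0 W U); congr (g1 _).
  apply: (pair_inj qt) => y.
  (* Duality eliminates [nabW] under the pairing in favour of [nabV] and the anchor, on both sides,
     so that [ring] meets the same atoms. *)
  have nd c z u' : pair z (nabW c u') = rhoB c (pair z u') - pair (nabV c z) u'.
    by rewrite nab_dual; ring.
  have := pc_21V CP y x b u; rewrite !(pairEr pairP) (pair_nab_rep pairP qt DP) /=.
  rewrite !nd !(pairEr pairP) !(dr_rs DP) !(anchorE (la_anchor LB)) => e.
  by rewrite -[RHS]e; ring.
rewrite 2!(sderD (sU xi)) 2!(sderN _ (sU xi)) (iU_hvf1 qt QP) iU_ham1.
rewrite (iU_hvf2 pairP qt DP QP) hamE (iU_ham2 pairP q t LB SP) !(iU_hvf1 qt QP) hamE.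
rewrite (pair_nab_rep pairP qt DP) /= -(pc_21U CP) -!(gscalN, gscalD) -[RHS](gscal0 W U).
congr (gs _); rewrite dual_add -scaleN1r dual_scale; ring.
Qed.

Lemma iVV_ham2_hvf2 x y b c : iV y (iV x (ham2 c (Q (g2 b)))) =
  - g1 (nabW c (w x y b)) + g1 (w x (nabV c y) b) - g1 (wB c (nab x b) y)
  + g1 (w (nabV c x) y b) - g1 (nab_rep q t nab (pair_dual pairP y (wB_linear SP c x)) b)
  + g1 (wB c (nab y b) x).
Proof.
rewrite (iV_ham2 pairP qt LB SP) 2!(sderD (sV y)) 2!(sderN _ (sV y)).
rewrite (iV_ham2 pairP qt LB SP) !(iVV_hvf2 pairP qt DP QP) (sderN _ (s2 c)) hamE.
rewrite (iV_iW pairP (wB_linear SP c x)) !(iWV_hvf2 pairP qt DP QP); try exact: (wB_linear SP).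
rewrite (iU_hvf2 pairP qt DP QP).
by zmodule.
Qed.

Lemma iVV_hvf_curv x y b c : iV y (iV x (Q (curv b c))) =
  g1 (Delta x (wB b c y)) - g1 (wB b c (brV x y))
  - g1 (Delta y (wB b c x) - rs (pair y (wB b c x))).
Proof.
have wP : is_linear (w x y) := h2_linear (dr_2form DP) x y.
rewrite (lieVE pair Q x) (sderD (sV y)) (sderN _ (sV y)) (iV_curv pairP qt SP).
rewrite (iV_hvf1 pairP qt DP QP) (iV_lieV pairP qt DP QP) !(iV_curv pairP qt SP).
by rewrite (iW_2form q t _ wP) (lieV_gen1 pairP qt DP QP) subr0.
Qed.

Lemma iU_ham2_hvf2 xi b c : iU xi (ham2 c (Q (g2 b))) =
  g1 (nabW c (nab_rep q t nab xi b)) - g1 (nab_rep q t nab (lieB LB c xi) b).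
Proof.
by rewrite (iU_ham2 pairP q t LB SP) !(iU_hvf2 pairP qt DP QP) hamE.
Qed.

Lemma iU_hvf_curv xi b c : iU xi (Q (curv b c)) = g1 (wB b c (ds xi)).
Proof. by rewrite lieUE lieU_curv iU_2form (sder0 sQ) addr0. Qed.

(** The defect has degree 3, so a first contraction with Q may be imposed; the resulting element of
    degree 2 is tested by Q, giving [pc_22V], and by B', giving [pc_22U]. *)
Lemma defect22 b c : defect false (g2 b) (g2 c) = 0.
Proof.
have wBs e e' x y : pair x (wB e e' y) = - pair y (wB e e' x) by have [_ []] := SP.
have nd e z u' : pair z (nabW e u') = rhoB e (pair z u') - pair (nabV e z) u'.
  by rewrite nab_dual; ring.
have dd := defect_deg (gdeg_gen2 _ b) (gdeg_gen2 _ c) isT.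
move: dd; rewrite /defect (br_skew brP (Qdeg (gdeg_gen2 _ b)) (gdeg_gen2 _ c)) /= !brE !hamE opprK.
rewrite (sderD sQ) (sderN _ sQ).
move=> dd; apply: (gdeg3_eq0 pairP qt bP dd) => x.
apply: (gdeg_eq0 pairP qt bP (iV_deg pairP x dd)) => [y|xi].
  rewrite 3!(sderD (sV x)) 2!(sderN _ (sV x)) 3!(sderD (sV y)) 2!(sderN _ (sV y)).
  rewrite (iVV_hvf2 pairP qt DP QP) iVV_hvf_curv !iVV_ham2_hvf2.
  rewrite -!(gen1N, gen1D) -[RHS](gen1_0 W U); congr (g1 _).
  apply: (pair_inj qt) => z; have := pc_22V CP x y z b c.
  rewrite !(pairEr pairP) !(pair_nab_rep pairP qt DP) /= !nd !(pair_Delta DP) (dr_rs DP).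
  by move=> e; rewrite -[RHS]e; ring.
rewrite (iU_iV pairP) 3!(sderD (sU xi)) 2!(sderN _ (sU xi)).
rewrite (iU_hvf2 pairP qt DP QP) iU_hvf_curv !iU_ham2_hvf2.
rewrite -!(gen1N, gen1D) (iV_gen1 U pairP) -[RHS](gscal0 W U); congr (gs _).
rewrite !(pairEr pairP) !nd !(pair_nab_rep pairP qt DP) wBs (dr_ds DP) /= (pc_22U CP).
by rewrite -!scaleN1r !(dual_add, dual_scale); ring.
Qed.

Lemma defect_generators k l a a' : is_generator k a -> is_generator l a' ->
  defect (odd k) a a' = 0.
Proof.
case=> [f|u|b] [g|v|c].
- exact: defect00.
- exact: defect01.
- exact: (defect_swap (gdeg_gen2 _ c) (gdeg_scal _ _ f) (defect20 c f)).
- exact: (defect_swap (gdeg_scal _ _ g) (gdeg_gen1 _ u) (defect01 g u)).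
- exact: defect11.
- exact: (defect_swap (gdeg_gen2 _ c) (gdeg_gen1 _ u) (defect21 c u)).
- exact: defect20.
- exact: defect21.
- exact: defect22.
Qed.

(** The second argument is reduced to a generator, the arguments are swapped, and then the other one
    is reduced. *)
Lemma defect_eq0 k a a' : gdeg k a -> defect (odd k) a a' = 0.
Proof.
move=> da; apply: (sder_generator (sder_defect da)) a' => l g gg.
have dg := is_generator_deg gg; apply: (defect_swap dg da).
apply: (sder_generator (sder_defect dg)) => k' g' gg'; exact: (defect_generators gg gg').
Qed.

Lemma split_poisson_lie2 : is_split_poisson_lie2 Q br.
Proof.
split.
- exact: (hvf_split_lie2 pairP qt bP DP drs QP).
- exact: (self_dual_bracket_poisson pairP qt bP LB SP brP).
- move=> k x y dx; have := defect_eq0 y dx; rewrite /defect gsgnE => e.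
  by apply/eqP; rewrite -subr_eq0 -e; apply/eqP; zmodule.
Qed.

End Compatibility.

(** * The structures attached to a pair of 2-representations *)

Section SectionFrames.
Variables (R : realType) (n : nat) (M : smoothManifold R n).
Local Notation K := (Cinf M).

Lemma sec_sumE (E : vectorBundle M) N (s : 'I_N -> Sec E) x :
  (\sum_i s i : Sec E) x = \sum_i s i x.
Proof. by apply: (big_morph (fun s : Sec E => s x)). Qed.

Lemma sec_frame (E : vectorBundle M) : exists N (eps : 'I_N -> dual (Sec E)) (e : 'I_N -> Sec E),
  is_frame eps e.
Proof.
have [N [e [eps [smooth_e lin_eps smooth_eps sum_e]]]] := vb_finite E.
have epsP i (s : Sec E) : (fun x => eps i x (s x)) \in @smooth_pred R n M.
  by apply/asboolP; apply: smooth_eps; exact: secP.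
have eps_linear i (f : K) (u v : Sec E) :
    MkCinf (epsP i (f *: u + v)) = f * MkCinf (epsP i u) + MkCinf (epsP i v).
  apply: CinfP => x /=; exact: lin_eps.
exists N, (fun i => MkDual (eps_linear i)), (fun i => MkSec (smooth_e i)) => s.
by apply: sec_ext => x; rewrite sec_sumE; exact: sum_e.
Qed.

Lemma dualDE (V : lmodType K) (a b : dual V) v : (a + b) v = a v + b v. Proof. by []. Qed.
Lemma dualZE (V : lmodType K) (f : K) (a : dual V) v : (f *: a) v = f * a v. Proof. by []. Qed.
Lemma dualNE (V : lmodType K) (a : dual V) v : (- a) v = - a v.
Proof. by rewrite -scaleN1r dualZE mulN1r. Qed.
Lemma dual0E (V : lmodType K) v : (0 : dual V) v = 0. Proof. by []. Qed.
Lemma dual_sumE (V : lmodType K) N (a : 'I_N -> dual V) v :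
  (\sum_i a i : dual V) v = \sum_i a i v.
Proof. by apply: (big_morph (fun a : dual V => a v)). Qed.
Lemma dual_opp (V : lmodType K) (a : dual V) v : a (- v) = - a v.
Proof. by rewrite -scaleN1r dual_scale mulN1r. Qed.
Lemma dual_sum (V : lmodType K) (a : dual V) N (v : 'I_N -> V) :
  a (\sum_i v i) = \sum_i a (v i).
Proof. by apply: (big_morph a); [exact: dual_add|exact: dual_zero]. Qed.

Lemma dual_frame (V : lmodType K) N (eps : 'I_N -> dual V) (e : 'I_N -> V) (a : dual V) :
  is_frame eps e -> a = \sum_i a (e i) *: eps i.
Proof.
move=> eP; apply: dual_ext => v; rewrite dual_sumE {1}[v]eP dual_sum.
by apply: eq_bigr => i _; rewrite dual_scale dualZE mulrC.
Qed.

Section Pairs.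
Variables E F : lmodType K.
Lemma fstD (x y : E * F) : (x + y).1 = x.1 + y.1. Proof. by []. Qed.
Lemma sndD (x y : E * F) : (x + y).2 = x.2 + y.2. Proof. by []. Qed.
Lemma fstN (x : E * F) : (- x).1 = - x.1. Proof. by []. Qed.
Lemma sndN (x : E * F) : (- x).2 = - x.2. Proof. by []. Qed.
Lemma fstZ (f : K) (x : E * F) : (f *: x).1 = f *: x.1. Proof. by []. Qed.
Lemma sndZ (f : K) (x : E * F) : (f *: x).2 = f *: x.2. Proof. by []. Qed.
Lemma fst_sum N (x : 'I_N -> E * F) : (\sum_i x i).1 = \sum_i (x i).1.
Proof. by apply: (big_morph fst). Qed.
Lemma snd_sum N (x : 'I_N -> E * F) : (\sum_i x i).2 = \sum_i (x i).2.
Proof. by apply: (big_morph snd). Qed.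
End Pairs.
Definition pairE := (fstD, sndD, fstN, sndN, fstZ, sndZ).
Definition dualE := (dualDE, dualZE, dualNE, dual0E).
Definition dual_linE := (dual_add, dual_scale, dual_opp, dual_zero).

Variables (A B : lieAlgebroid M) (C : vectorBundle M).

Lemma pairQ_pairing : is_pairing (@pairQ R n M A C).
Proof.
split=> [f [a g] [a' g'] [c al]|f [a g] [c al] [c' al']];
  rewrite /pairQ !pairE /= ?dualE ?dual_linE; ring.
Qed.

(** Generators of A are matched with forms on A, and forms on C with generators of C, in the same
    order of indices; the mixed pairings vanish. *)
Lemma pairQ_frames : exists N (q : 'I_N -> Sec A * dual (Sec C)) (t : 'I_N -> Sec C * dual (Sec A)),
  dual_frames (@pairQ R n M A C) q t.
Proof.
have [NA [epsA [eA frA]]] := sec_frame A; have [NC [epsC [eC frC]]] := sec_frame C.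
exists (NA + NC)%N, (fun i : 'I_(NA + NC) => match fintype.split i with inl j => (eA j, 0) | inr j => (0, epsC j) end),
  (fun i : 'I_(NA + NC) => match fintype.split i with inl j => (0, epsA j) | inr j => (eC j, 0) end).
split=> [[a g]|[c al]]; rewrite big_split_ord /=.
  under eq_bigr do rewrite (unsplitK (inl _)) /pairQ /= dual_zero addr0.
  under [X in _ + X]eq_bigr do rewrite (unsplitK (inr _)) /pairQ /= add0r.
  apply: injective_projections; rewrite pairE ?fst_sum ?snd_sum /=.
    by rewrite -[LHS]addr0 {1}[a]frA; congr (_ + _); rewrite big1 // => i _; rewrite scaler0.
  by rewrite {1}[g](dual_frame _ frC) [X in _ = X + _]big1 ?add0r // => i _; rewrite scaler0.
under eq_bigr do rewrite (unsplitK (inl _)) /pairQ /= addr0.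
under [X in _ + X]eq_bigr do rewrite (unsplitK (inr _)) /pairQ /= dual_zero add0r.
apply: injective_projections; rewrite pairE ?fst_sum ?snd_sum /=.
  by rewrite {1}[c]frC [X in X + _]big1 ?add0r // => i _; rewrite scaler0.
by rewrite {1}[al](dual_frame _ frA) [X in _ + X]big1 ?addr0 // => i _; rewrite scaler0.
Qed.

End SectionFrames.

Section Connections.
Variables (R : realType) (n : nat) (M : smoothManifold R n).
Local Notation K := (Cinf M).
Variables (V E : lmodType K) (rho : V -> K -> K) (nab : V -> E -> E).
Hypothesis nabP : is_connection rho nab.

Lemma conn0 v : nab v 0 = 0.
Proof. by apply: (addIr (nab v 0)); rewrite -(conn_add nabP) !add0r. Qed.
Lemma connN v e : nab v (- e) = - nab v e.
Proof. by apply: (addIr (nab v e)); rewrite -(conn_add nabP) !addNr conn0. Qed.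
Lemma conn_lin e : is_linear (nab^~ e).
Proof. by move=> f u v; exact: conn_linear nabP f u v e. Qed.
Lemma connDl u v e : nab (u + v) e = nab u e + nab v e.
Proof. exact: is_linearD (conn_lin e) u v. Qed.
Lemma connNl v e : nab (- v) e = - nab v e. Proof. exact: is_linearN (conn_lin e) v. Qed.
Lemma conn0l e : nab 0 e = 0. Proof. exact: is_linear0 (conn_lin e). Qed.
Lemma connZl f v e : nab (f *: v) e = f *: nab v e. Proof. exact: is_linearZ (conn_lin e) f v. Qed.
Definition connE := (conn_add nabP, connN, conn0, conn_leibniz nabP, connDl, connNl, conn0l, connZl).
End Connections.

Section Anchors.
Variables (R : realType) (n : nat) (M : smoothManifold R n).
Local Notation K := (Cinf M).
Variables (V : lmodType K) (rho : V -> K -> K) (rhoP : is_anchor rho).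
Lemma anchor_add u v f : rho (u + v) f = rho u f + rho v f.
Proof. by have := anchor_linear rhoP 1 u v f; rewrite scale1r mul1r. Qed.
Lemma anchor_zero f : rho 0 f = 0.
Proof. by apply: (addIr (rho 0 f)); rewrite -anchor_add !add0r. Qed.
Lemma anchor_scale g v f : rho (g *: v) f = g * rho v f.
Proof. by have := anchor_linear rhoP g v 0 f; rewrite anchor_zero !addr0. Qed.
Definition anchor_linE := (anchor_add, anchor_zero, anchor_scale).
End Anchors.

Section LieAlgebroids.
Variables (R : realType) (n : nat) (M : smoothManifold R n) (A : lieAlgebroid M).
Local Notation K := (Cinf M).
Let LA := la_axioms A.
Implicit Types (a u v : Sec A) (f : K).
Lemma la_addl u v a : la_br (u + v) a = la_br u a + la_br v a.
Proof. by rewrite !(la_skew LA _ a) (la_addr LA) opprD. Qed.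
Lemma la_leibnizl u f v : la_br (f *: v) u = f *: la_br v u - la_rho u f *: v.
Proof. by rewrite !(la_skew LA _ u) (la_leibniz LA) scalerN; zmodule. Qed.
Definition la_brE := (la_addr LA, la_addl, la_leibniz LA, la_leibnizl).
End LieAlgebroids.

Section DorfmanRepresentation.
Variables (R : realType) (n : nat) (M : smoothManifold R n).
Local Notation K := (Cinf M).
Variables (A B : lieAlgebroid M) (C : vectorBundle M) (DA : twoRep A (Sec C) (Sec B)).
Local Notation VQ := (Sec A * dual (Sec C))%type.
Local Notation WQ := (Sec C * dual (Sec A))%type.
Local Notation rho := (@la_rho R n M A).
Local Notation nabC := (tr_nab0 DA).
Local Notation nabB := (tr_nab1 DA).
Local Notation RA := (tr_R DA).
Let LA := la_axioms A.
Let rP := la_anchor LA.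
Let TA := tr_axioms DA.
Let nCP := tr_conn0 TA.
Let nBP := tr_conn1 TA.
Let RP := tr_2form TA.

Lemma differential_subproof (f : K) (g : K) (u v : Sec A) :
  rho (g *: u + v) f = g * rho u f + rho v f.
Proof. exact: anchor_linear rP g u v f. Qed.
Definition differential (f : K) : dual (Sec A) := MkDual (differential_subproof f).

(** The three maps determined by the representation: rho_Q^* d f lies in A', the dull bracket is the
    semi-direct bracket of A with C', and the transpose of d takes values in C', where the anchor
    and both connections vanish. *)
Definition sd_rs (f : K) : WQ := (0, differential f).
Definition sd_br (q1 q2 : VQ) : VQ :=
  ((la_br q1.1 q2.1), dual_nabla nCP q1.1 q2.2 - dual_nabla nCP q2.1 q1.2).
Definition sd_ds (xi : dual (Sec B)) : VQ := (0, transpose (tr_linear TA) xi).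

Lemma sd_R_2form : is_hom_2form (sd_R DA).
Proof.
split=> [[a g] [a' g'] f b b'|f [a g] [a' g'] [v h] b|[a g] [a' g'] b];
  apply: injective_projections; rewrite ?pairE /=.
- exact: (h2_linear RP).
- apply: dual_ext => v; rewrite ?dualE /= !(h2_linear RP) ?dual_linE; ring.
- exact: (h2_form RP).
- apply: dual_ext => z; rewrite ?dualE /= !(h2_form RP) ?dual_linE.
  by ring.
- exact: (h2_skew RP).
- apply: dual_ext => z; rewrite ?dualE /= !(h2_skew RP _ z) ?dual_linE; ring.
Qed.

(** A cyclic sum of the g_i applied to R_AB of the other two sections of A, from which total
    skew-symmetry is visible. *)
Lemma omega_sdE a1 g1 a2 g2 a3 g3 b :
  omega (@pairQ R n M A C) (sd_R DA) (a1, g1) (a2, g2) (a3, g3) b =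
  g3 (RA a1 a2 b) - g2 (RA a1 a3 b) + g1 (RA a2 a3 b).
Proof.
rewrite /omega /pairQ /sd_R /= ?dualE /= (h2_skew RP a3 a2) ?dual_linE; ring.
Qed.

Lemma sd_dorfman_axioms : dorfman_axioms (@pairQ R n M A C) (@rhoQ R n M A C)
  (sd_d DA) (sd_Delta DA) (sd_nabla DA) (sd_R DA) sd_rs sd_br sd_ds.
Proof.
split.
- by move=> [a g] f; rewrite /pairQ /= dual_zero addr0.
- move=> [a g] [a' g'] [c al]; rewrite /dull_pairing /pairQ /rhoQ /sd_br /= ?dualE /=.
  by rewrite ?(anchorE rP); ring.
- by move=> xi [c al]; rewrite /pairQ /= dual_zero add0r.
- split=> [[a g]|f [a g] [a' g'] h]; first exact: anchor_vf rP a.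
  exact: anchor_linear rP f a a' h.
- by move=> f [c al] [c' al']; exact: tr_linear TA f c c'.
- split=> [[a g] b b'|[a g] f b|f [a g] [a' g'] b].
  + exact: conn_add nBP a b b'.
  + exact: conn_leibniz nBP a f b.
  + exact: conn_linear nBP f a a' b.
- exact: sd_R_2form.
- move=> [a g] [c al] [c' al']; apply: injective_projections; rewrite ?pairE /= ?(connE nCP) //.
  apply: dual_ext => v; rewrite ?dualE /= ?dualE ?(connE nCP) ?dual_linE ?(anchorE rP); ring.
- move=> [a g] [a' g'] [c al]; apply: injective_projections; rewrite ?pairE /= ?(connE nCP) //.
  apply: dual_ext => v; rewrite ?dualE /= ?dualE (la_addl) ?dual_linE.
  by rewrite !(anchor_linE rP) ?(anchorE rP); ring.
- move=> [a g] f [c al]; apply: injective_projections; rewrite ?pairE /= ?(connE nCP) //.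
  apply: dual_ext => v; rewrite ?dualE /= ?dualE ?(connE nCP) ?dual_linE ?(anchorE rP) /rhoQ /=.
  by ring.
- move=> f [a g] [c al]; apply: injective_projections; rewrite ?pairE /= ?(connE nCP) ?scaler0 ?addr0 //.
  apply: dual_ext => v; rewrite ?dualE /= ?dualE la_leibnizl ?dual_linE /pairQ /=.
  by rewrite !(anchor_linE rP) ?(anchorE rP); ring.
- move=> [a g] f; apply: injective_projections; rewrite /= ?(connE nCP) //.
  apply: dual_ext => v; rewrite ?dualE /= (connE nCP) ?dual_linE (la_morph LA) /rhoQ /=.
  by rewrite ?(anchorE rP); ring.
- move=> [a g] [a' g']; apply: injective_projections; rewrite ?pairE /= ?opprB //.
  exact: la_skew LA a a'.
- by move=> [a g] [c al]; exact: tr_chain TA a c.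
- move=> xi1 xi2 b; rewrite /nabla_star /rhoQ /sd_nabla /sd_ds /=.
  by rewrite !(anchor_zero rP) !(conn0l nBP) !dual_zero; ring.
- move=> [a g] [a' g'] b; exact: (esym (tr_curv1 TA a a' b)).
- move=> [a1 g1] [a2 g2] [c al]; apply: injective_projections; rewrite /curvature ?pairE /=.
    by rewrite -(tr_curv0 TA).
  apply: dual_ext => v; rewrite ?dualE /= ?dualE /= ?dualE.
  rewrite (h2_skew RP v a2) -!(tr_curv0 TA) /curvature ?(anchorE rP) ?dual_linE.
  rewrite (la_jacobi LA a1 a2 v) !(la_morph LA) ?dual_linE ?(anchorE rP) /=.
  ring.
- move=> [a1 g1] [a2 g2] [a3 g3] b; rewrite !omega_sdE (h2_skew RP a2 a1) ?dual_linE; ring.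
- move=> [a1 g1] [a2 g2] [a3 g3] b; rewrite !omega_sdE (h2_skew RP a3 a2) ?dual_linE; ring.
- move=> [a1 g1] [a2 g2] [a3 g3] [a4 g4] b.
  have funD (phi psi : Sec B -> K) : (phi + psi) b = phi b + psi b by [].
  have funN (phi : Sec B -> K) : (- phi) b = - phi b by [].
  rewrite /koszul3 !(funD, funN) /nabla_star /sd_br /= !omega_sdE /rhoQ /sd_nabla /=.
  (* The differential of omega is linear in the four forms g_i; the coefficient of each is, up to an
     alternating sign, the Bianchi identity of R_AB on the other three sections. *)
  have closed u1 u2 u3 : nabC u1 (RA u2 u3 b) - RA u2 u3 (nabB u1 b) - (nabC u2 (RA u1 u3 b) -
      RA u1 u3 (nabB u2 b)) + (nabC u3 (RA u1 u2 b) - RA u1 u2 (nabB u3 b)) - RA (la_br u1 u2) u3 b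
      + RA (la_br u1 u3) u2 b - RA (la_br u2 u3) u1 b = 0.
    exact: (tr_closed TA u1 u2 u3 b).
  have := congr1 g4 (closed a1 a2 a3); have := congr1 g3 (closed a1 a2 a4).
  have := congr1 g2 (closed a1 a3 a4); have := congr1 g1 (closed a2 a3 a4).
  rewrite ?dual_linE ?dualE /= ?(anchorE rP) => e1 e2 e3 e4.
  have e0 (x1 x2 x3 x4 : K) : x1 = 0 -> x2 = 0 -> x3 = 0 -> x4 = 0 -> x4 - x3 + x2 - x1 = 0.
    by move=> -> -> -> ->; ring.
  by rewrite -[RHS](e0 _ _ _ _ e1 e2 e3 e4); ring.
Qed.

Lemma sd_d_rs f : sd_d DA (sd_rs f) = 0.
Proof. exact: is_linear0 (tr_linear TA). Qed.

End DorfmanRepresentation.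

Section SelfDualRepresentation.
Variables (R : realType) (n : nat) (M : smoothManifold R n).
Local Notation K := (Cinf M).
Variables (A B : lieAlgebroid M) (C : vectorBundle M) (DB : twoRep B (Sec C) (Sec A)).
Let LB := la_axioms B.
Let rP := la_anchor LB.
Let TB := tr_axioms DB.
Let nCP := tr_conn0 TB.
Let nAP := tr_conn1 TB.
Let RP := tr_2form TB.

(** The components in C and A are the axioms of the given 2-representation, those in A' and C' their
    transposes; transposition exchanges the two curvature conditions. *)
Lemma po_self_dual : is_self_dual_2rep (@pairQ R n M A C) (@la_rho R n M B) (@la_br R n M B)
  (po_d DB) (po_nablaQd DB) (po_nablaQ DB) (po_R DB).
Proof.
split; last first.
  split=> [[c al] [c' al']|b [a g] [c al]|b1 b2 [a g] [a' g']]; rewrite /pairQ /=.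
  - by ring.
  - by rewrite ?(anchorE rP); ring.
  - by rewrite ?dualNE /=; ring.
split.
- move=> f [c al] [c' al']; apply: injective_projections; rewrite ?pairE /=; first exact: (tr_linear TB).
  by apply: dual_ext => v; rewrite ?dualE /= ?dualE.
- split=> [b [c al] [c' al']|b f [c al]|f b b' [c al]]; apply: injective_projections;
    rewrite ?pairE /= ?(connE nCP) //; apply: dual_ext => v;
    rewrite ?dualE /= ?dualE ?(connE nAP) ?dual_linE ?(anchor_linE rP) ?(anchorE rP); ring.
- split=> [b [a g] [a' g']|b f [a g]|f b b' [a g]]; apply: injective_projections;
    rewrite ?pairE /= ?(connE nAP) //; apply: dual_ext => v;
    rewrite ?dualE /= ?dualE ?(connE nCP) ?dual_linE ?(anchor_linE rP) ?(anchorE rP); ring.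
- split=> [b b' f [a g] [a' g']|f b b' e [a g]|b b' [a g]]; apply: injective_projections; rewrite ?pairE /=.
  + exact: (h2_linear RP).
  + by apply: dual_ext => v; rewrite ?dualE /= ?dualE; ring.
  + exact: (h2_form RP).
  + by apply: dual_ext => v; rewrite ?dualE /= (h2_form RP) ?dual_linE; ring.
  + exact: (h2_skew RP).
  + by apply: dual_ext => v; rewrite ?dualE /= (h2_skew RP) ?dual_linE; ring.
- move=> b [c al]; apply: injective_projections => /=; first exact: (tr_chain TB).
  by apply: dual_ext => v /=; rewrite (tr_chain TB).
- move=> b b' [c al]; apply: injective_projections; rewrite /curvature ?pairE /=.
    by rewrite -(tr_curv0 TB).
  apply: dual_ext => v; rewrite ?dualE /= -(tr_curv1 TB) /curvature ?dual_linE (la_morph LB).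
  by rewrite ?(anchorE rP); ring.
- move=> b b' [a g]; apply: injective_projections; rewrite /curvature ?pairE /=.
    by rewrite -(tr_curv1 TB).
  apply: dual_ext => v; rewrite ?dualE /= -(tr_curv0 TB) /curvature ?dual_linE (la_morph LB).
  by rewrite ?(anchorE rP); ring.
- move=> b1 b2 b3 [a g].
  have closed v : tr_nab0 DB b1 (tr_R DB b2 b3 v) - tr_R DB b2 b3 (tr_nab1 DB b1 v)
      - (tr_nab0 DB b2 (tr_R DB b1 b3 v) - tr_R DB b1 b3 (tr_nab1 DB b2 v))
      + (tr_nab0 DB b3 (tr_R DB b1 b2 v) - tr_R DB b1 b2 (tr_nab1 DB b3 v))
      - tr_R DB (la_br b1 b2) b3 v + tr_R DB (la_br b1 b3) b2 v - tr_R DB (la_br b2 b3) b1 v = 0.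
    exact: (tr_closed TB b1 b2 b3 v).
  have funD (phi psi : Sec A * dual (Sec C) -> Sec C * dual (Sec A)) e :
    (phi + psi) e = phi e + psi e by [].
  have funN (phi : Sec A * dual (Sec C) -> Sec C * dual (Sec A)) e : (- phi) e = - phi e by [].
  rewrite /koszul2 !(funD, funN) /nabla_hom; apply: injective_projections; rewrite ?pairE /=.
    exact: closed.
  apply: dual_ext => v; rewrite ?dualE /= ?dualE /= ?(anchorE rP).
  have := congr1 g (closed v); rewrite ?dual_linE => e.
  by rewrite -[RHS]oppr0 -[X in _ = - X]e; ring.
Qed.

End SelfDualRepresentation.

(** * Consequences of the matched pair axioms *)

Section MatchedPairs.
Variables (R : realType) (n : nat) (M : smoothManifold R n).
Local Notation K := (Cinf M).
Variables (A B : lieAlgebroid M) (C : vectorBundle M).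
Variables (DA : twoRep A (Sec C) (Sec B)) (DB : twoRep B (Sec C) (Sec A)).
Hypothesis MP : matched_pair DA DB.
Local Notation rA := (@la_rho R n M A).
Local Notation rB := (@la_rho R n M B).
Local Notation dB := (tr_d DA).
Local Notation dA := (tr_d DB).
Local Notation AB := (tr_nab1 DA).
Local Notation BA := (tr_nab1 DB).
Local Notation RAB := (tr_R DA).
Let TA := tr_axioms DA.
Let TB := tr_axioms DB.
Let LA := la_axioms A.
Let LB := la_axioms B.
Let rAP := la_anchor LA.
Let rBP := la_anchor LB.
Let nACP := tr_conn0 TA.
Let nABP := tr_conn1 TA.
Let nBCP := tr_conn0 TB.
Let nBAP := tr_conn1 TB.

Lemma matched_pair_sym : matched_pair DB DA.
Proof.
split.
- by move=> c1 c2; rewrite addrC [RHS]addrC -(mp1 MP).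
- exact: (mp3 MP).
- exact: (mp2 MP).
- move=> b a c; have := congr1 -%R (mp4 MP a b c); rewrite opprB => <-; zmodule.
- exact: (mp6 MP).
- exact: (mp5 MP).
- by move=> b1 b2 a1 a2; rewrite (mp7 MP).
Qed.

Lemma eq_of_subr (E : zmodType) (x x' z z' : E) : x = x' -> z - z' = x - x' -> z = z'.
Proof. by move=> -> /eqP; rewrite subrr subr_eq0 => /eqP. Qed.

(** Reduces z = 0 to exhibiting z as a signed combination of known equalities, an identity left to
    [ring] or [zmodule]. *)
Lemma subr_eq0_comb3 (E : zmodType) (x1 y1 x2 y2 x3 y3 z : E) :
  x1 = y1 -> x2 = y2 -> x3 = y3 -> z = (x1 - y1) + (x2 - y2) - (x3 - y3) -> z = 0.
Proof. by move=> -> -> -> ->; rewrite !subrr subr0 addr0. Qed.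

Lemma subr_eq0_comb (E : zmodType) (x x' y y' z : E) :
  x = x' -> y = y' -> z = (x - x') - (y - y') -> z = 0.
Proof. by move=> -> -> ->; rewrite !subrr. Qed.

(* Replacing c2 by f c2 in the first axiom of matched pairs. *)
Lemma anchor_core f c : rA (dA c) f = rB (dB c) f.
Proof.
have phiP (g : K) u v : rA (dA (g *: u + v)) f - rB (dB (g *: u + v)) f =
    g * (rA (dA u) f - rB (dB u) f) + (rA (dA v) f - rB (dB v) f).
  by rewrite (tr_linear TA) (tr_linear TB) !(anchor_linear rAP) !(anchor_linear rBP); ring.
have phi0 (u v : Sec C) : MkDual phiP u *: v = 0.
  have := mp1 MP u (f *: v).
  rewrite (conn_leibniz nACP) (conn_leibniz nBCP) !(is_linearZ (tr_linear TA)) !(is_linearZ (tr_linear TB)).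
  rewrite !(connZl nACP) !(connZl nBCP) => e1.
  have := congr1 (fun x => f *: x) (mp1 MP u v); rewrite /= !(scalerDr, scalerN) => e2.
  by rewrite scalerBl; apply: (subr_eq0_comb e1 e2); zmodule.
by apply/eqP; rewrite -subr_eq0; apply/eqP; exact: (dual_mulV_eq0 phi0 c).
Qed.

(* Replacing a2 by f a2 in the fifth axiom of matched pairs. *)
Lemma anchor_comm a b f :
  rA a (rB b f) = rB b (rA a f) + rB (AB a b) f - rA (BA b a) f.
Proof.
(* The expression is linear over functions in a: the derivative of g along b comes from the second
   and the last terms with opposite signs. *)
have phiP (g : K) u v :
    rA (g *: u + v) (rB b f) - rB b (rA (g *: u + v) f) - rB (AB (g *: u + v) b) f
      + rA (BA b (g *: u + v)) f =
    g * (rA u (rB b f) - rB b (rA u f) - rB (AB u b) f + rA (BA b u) f) +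
    (rA v (rB b f) - rB b (rA v f) - rB (AB v b) f + rA (BA b v) f).
  rewrite (conn_linear nABP) !(connE nBAP) !(anchor_linE rAP) !(anchor_linE rBP).
  by rewrite !(anchorE rBP); ring.
have phi0 (u v : Sec A) : MkDual phiP u *: v = 0.
  have e1 := mp5 MP u (f *: v) b.
  have := congr1 (fun x => f *: x) (mp5 MP u v b); rewrite /= => e2.
  have RZ : RAB u (f *: v) b = f *: RAB u v b.
    rewrite !(h2_skew (tr_2form TA) u) scalerN; congr (- _).
    exact: (is_linearZ (fun g x y => h2_form (tr_2form TA) g x y u b)).
  move: e1 e2; rewrite RZ (is_linearZ (tr_linear TB)) ?la_brE ?(connE nABP) ?(connE nBAP) ?la_brE.
  rewrite !(scalerDr, scalerN) !(scalerDl, scaleNr) => e1 e2.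
  by apply: (subr_eq0_comb (esym e1) (esym e2)); zmodule.
have := dual_mulV_eq0 phi0 a; rewrite /= => e.
by rewrite -[LHS]subr0 -[X in _ - X = _]e; ring.
Qed.

(** The two anchor identities give [pc_01] and [pc_20]. The C and A' components of [pc_11] are
    axioms 1 and 2, [pc_21U] is axiom 3, [pc_21V] combines axioms 4 and 5, [pc_22U] is axiom 6 and
    [pc_22V] is axiom 7. *)
Lemma matched_pair_compatible : poisson_compatible (@pairQ R n M A C) (@rhoQ R n M A C)
  (sd_d DA) (sd_Delta DA) (sd_nabla DA) (sd_R DA) (@sd_rs R n M A C) (sd_br DA)
  rB (@la_br R n M B) (po_d DB) (po_nablaQd DB) (po_nablaQ DB) (po_R DB).
Proof.
split.
- move=> f [c al]; rewrite /pairQ /po_d /sd_d /sd_rs /= (is_linear0 (tr_linear TB)) dual_zero.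
  by rewrite add0r anchor_core.
- by move=> [a g] b f; rewrite /rhoQ /sd_nabla /= anchor_comm; ring.
- move=> [c al] [c' al']; apply: injective_projections; rewrite ?pairE /=.
    by rewrite /sd_d /=; apply: (eq_of_subr (mp1 MP c c')); zmodule.
  apply: dual_ext => v; rewrite ?dualE /= ?dualE /sd_d /pairQ /=.
  (* The Lie derivatives along [dA c] and [dA c'] evaluate forms on brackets with v, which the
     second axiom computes. *)
  have e := mp2 MP v c; have e' := mp2 MP v c'.
  rewrite (la_skew LA (dA c')) (la_skew LA (dA c)) e e' ?dual_linE !(anchorE rAP).
  by rewrite ?dualE !anchor_core; ring.
- by move=> b [c al]; rewrite /sd_d /sd_nabla /= (mp3 MP).
- move=> [a g] [a' g'] b [c al].
  have := congr1 g (mp4 MP a' b c); have := congr1 g' (mp4 MP a b c).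
  have := congr1 al (mp5 MP a' a b).
  rewrite /pairQ /rhoQ /sd_nabla /= ?dualE /= ?dualE /= ?dual_linE.
  rewrite /sd_d /= ?(anchorE rAP) ?(anchorE rBP) ?anchor_comm ?(anchorE rBP) => e1 e2 e3.
  (* Axiom 5 is paired with the form in A', axiom 4 with the two forms in C', once for each section
     of A. *)
  by apply: (subr_eq0_comb3 e1 e2 e3); ring.
- move=> [a g] b c; rewrite /sd_d /sd_nabla /= (mp6 MP) (la_skew LB (AB a b)).
  zmodule.
- move=> [a g] [a' g'] [a'' g''] b c /=.
  have := congr1 g (mp7 MP a' a'' b c); have := congr1 g' (mp7 MP a a'' b c).
  have := congr1 g'' (mp7 MP a a' b c).
  rewrite /koszul1 /nabla_alt2.
  rewrite /pairQ /rhoQ /sd_nabla /= ?dualE /= ?dualE /= ?dual_linE => e1 e2 e3.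
  have sA := h2_skew (tr_2form TA); have sB := h2_skew (tr_2form TB).
  (* The curvatures are brought to a common order of their two arguments before [ring]. *)
  rewrite !(sA a'' a') !(sA (BA _ a'') a') !(sA a'' (BA _ a')) !(sB c (AB _ _)).
  rewrite !(connN nBCP) ?dual_linE !(anchorE rAP) !(anchorE rBP).
  (* The alternating sum of axiom 7 over the three forms in C' is the opposite of the left-hand
     side. *)
  suff : forall z : K, - z = 0 -> z = 0 by apply; apply: (subr_eq0_comb3 e1 e3 e2); ring.
  by move=> z /eqP; rewrite oppr_eq0 => /eqP.
Qed.

Lemma matched_pair_poisson : carries_split_poisson_lie2 DA DB.
Proof.
have pQ := pairQ_pairing A C.
have [N [q [t qt]]] := pairQ_frames A C; have [m [beta [bb bP]]] := sec_frame B.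
have DP := sd_dorfman_axioms DA; have SP := po_self_dual DB.
split.
- by exists (@sd_rs R n M A C), (sd_br DA), (sd_ds DA).
- exact: SP.
- exact: (homological_vf_exists pQ qt bP DP).
- exact: (self_dual_bracket_exists pQ qt bP LB SP).
- move=> Q br QP brP.
  exact: (split_poisson_lie2 pQ qt bP DP (@sd_d_rs _ _ _ _ _ _ DA) LB SP
    matched_pair_compatible QP brP).
Qed.

End MatchedPairs.

Theorem theorem7p6 (R : realType) (n : nat) (M : smoothManifold R n)
    (A B : lieAlgebroid M) (C : vectorBundle M)
    (DA : twoRep A (Sec C) (Sec B)) (DB : twoRep B (Sec C) (Sec A))
    (DADB : matched_pair DA DB) :
  carries_split_poisson_lie2 DA DB /\ carries_split_poisson_lie2 DB DA.
Proof.
split; first exact: matched_pair_poisson.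
exact: (matched_pair_poisson (matched_pair_sym DADB)).
Qed.
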